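(* Let $Y=(Y_n)_{n\in\mathbb{N}_0}$, $Y_n=\sum_{k=0}^n\sum_{i=1}^{J_k}X_{i,k}(n-k)$, be the Galton–Watson process with immigration described in the context. Suppose that $$\mathbb{P}\{\log J>x\}\sim x^{-\alpha}\ell(x),\qquad x\to\infty,$$ for some $\alpha\in(0,1]$ and some function $\ell$ slowly varying at $\infty$, and if $\alpha=1$ suppose additionally that $\lim_{x\to\infty}\ell(x)=\infty$. Let $(b_n)_{n\in\mathbb{N}}$ be positive numbers with $\lim_{n\to\infty}n\,\mathbb{P}\{\log J>b_n\}=1$. Then, as $n\to\infty$, $$\frac{\log^+\big(Y_{[n\cdot]}\big)}{b_n}\ \Rightarrow\ \sup_{t_k^{(1,\alpha)}\le\cdot} j_k^{(1,\alpha)},$$ weakly on the Skorokhod space $D[0,\infty)$ with the $J_1$-topology.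
   Context: $\mathbb{N}_0=\mathbb{N}\cup\{0\}$. The families $(X_{i,k})_{i\in\mathbb{N},k\in\mathbb{N}_0}$ and $(J_k)_{k\in\mathbb{N}_0}$ are mutually independent, each consisting of i.i.d. random objects; each $X_{i,k}=(X_{i,k}(n))_{n\in\mathbb{N}_0}$ is a Galton–Watson process with $X_{i,k}(0)=1$ and offspring mean $\mathbb{E}X_{i,k}(1)=\mu\in(0,\infty)$; each $J_k$ is a nonnegative integer-valued random variable with $\mathbb{P}\{J_k=0\}<1$, and $J$ denotes a random variable with the law of $J_k$. $\log^+x=\max(\log x,0)$, $[\cdot]$ is the integer part. For $a,b>0$, $N^{(a,b)}=\sum_{k}\varepsilon_{(t_k^{(a,b)},\,j_k^{(a,b)})}$ is a Poisson random measure on $[0,\infty)\times(0,\infty]$ with mean measure $\mathrm{Leb}\times\mu_{a,b}$, where $\mu_{a,b}((x,\infty])=ax^{-b}$ for $x>0$. The supremum over the empty set is $0$. *)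

(* Defs.v *)
From HB Require Import structures.
From mathcomp Require Import all_boot all_order all_algebra.
From mathcomp Require Import all_classical all_reals all_analysis.
From mathcomp Require Import measurable_realfun.
Set Implicit Arguments. Unset Strict Implicit. Unset Printing Implicit Defensive.
Import Order.TTheory GRing.Theory Num.Theory.
Import numFieldNormedType.Exports.
Local Open Scope classical_set_scope.
Local Open Scope ring_scope.

Section Defs.
Variable R : realType.

(** log^+ x = max(log x, 0), with log^+ 0 = 0. *)
Definition logp (x : R) : R := Num.max (ln x) 0.

Definition slowly_varying (l : R -> R) : Prop :=
  (exists a : R, (forall x, a < x -> 0 < l x) /\
                 measurable_fun [set x | a < x] l) /\
  forall lam : R, 0 < lam -> (l (lam * x) / l x) @[x --> +oo] --> (1 : R).

(** Skorokhod space D[0,oo): functions on [0,oo) (values at t<0 are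
    irrelevant) which are right-continuous with left limits. *)
Definition cadlag (x : R -> R) : Prop :=
  (forall t, 0 <= t -> x @ t^'+ --> x t) /\
  (forall t, 0 < t -> cvg (x @ t^'-)).

Definition time_change (lam : R -> R) : Prop :=
  lam 0 = 0 /\
  {within [set t | 0 <= t], continuous lam} /\
  (forall s t, 0 <= s -> s < t -> lam s < lam t) /\
  (forall y, 0 <= y -> exists2 t, 0 <= t & lam t = y).

(** J1 convergence in D[0,oo) (Billingsley 1999, Thm 16.2): there are time
    changes lam_n with sup_{t>=0} |lam_n t - t| -> 0 and, for every T > 0,
    sup_{0<=t<=T} |x_n (lam_n t) - x t| -> 0. *)
Definition J1_cvg (xs : nat -> R -> R) (x : R -> R) : Prop :=
  exists lams : nat -> R -> R,
    (forall n, time_change (lams n)) /\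
    (forall e : R, 0 < e ->
       \forall n \near \oo, forall t, 0 <= t -> `|lams n t - t| <= e) /\
    (forall T e : R, 0 < T -> 0 < e ->
       \forall n \near \oo, forall t, 0 <= t <= T ->
          `|xs n (lams n t) - x t| <= e).

(** (sequential, equivalently -- J1 being metrizable -- topological)
    continuity of a functional on (D[0,oo), J1). *)
Definition J1_continuous (f : (R -> R) -> R) : Prop :=
  forall (xs : nat -> R -> R) (x : R -> R),
    cadlag x -> (forall n, cadlag (xs n)) -> J1_cvg xs x ->
    f (xs n) @[n --> \oo] --> f x.

Definition bounded_functional (f : (R -> R) -> R) : Prop :=
  exists M : R, forall x, `|f x| <= M.

Definition D_weak_cvg {d} {Omega : measurableType d} (P : probability Omega R)
  (Z : nat -> Omega -> R -> R)
  {d'} {Omega' : measurableType d'} (Q : probability Omega' R)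
  (Zl : Omega' -> R -> R) : Prop :=
  forall f : (R -> R) -> R, bounded_functional f -> J1_continuous f ->
    (\int[P]_w (f (Z n w))%:E)%E @[n --> \oo] --> (\int[Q]_w (f (Zl w))%:E)%E.

Definition nat_rv {d} {Omega : measurableType d} (X : Omega -> nat) : Prop :=
  forall A : set nat, measurable (X @^-1` A).

Definition mutually_independent {d} {Omega : measurableType d}
  (P : probability Omega R) {I : eqType} (F : I -> Omega -> nat) : Prop :=
  forall (s : seq I) (A : I -> set nat), uniq s ->
    (P [set w | forall i, i \in s -> A i (F i w)] =
    \big[*%E/1%E]_(i <- s) P (F i @^-1` A i))%E.

(** X i k is built from offspring numbers xi i k m l (number of children of
    the l-th individual of generation m of the process X_{i,k}):
    X_{i,k}(0) = 1, X_{i,k}(m+1) = sum_{l < X_{i,k}(m)} xi_{i,k,m,l}. *)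
Fixpoint GW (xi : nat -> nat -> nat) (m : nat) : nat :=
  match m with
  | 0 => 1%N
  | m'.+1 => (\sum_(l < GW xi m') xi m' l)%N
  end.

Definition GWI {Omega : Type} (xi : nat -> nat -> nat -> nat -> Omega -> nat)
  (J : nat -> Omega -> nat) (n : nat) (w : Omega) : nat :=
  (\sum_(0 <= k < n.+1) \sum_(1 <= i < (J k w).+1)
      GW (fun m l => xi i k m l w) (n - k))%N.

Definition GWI_family {Omega : Type}
  (xi : nat -> nat -> nat -> nat -> Omega -> nat) (J : nat -> Omega -> nat)
  (ix : (nat * nat * nat * nat) + nat) : Omega -> nat :=
  match ix with
  | inl (i, k, m, l) => xi i k m l
  | inr k => J k
  end.

Definition poisson_pmf (lam : R) (k : nat) : R :=
  expR (- lam) * lam ^+ k / (k `!)%:R.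

(** mean measure Leb x mu on [0,oo) x (0,oo], computed as in the
    definition of the product measure: B |-> int_{[0,oo)} mu(B_t) dt. *)
Definition mean_measure (mu : set (\bar R) -> \bar R)
  (B : set (R * \bar R)) : \bar R :=
  (\int[lebesgue_measure]_(t in [set t : R | (0 <= t)%R]) mu (xsection B t))%E.

Definition is_mu_ab (a b : R) (mu : measure (\bar R) R) : Prop :=
  mu [set y : \bar R | (y <= 0)%E] = 0%E /\
  forall x : R, 0 < x -> mu [set y : \bar R | (x%:E < y)%E] = (a * x `^ (- b))%:E.

Definition count_pts {Omega : Type} (t : nat -> Omega -> R)
  (j : nat -> Omega -> \bar R) (w : Omega) (B : set (R * \bar R)) : \bar R :=
  (\sum_(0 <= k <oo) (if `[< B (t k w, j k w) >] then 1 else 0)%:E)%E.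

Definition is_PRM {d} {Omega : measurableType d} (Q : probability Omega R)
  (t : nat -> Omega -> R) (j : nat -> Omega -> \bar R)
  (m : set (R * \bar R) -> \bar R) : Prop :=
  (forall k, measurable_fun setT (t k)) /\ (forall k, measurable_fun setT (j k)) /\
  forall (n : nat) (B : 'I_n -> set (R * \bar R)) (c : 'I_n -> nat),
    (forall i, measurable (B i)) ->
    (forall i, (m (B i) < +oo)%E) ->
    (forall i i', i != i' -> B i `&` B i' = set0) ->
    (Q [set w | forall i, count_pts t j w (B i) = (c i)%:R%:E] =
    (\prod_(i < n) poisson_pmf (fine (m (B i))) (c i))%:E)%E.

Definition sup0 (A : set (\bar R)) : \bar R :=
  if `[< A = set0 >] then 0%E else ereal_sup A.

Definition sup_process {Omega : Type} (t : nat -> Omega -> R)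
  (j : nat -> Omega -> \bar R) (w : Omega) (s : R) : R :=
  fine (sup0 [set j k w | k in [set k | t k w <= s]]).

End Defs.

(* Main.v *)
Require Import Defs.
From HB Require Import structures.
From mathcomp Require Import all_boot all_order all_algebra.
From mathcomp Require Import all_classical all_reals all_analysis.
From mathcomp Require Import measurable_realfun.
From mathcomp Require Import ring lra.
Import Order.TTheory GRing.Theory Num.Theory.
Import numFieldNormedType.Exports.
Local Open Scope classical_set_scope.
Local Open Scope ring_scope.
Set Implicit Arguments. Unset Strict Implicit. Unset Printing Implicit Defensive.

(** Write G x = P(log J > x). Since the tail G is monotone and G(2x)/G(x) tends to
    2^-alpha, x G(x) tends to infinity (for alpha = 1 because l does), so n = o(b_n).
    Offspring numbers have finite mean and are positive with positive probability, so
    over a horizon of order n the progeny of J immigrants is J up to factors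
    exp(o(b_n)): log^+ Y_m / b_n is uniformly close to max_(k <= m) log J_k / b_n,
    the running maximum of the points (k / n, log J_k / b_n).

    J1-continuous functionals are only sequentially continuous, so convergence is
    proved by a discretization. Cut time into small columns and label a configuration
    by the rounded height of its highest point in each column. Outside an event of
    small probability every column carries at most one point above the level e,
    strictly inside the column, and then any two paths with the same label are J1-close:
    a piecewise linear time change aligns their jumps. The label laws converge because
    they are determined by the probabilities that boxes are free of points, and these
    are products of powers of 1 - G(y b_n) on one side and exponentials on the other.
    Bounding f on each cell by its supremum and infimum squeezes the integrals; the
    gap vanishes by Borel-Cantelli and dominated convergence. *)

(** * Time changes *)

(** Functionals are not assumed measurable, so weak convergence cannot be read off from laws on path
    space. The integral of an arbitrary function is still monotone, and the supremum and infimum of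
    [f] over a cell depend on a finite label only, hence are simple functions. A label is a vector
    of column maxima, so its lower orthants are void events of unions of disjoint boxes. The
    population bounds must hold for all times up to the horizon at once and for heavy-tailed [J].
    Conditioning on [J] is avoided on both sides. Above, the [i]-th immigrant gets weight [1 / i],
    which costs only a factor [1 + ln N] in the mean although [N] is of order [exp (H * b n)].
    Below, all potential immigrants are cut into blocks of length about [exp (del * b n)], and each
    block must contain one whose line of first children survives; this line lasts with probability
    [p^K], which is [exp (- o(b n))] because [K] is of order [n]. *)

Section time_changes.
Variable R : realType.
Implicit Types (l r s t u : R).

(** The identity plus a multiple of a tent that is 1 at [s] and 0 outside ]l, r[: the piecewise
    linear map with vertices (l, l), (s, s'), (r, r). This form makes continuity immediate. *)
Definition tent_bump l r s s' t : R :=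
  t + (s' - s) * Num.max 0 (Num.min ((t - l) / (s - l)) ((r - t) / (r - s))).

Lemma tent_bump_left l r s s' t : l < s -> s < r -> t <= l ->
  tent_bump l r s s' t = t.
Proof.
move=> ls sr tl; rewrite /tent_bump (_ : Num.max _ _ = 0) ?mulr0 ?addr0//.
apply: max_l; rewrite ge_min; apply/orP; left.
by rewrite pmulr_lle0 ?subr_le0// invr_gt0 subr_gt0.
Qed.

Lemma tent_bump_right l r s s' t : l < s -> s < r -> r <= t ->
  tent_bump l r s s' t = t.
Proof.
move=> ls sr tl; rewrite /tent_bump (_ : Num.max _ _ = 0) ?mulr0 ?addr0//.
apply: max_l; rewrite ge_min; apply/orP; right.
by rewrite pmulr_lle0 ?subr_le0// invr_gt0 subr_gt0.
Qed.

Lemma tent_bump_up l r s s' t : l < s -> s < r -> l <= t <= s ->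
  tent_bump l r s s' t = l + (t - l) * ((s' - l) / (s - l)).
Proof.
move=> ls sr /andP[lt ts]; rewrite /tent_bump.
have sl0 : 0 < s - l by rewrite subr_gt0.
have rs0 : 0 < r - s by rewrite subr_gt0.
rewrite min_l; last first.
  rewrite (@le_trans _ _ 1)//.
    by rewrite ler_pdivrMr// mul1r lerD2r.
  by rewrite ler_pdivlMr// mul1r lerB.
rewrite max_r; last by rewrite divr_ge0// ?subr_ge0// ltW.
field; exact: lt0r_neq0.
Qed.

Lemma tent_bump_down l r s s' t : l < s -> s < r -> s <= t <= r ->
  tent_bump l r s s' t = r - (r - t) * ((r - s') / (r - s)).
Proof.
move=> ls sr /andP[lt ts]; rewrite /tent_bump.
have sl0 : 0 < s - l by rewrite subr_gt0.
have rs0 : 0 < r - s by rewrite subr_gt0.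
rewrite min_r; last first.
  rewrite (@le_trans _ _ 1)//.
    by rewrite ler_pdivrMr// mul1r lerB.
  by rewrite ler_pdivlMr// mul1r lerD2r.
rewrite max_r; last by rewrite divr_ge0// ?subr_ge0// ltW.
field; exact: lt0r_neq0.
Qed.

Section bump.
Variables l r s s' : R.
Hypotheses (ls : l < s) (sr : s < r) (ls' : l < s') (sr' : s' < r).
Local Notation B := (tent_bump l r s s').

Let k1 : 0 < (s' - l) / (s - l). Proof. by rewrite divr_gt0 ?subr_gt0. Qed.
Let k2 : 0 < (r - s') / (r - s). Proof. by rewrite divr_gt0 ?subr_gt0. Qed.

Let k1E : (s - l) * ((s' - l) / (s - l)) = s' - l.
Proof. by field; rewrite subr_eq0 gt_eqF. Qed.

Let k2E : (r - s) * ((r - s') / (r - s)) = r - s'.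
Proof. by field; rewrite subr_eq0 gt_eqF. Qed.

Lemma tent_bump_mono t u : t < u -> B t < B u.
Proof.
move=> tu; have [ul|ul] := leP u l.
  by rewrite !tent_bump_left// (le_trans (ltW tu)).
have [rt|rt] := leP r t.
  by rewrite !tent_bump_right// (le_trans rt (ltW tu)).
have [us|us] := leP u s.
  rewrite (tent_bump_up _ ls sr (t := u)) ?us ?ltW//.
  have [tl|tl] := leP t l.
    rewrite tent_bump_left// (le_lt_trans tl)// ltrDl mulr_gt0// subr_gt0//.
  rewrite tent_bump_up ?(ltW tl) ?(le_trans (ltW tu))// ltrD2l ltr_pM2r//.
  by rewrite ltrD2r.
have [ru|ru] := leP r u.
  rewrite (tent_bump_right _ ls sr ru).
  have [tl|tl] := leP t l.
    by rewrite tent_bump_left.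
  have [ts|ts] := leP t s.
    rewrite tent_bump_up ?(ltW tl)// (lt_le_trans _ ru)//.
    rewrite -ltrBrDl (le_lt_trans (y := s' - l))// ?ltrD2r//.
    by rewrite -[leRHS]k1E ler_pM2r// lerD2r.
  rewrite tent_bump_down ?(ltW ts) ?(ltW rt)// (lt_le_trans _ ru)// ltrBlDr.
  by rewrite ltrDl mulr_gt0// subr_gt0.
rewrite (tent_bump_down _ ls sr (t := u)) ?(ltW us) ?(ltW ru)//.
have s'B : s' < r - (r - u) * ((r - s') / (r - s)).
  by rewrite ltrBrDl -ltrBrDr -[ltRHS]k2E ltr_pM2r// ltrD2l ltrN2.
have [tl|tl] := leP t l.
  by rewrite tent_bump_left// (le_lt_trans tl)// (lt_trans ls').
have [ts|ts] := leP t s.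
  rewrite tent_bump_up ?(ltW tl)// (le_lt_trans _ s'B)// -lerBrDl.
  by rewrite -[leRHS]k1E ler_pM2r// lerD2r.
rewrite tent_bump_down ?(ltW ts) ?(ltW rt)//.
by rewrite ltrD2l ltrN2 ltr_pM2r// ltrD2l ltrN2.
Qed.

Lemma tent_bump_l : B l = l. Proof. by rewrite tent_bump_left. Qed.
Lemma tent_bump_r : B r = r. Proof. by rewrite tent_bump_right. Qed.
Lemma tent_bump_s : B s = s'.
Proof. by rewrite tent_bump_up ?lexx ?andbT ?ltW// k1E addrC subrK. Qed.

Lemma tent_bump_continuous : continuous B.
Proof.
move=> t; rewrite /tent_bump; apply: cvgD; first exact: cvg_id.
apply: cvgM; first exact: cvg_cst.
pose f u : R^o := (u - l) / (s - l); pose g u : R^o := (r - u) / (r - s).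
have /(_ _ _)/= H := @continuous_max R R (cst 0) (f \min g) t.
apply: H; first exact: cvg_cst.
by apply: continuous_min; apply: cvgM; try exact: cvg_cst;
  apply: cvgB; try exact: cvg_cst; exact: cvg_id.
Qed.

End bump.

Lemma mono_le (g : R -> R) : (forall t u, t < u -> g t < g u) ->
  forall t u, t <= u -> g t <= g u.
Proof. by move=> gm t u; rewrite le_eqVlt => /predU1P[->//|/gm/ltW]. Qed.

Lemma surj_of_id_after (g : R -> R) (T : R) : g 0 = 0 -> continuous g ->
  (forall t, T <= t -> g t = t) ->
  forall y, 0 <= y -> exists2 t, 0 <= t & g t = y.
Proof.
(* [M] is a fixed point of [g] that is at least [y], so the intermediate value theorem applies on
   [0, M]. *)
move=> g0 gc gT y y0; pose M := Num.max y T.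
have M0 : 0 <= M by rewrite /M le_max y0.
have gM : g M = M by apply: gT; rewrite /M le_max lexx orbT.
have [|||c] := @IVT R g 0 M y => //.
- by apply: continuous_subspaceT => ?; exact: gc.
- by rewrite g0 gM min_l// max_r// y0 /= /M le_max lexx.
- by rewrite in_itv /= => /andP[c0 _] gcy; exists c.
Qed.

(** One bump per column is composed. The composite built so far is the identity to the right of its
    columns and the new bump is the identity to the left of its own, so they do not interfere. Every
    column is mapped into itself, hence no point moves by more than [h]. *)
Lemma column_time_change (h : R) (A : nat) (s s' : nat -> R) : 0 < h ->
  (forall a, (a < A)%N -> a%:R * h < s a < a.+1%:R * h) ->
  (forall a, (a < A)%N -> a%:R * h < s' a < a.+1%:R * h) ->
  exists lam : R -> R, [/\ time_change lam,
    forall t, 0 <= t -> `|lam t - t| <= h &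
    forall a, (a < A)%N -> forall t,
      (a%:R * h <= t < s a -> a%:R * h <= lam t < s' a) /\
      (s a <= t < a.+1%:R * h -> s' a <= lam t < a.+1%:R * h)].
Proof.
move=> h0 sA s'A.
suff [lam [lam0 lamc lamm lamA lamcol]] : exists lam : R -> R,
  [/\ lam 0 = 0, continuous lam, (forall t u, t < u -> lam t < lam u),
    (forall t, A%:R * h <= t -> lam t = t) &
    forall a, (a < A)%N -> forall t,
      (a%:R * h <= t < s a -> a%:R * h <= lam t < s' a) /\
      (s a <= t < a.+1%:R * h -> s' a <= lam t < a.+1%:R * h)].
  exists lam; split => //.
  - split=> //; split; first by apply: continuous_subspaceT => ?; exact: lamc.
    split; first by move=> t u _; exact: lamm.
    exact: surj_of_id_after lamA.
  - move=> t t0; have [At|tA] := leP (A%:R * h) t.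
      by rewrite lamA// subrr normr0 ltW.
    pose a := Num.truncn (t / h).
    have th0 : 0 <= t / h by rewrite divr_ge0// ltW.
    have /andP[at1 ta2] := truncn_itv th0.
    rewrite ler_pdivlMr// in at1; rewrite ltr_pdivrMr// in ta2.
    have aA : (a < A)%N.
      rewrite -(ltr_nat R) -(ltr_pM2r h0); exact: le_lt_trans tA.
    have [sa1 sa2] := andP (sA _ aA); have [sb1 sb2] := andP (s'A _ aA).
    have [c1 c2] := lamcol _ aA t.
    have aS : a.+1%:R * h = a%:R * h + h by rewrite -natr1 mulrDl mul1r.
    rewrite -/a aS in at1 ta2 sa2 sb2 c1 c2.
    rewrite ler_norml.
    have [ts|ts] := ltP t (s a).
      have /andP[] := c1 (introT andP (conj at1 ts)); lra.
    have /andP[] := c2 (introT andP (conj ts ta2)); lra.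
elim: A sA s'A => [_ _|A IH sA s'A].
  by exists id; split => // t; exact: cvg_id.
have [a aA|a aA|lam [lam0 lamc lamm lamA lamcol]] := IH.
- by apply: sA; rewrite ltnS ltnW.
- by apply: s'A; rewrite ltnS ltnW.
have [sl sr] := andP (sA A (ltnSn A)).
have [sl' sr'] := andP (s'A A (ltnSn A)).
set l := A%:R * h in sl sl' lamA *; set r := A.+1%:R * h in sr sr' *.
have l0 : 0 <= l by rewrite mulr_ge0// ltW.
have lr : l < r by exact: lt_trans sl sr.
pose B := tent_bump l r (s A) (s' A).
have Bm := tent_bump_mono sl sr sl' sr'.
exists (B \o lam); split => /=.
- by rewrite lam0 /B tent_bump_left.
- move=> t; apply: continuous_comp; first exact: lamc.
  exact: tent_bump_continuous.
- by move=> t u tu; apply: Bm; exact: lamm.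
- move=> t rt; rewrite lamA; last by apply: le_trans rt; exact: ltW.
  by rewrite /B tent_bump_right.
move=> a; rewrite ltnS leq_eqVlt => /predU1P[->{a} t|aA t].
  rewrite -/l -/r; split=> /andP[t1 t2].
    rewrite lamA//; apply/andP; split.
      by rewrite -(tent_bump_l (s' A) sl sr); apply: mono_le.
    rewrite -[ltRHS](tent_bump_s (s' A) sl sr); exact: Bm.
  rewrite lamA; last by apply: le_trans t1; exact: ltW.
  apply/andP; split.
    rewrite -[leLHS](tent_bump_s (s' A) sl sr); exact: mono_le.
  by rewrite -[ltRHS](tent_bump_r (s' A) sl sr); exact: Bm.
have Sal : a.+1%:R * h <= l by rewrite ler_pM2r// ler_nat.
have [c1 c2] := lamcol _ aA t.
have Bid : t < a.+1%:R * h -> B (lam t) = lam t.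
  move=> ta; rewrite /B tent_bump_left//; apply: ltW.
  rewrite -[ltRHS]lamA//; apply: lamm; exact: lt_le_trans Sal.
have [sa1 sa2] := andP (sA _ (ltnW aA : (a < A.+1)%N)).
split=> /[dup] /andP[t1 t2].
  by move=> /c1; rewrite Bid//; exact: lt_trans sa2.
by move=> /c2; rewrite Bid.
Qed.

End time_changes.

(** * Cells of paths close to a common step function *)

Section cells.
Variable R : realType.
Implicit Types (e h H : R) (x y z : R -> R) (t : nat -> R) (j : nat -> \bar R).

(** A single parameter bounds the time change and the values and sets the horizon, so that closeness
    with parameters tending to 0 gives [J1_cvg]. *)
Definition J1_close e x y := exists lam : R -> R, [/\ time_change lam,
  forall s, 0 <= s -> `|lam s - s| <= e &
  forall s, 0 <= s <= e^-1 -> `|y (lam s) - x s| <= e].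

(** The running maximum before column [a]; at [a.+1] it includes column [a] and is the level after
    the jump there. *)
Definition cell_height e (c : nat -> nat) (a : nat) : R :=
  (\max_(i < a) c i)%:R * e.

(* Paths within 2 e of a step function with one jump, at an unspecified time,
   inside each of the columns [a h, (a+1) h[, a < A. *)
Definition step_cell h (A : nat) e (c : nat -> nat) : set (R -> R) :=
  [set z | exists s : nat -> R, forall a, (a < A)%N ->
    [/\ a%:R * h < s a < a.+1%:R * h,
       forall u, a%:R * h <= u < s a -> `|z u - cell_height e c a| <= 2 * e &
       forall u, s a <= u < a.+1%:R * h ->
         `|z u - cell_height e c a.+1| <= 2 * e]].

Lemma in_column h (A : nat) (u : R) : 0 < h -> 0 <= u < A%:R * h ->
  exists2 a, (a < A)%N & a%:R * h <= u < a.+1%:R * h.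
Proof.
move=> h0 /andP[u0 uA].
have th0 : 0 <= u / h by rewrite divr_ge0// ltW.
have /andP[at1 ta2] := truncn_itv th0.
rewrite ler_pdivlMr// in at1; rewrite ltr_pdivrMr// in ta2.
exists (Num.truncn (u / h)); last by rewrite at1.
rewrite -(ltr_nat R) -(ltr_pM2r h0); exact: le_lt_trans uA.
Qed.

(** The time change carries the jump times of [x] to those of [y]; on either side of a jump both
    paths are within [2 * e] of the same height, whence [4 * e]. *)
Lemma step_cell_close h A e c d x y : 0 < h -> h <= d -> 4 * e <= d ->
  d^-1 < A%:R * h -> step_cell h A e c x -> step_cell h A e c y ->
  J1_close d x y.
Proof.
move=> h0 hd ed dA [s sP] [s' s'P].
have [|a aA|a aA|lam [lamt lamh lamcol]] := @column_time_change R h A s s' => //.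
- by have [] := sP _ aA.
- by have [] := s'P _ aA.
exists lam; split => // u.
  by move=> u0; apply: le_trans hd; exact: lamh.
move=> /andP[u0 ud].
have [|a aA /andP[u1 u2]] := @in_column h A u h0.
  by rewrite u0 (le_lt_trans ud).
have [_ xl xr] := sP _ aA; have [_ yl yr] := s'P _ aA.
have [cl cr] := lamcol _ aA u.
apply: le_trans ed; rewrite (_ : 4 * e = 2 * e + 2 * e); last by ring.
have [us|us] := ltP u (s a).
  have := xl _ (introT andP (conj u1 us)).
  have := yl _ (cl (introT andP (conj u1 us))).
  by rewrite !ler_norml; lra.
have := xr _ (introT andP (conj us u2)).
have := yr _ (cr (introT andP (conj us u2))).
by rewrite !ler_norml; lra.
Qed.

(** Left limits come from the Cauchy criterion, so no candidate value for them is needed. *)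
Lemma cadlag_of_local_osc z :
  (forall e u, 0 < e -> 0 <= u ->
    exists2 r, u < r & forall v, u <= v < r -> `|z v - z u| <= e) ->
  (forall e u, 0 < e -> 0 < u ->
    exists2 l, l < u & forall v w, l < v < u -> l < w < u -> `|z v - z w| <= e) ->
  cadlag z.
Proof.
move=> zr zl; split => u u0.
  apply/cvgrPdist_le => e e0; have [r ur rP] := zr _ _ e0 u0.
  near=> v; rewrite distrC; apply: rP; apply/andP; split.
    by apply: ltW; near: v; exact: nbhs_right_gt.
  by near: v; exact: nbhs_right_lt.
apply: cauchy_cvg; apply/cauchy_ballP => e e0; rewrite near_simpl.
have e20 : 0 < e / 2 by rewrite divr_gt0.
have [l lu lP] := zl _ _ e20 u0.
have [v vP] : exists v, l < v < u.
  by exists ((l + u) / 2); rewrite midf_lt//=; lra.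
near=> ab => /=; rewrite -ball_normE /ball_ /=.
apply: (@le_lt_trans _ _ (e / 2)); last by lra.
apply: lP.
  near: ab; exists ([set a | l < a < u], setT) => /=; last by move=> [a b] /= [].
  split; last exact: filterT.
  near=> a; apply/andP; split; last by near: a; exact: nbhs_left_lt.
  by near: a; exact: nbhs_left_gt.
near: ab; exists (setT, [set a | l < a < u]) => /=; last by move=> [a b] /= [].
split; first exact: filterT.
near=> a; apply/andP; split; last by near: a; exact: nbhs_left_lt.
by near: a; exact: nbhs_left_gt.
Unshelve. all: by end_near. Qed.

(** On either side of its jump time in a column the path oscillates by at most [4 * e], so
    membership in ever finer cells forces regularity. The limit paths are shown to be cadlag almost
    surely in this way. *)
Lemma step_cell_cadlag z :
  (forall d, 0 < d -> exists h A e c, [/\ 0 < h, 0 < e, 4 * e <= d,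
    d^-1 < A%:R * h & step_cell h A e c z]) -> cadlag z.
Proof.
move=> zP.
have piece d u : 0 < d -> 0 <= u -> exists h A e c, [/\ 0 < h, 4 * e <= d,
    u < A%:R * h & step_cell h A e c z].
  move=> d0 u0.
  (* The second entry of the minimum pushes the horizon of the cell beyond [u]. *)
  have [|h [A [e [c [h0 e0 ed dA zc]]]]] := zP (Num.min d (u + 1)^-1).
    by rewrite lt_min d0 invr_gt0 ltr_wpDl.
  exists h, A, e, c; split => //; first by rewrite (le_trans ed)// ge_min lexx.
  apply: le_lt_trans dA.
  apply: (@le_trans _ _ (u + 1)); first by rewrite lerDl.
  rewrite -[leLHS]invrK lef_pV2 ?posrE ?lt_min ?d0 ?invr_gt0 ?ltr_wpDl//.
  by rewrite ge_min lexx orbT.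
apply: cadlag_of_local_osc => d u d0 u0.
  have [h [A [e [c [h0 ed uA [s sP]]]]]] := piece _ _ d0 u0.
  have [|a aA /andP[u1 u2]] := @in_column h A u h0; first by rewrite u0.
  have [/andP[s1 s2] sl sr] := sP _ aA.
  have [us|us] := ltP u (s a).
    exists (s a) => // v /andP[v1 v2].
    have /sl : a%:R * h <= u < s a by rewrite u1.
    have /sl : a%:R * h <= v < s a by rewrite v2 (le_trans u1).
    by rewrite !ler_norml; lra.
  exists (a.+1%:R * h) => // v /andP[v1 v2].
  have /sr : s a <= u < a.+1%:R * h by rewrite us.
  have /sr : s a <= v < a.+1%:R * h by rewrite v2 (le_trans us).
  by rewrite !ler_norml; lra.
have [h [A [e [c [h0 ed uA [s sP]]]]]] := piece _ _ d0 (ltW u0).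
(* A left limit sees the times just before [u], so the column is taken open on the left. *)
have [a aA /andP[u1 u2]] : exists2 a, (a < A)%N & a%:R * h < u <= a.+1%:R * h.
  have [|a aA /andP[u1 u2]] := @in_column h A u h0; first by rewrite ltW.
  move: u1; rewrite le_eqVlt => /predU1P[uE|u1]; last first.
    by exists a => //; rewrite u1 ltW.
  move: aA uE; case: a {u2} => [_ uE|a aA uE].
    by move: u0; rewrite -uE mul0r ltxx.
  by exists a; [exact: ltnW|rewrite -uE lexx andbT ltr_pM2r// ltr_nat].
have [/andP[s1 s2] sl sr] := sP _ aA.
have [us|us] := leP u (s a).
  exists (a%:R * h) => // v w /andP[v1 v2] /andP[w1 w2].
  have /sl : a%:R * h <= v < s a by rewrite (ltW v1) (lt_le_trans v2).
  have /sl : a%:R * h <= w < s a by rewrite (ltW w1) (lt_le_trans w2).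
  by rewrite !ler_norml; lra.
exists (s a) => // v w /andP[v1 v2] /andP[w1 w2].
have /sr : s a <= v < a.+1%:R * h by rewrite (ltW v1) (lt_le_trans v2).
have /sr : s a <= w < a.+1%:R * h by rewrite (ltW w1) (lt_le_trans w2).
by rewrite !ler_norml; lra.
Qed.

(** The path follows the running maximum of the marks with tolerance [e]. The alternative [z s <= e]
    covers times without sizable marks; in the other one an approximate maximizer is enough, so no
    supremum has to be attained. *)
Definition tracks (T e : R) t j z := forall s, 0 <= s < T ->
  [/\ - e <= z s, (forall k, t k <= s -> (j k <= (z s + e)%:E)%E) &
    z s <= e \/ exists2 k, t k <= s & ((z s - e)%:E <= j k)%E].

Definition no_point_above h t j (a : nat) (y : R) :=
  forall k, a%:R * h <= t k < a.+1%:R * h -> (j k <= y%:E)%E.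

(** The least admissible [b], or [B] if there is none, which is what [find] returns on failure.
    Empty columns and columns with marks at most [e] get label 0. *)
Definition column_label h e (B : nat) t j (a : nat) : nat :=
  find (fun b => `[< no_point_above h t j a (b.+1%:R * e) >]) (iota 0 B).

Lemma column_label_le h e B t j a b : 0 < e -> (b < B)%N ->
  (column_label h e B t j a <= b)%N = `[< no_point_above h t j a (b.+1%:R * e) >].
Proof.
move=> e0 bB; apply/idP/idP => [lb|nb]; last first.
  rewrite leqNgt; apply/negP => /(before_find 0%N).
  by rewrite nth_iota// add0n nb.
have lB : (column_label h e B t j a < B)%N by exact: leq_ltn_trans bB.
have : has (fun b => `[< no_point_above h t j a (b.+1%:R * e) >]) (iota 0 B).
  by rewrite has_find size_iota.
move=> /(nth_find 0%N); rewrite nth_iota// add0n => /asboolP nl.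
apply/asboolP => k kP; apply: (le_trans (nl _ kP)).
by rewrite lee_fin ler_pM2r// ler_nat ltnS.
Qed.

Lemma column_label_max h e B t j a : (column_label h e B t j a <= B)%N.
Proof. by rewrite -[leqRHS](size_iota 0) find_size. Qed.

(** High points in one column need only share their time, since a cell asks for one jump time per
    column. Left edges are excluded because that time lies strictly inside the column. *)
Definition good_config h (A : nat) e (B : nat) t j :=
  [/\ forall k, 0 <= t k,
      forall a k k', (a < A)%N -> a%:R * h <= t k < a.+1%:R * h ->
        a%:R * h <= t k' < a.+1%:R * h -> (e%:E < j k)%E -> (e%:E < j k')%E ->
        t k = t k',
      forall a k, (a < A)%N -> t k = a%:R * h -> (j k <= e%:E)%E &
      forall k, t k < A%:R * h -> (j k <= (B%:R * e)%:E)%E].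

(** Rounding the heights costs one [e] and tracking another, which explains the tolerance [2 * e] of
    a cell. *)
Lemma good_config_step_cell h A e B t j z : 0 < h -> 0 < e -> (0 < B)%N ->
  good_config h A e B t j -> tracks (A%:R * h) e t j z ->
  step_cell h A e (column_label h e B t j) z.
Proof.
move=> h0 e0 B0 [t0 g1 g2 g3] tr.
set c := column_label h e B t j.
have cB a : (a < A)%N -> (c a < B)%N.
  move=> aA; rewrite -(prednK B0) ltnS column_label_le ?(prednK B0)//.
  apply/asboolP => k /andP[_ ka]; apply: g3; apply: lt_le_trans ka _.
  by rewrite ler_pM2r// ler_nat.
have c_ub a k : (a < A)%N -> a%:R * h <= t k < a.+1%:R * h ->
    (j k <= ((c a).+1%:R * e)%:E)%E.
  move=> aA ka; have := leqnn (c a).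
  by rewrite {1}/c column_label_le ?cB// => /asboolP; exact.
have c_lb a : (a < A)%N -> (0 < c a)%N ->
    exists2 k, a%:R * h <= t k < a.+1%:R * h & (((c a)%:R * e)%:E < j k)%E.
  move=> aA ca0; have : ~~ (c a <= (c a).-1)%N by rewrite -ltnNge prednK.
  rewrite {1}/c column_label_le//; last first.
    by rewrite (leq_ltn_trans (leq_pred _))// cB.
  rewrite prednK// => /asboolPn /existsNP[k] /not_implyP[ka /negP].
  by rewrite -ltNge; exists k.
have VS a a' : (a' < a)%N -> (c a')%:R * e <= cell_height e c a.
  move=> a'a; rewrite ler_pM2r// ler_nat.
  exact: (@leq_bigmax _ (fun i : 'I_a => c i) (Ordinal a'a)).
have V0 a : 0 <= cell_height e c a by rewrite mulr_ge0// ltW.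
(* Marks at most [e] may be ignored, because heights are nonnegative. *)
have zub a u : (a <= A)%N -> 0 <= u < A%:R * h ->
    (forall k, t k <= u -> (j k <= e%:E)%E \/
      exists2 a', (a' < a)%N & a'%:R * h <= t k < a'.+1%:R * h) ->
    z u <= cell_height e c a + 2 * e.
  move=> aA uA uP; have [_ _ [ze|[k ku kz]]] := tr _ uA.
    by have := V0 a; lra.
  have [je|[a' a'a kc]] := uP _ ku.
    have := le_trans kz je; rewrite lee_fin; have := V0 a; lra.
  have := le_trans kz (c_ub _ _ (leq_trans a'a aA) kc).
  have := VS _ _ a'a.
  by rewrite lee_fin -natr1 mulrDl mul1r; lra.
have zlb a u : (a <= A)%N -> 0 <= u < A%:R * h ->
    (forall a', (a' < a)%N -> (0 < c a')%N ->
       exists2 k, t k <= u & (((c a')%:R * e)%:E < j k)%E) ->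
    cell_height e c a - e <= z u.
  move=> aA uA uP; have [z0 zk _] := tr _ uA.
  rewrite /cell_height; case: a {aA} uP => [|a] uP.
    by rewrite big_ord0 mul0r sub0r.
  have a0 : (0 < #|'I_a.+1|)%N by rewrite card_ord.
  have [i ->] := @bigop.eq_bigmax _ (fun i : 'I_a.+1 => c i) a0.
  have [->|ci0] := posnP (c i); first by rewrite mul0r sub0r.
  have [k ku kj] := uP _ (ltn_ord i) ci0.
  have := lt_le_trans kj (zk _ ku); rewrite lte_fin; lra.
(* The common time of the points above [e]; in a column without such points the height does not
   change and the midpoint serves. *)
pose s a := if pselect (exists2 k, a%:R * h <= t k < a.+1%:R * h & (e%:E < j k)%E)
  is left H then t (projT1 (cid2 H)) else a%:R * h + h / 2.
have aS a : a.+1%:R * h = a%:R * h + h by rewrite -natr1 mulrDl mul1r.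
have sP a : (a < A)%N -> a%:R * h < s a < a.+1%:R * h.
  move=> aA; rewrite /s; case: pselect => [H|_]; last first.
    by apply/andP; split; [rewrite ltrDl divr_gt0|rewrite aS ltrD2l; lra].
  case: cid2 => k /= /andP[k1 k2] kj; rewrite k2 andbT lt_neqAle k1 andbT.
  by apply/negP => /eqP/esym/(g2 _ _ aA); rewrite leNgt kj.
have sj a k : (a < A)%N -> a%:R * h <= t k < a.+1%:R * h -> (e%:E < j k)%E ->
    t k = s a.
  move=> aA ka kj; rewrite /s; case: pselect => [H|[]]; last by exists k.
  by case: cid2 => k' /= k'a k'j; exact: (g1 a).
exists s => a aA.
have [s1 s2] := andP (sP _ aA).
have a0 : 0 <= a%:R * h by rewrite mulr_ge0// ltW.
have SA : a.+1%:R * h <= A%:R * h by rewrite ler_pM2r// ler_nat.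
split; first exact: sP.
- move=> u /andP[u1 u2].
  have uA : 0 <= u < A%:R * h.
    by rewrite (le_trans a0)//= (lt_le_trans _ SA)// (lt_trans u2).
  have := @zub a u (ltnW aA) uA; have := @zlb a u (ltnW aA) uA.
  move=> /(_ _)/wrap[|zl].
    move=> a' a'a ca0; have [k /andP[_ k2] kj] := c_lb _ (ltn_trans a'a aA) ca0.
    exists k => //; apply: le_trans u1; apply: (le_trans (ltW k2)).
    by rewrite ler_pM2r// ler_nat.
  move=> /(_ _)/wrap[|zu]; last by rewrite ler_norml; lra.
  move=> k ku; have [kj|kj] := leP (j k) e%:E; [by left|right].
  have [|a' a'A ka'] := @in_column h A (t k) h0.
    by rewrite t0 (le_lt_trans ku)// (andP uA).2.
  have := sj _ _ a'A ka' kj => tk.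
  (* A point above [e] in column [a] sits at [s a], which is after [u], and all later columns start
     after [u] as well. *)
  exists a' => //; rewrite ltnNge; apply/negP => aa'.
  move: tk ka'; have [<-|na] := eqVneq a a' => tk ka'.
    by move: ku; rewrite tk leNgt u2.
  have /(ler_wpM2r (ltW h0)) : (a.+1%:R : R) <= a'%:R by rewrite ler_nat ltn_neqAle na.
  by move: ka' => /andP[k1 _]; lra.
- move=> u /andP[u1 u2].
  have uA : 0 <= u < A%:R * h.
    by rewrite (lt_le_trans u2)// andbT (le_trans a0)// (le_trans (ltW s1)).
  have := @zub a.+1 u aA uA; have := @zlb a.+1 u aA uA.
  move=> /(_ _)/wrap[|zl].
    move=> a' a'a ca0; have a'A : (a' < A)%N by exact: leq_ltn_trans aA.
    have [k /[dup] kc /andP[_ k2] kj] := c_lb _ a'A ca0.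
    exists k => //; have [aa|na] := eqVneq a' a.
      subst a'; rewrite (sj a k)//; apply: le_lt_trans kj.
      by rewrite lee_fin ler_peMl ?ler1n// ltW.
    apply: le_trans u1; apply: (le_trans (ltW k2)); apply: le_trans (ltW s1).
    by rewrite ler_pM2r// ler_nat ltn_neqAle na.
  move=> /(_ _)/wrap[|zu]; last by rewrite ler_norml; lra.
  move=> k ku; right.
  have [|a' a'A ka'] := @in_column h A (t k) h0.
    by rewrite t0 (le_lt_trans ku)// (andP uA).2.
  exists a' => //; rewrite ltnS leqNgt; apply/negP => aa'.
  have /(ler_wpM2r (ltW h0)) : (a.+1%:R : R) <= a'%:R by rewrite ler_nat.
  by move: ka' => /andP[k1 _]; lra.
Qed.

End cells.

(** * Weak convergence by discretization *)

Section sandwich.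
Local Open Scope ereal_scope.
Context d (T : measurableType d) (R : realType).

(* The integral is defined for every function and is monotone, measurable or not. *)
Lemma integral_mono_any (mu : {measure set T -> \bar R}) (f g : T -> \bar R) :
  (forall x, f x <= g x) -> \int[mu]_x f x <= \int[mu]_x g x.
Proof.
move=> fg; rewrite /integral !patch_setT; apply: leeB; apply: le_ereal_sup;
  move=> _ [k kP <-]; exists k => //= x; apply: (le_trans (kP x)).
- by rewrite !funeposE ge_max le_max le_max fg lexx orbT.
- by rewrite !funenegE ge_max le_max le_max leeN2 fg lexx orbT.
Qed.

Context (P : probability T R) (L : finType) (lab : T -> L).
Hypothesis mlab : forall c, measurable (lab @^-1` [set c]).

Lemma integral_label (u : L -> R) (K : R) (bad : set T) : measurable bad ->
  \int[P]_w (u (lab w) + K * \1_bad w)%:E =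
  ((\sum_c u c * fine (P (lab @^-1` [set c]))) + K * fine (P bad))%:E.
Proof.
move=> mbad.
pose g c w : \bar R := (u c)%:E * (\1_(lab @^-1` [set c]) w)%:E.
have ig c : P.-integrable setT (g c).
  by apply: integrableZl => //; exact: integrable_indic.
have Pfin A : measurable A -> P A \is a fin_num by exact: fin_num_measure.
transitivity (\int[P]_w ((\sum_c g c w) + K%:E * (\1_bad w)%:E)).
  apply: eq_integral => w _; rewrite EFinD EFinM; congr (_ + _).
  rewrite (bigD1 (lab w))//= /g indicE mem_set// mule1 big1 ?adde0// => c cw.
  by rewrite indicE memNset ?mule0// => /= E; rewrite E eqxx in cw.
rewrite integralD//; last 2 first.
- exact: integrable_sum.
- by apply: integrableZl => //; exact: integrable_indic.
rewrite integralZl//; last exact: integrable_indic.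
rewrite integral_indic// setIT integral_sum// EFinD; congr (_ + _); last first.
  by rewrite EFinM fineK// Pfin.
rewrite -sumEFin; apply: eq_bigr => c _.
rewrite /g integralZl//; last exact: integrable_indic.
by rewrite integral_indic// setIT EFinM fineK// Pfin.
Qed.

(** [g] may fail to be measurable: the bounds are simple functions, which squeeze its integral and
    make it finite. *)
Lemma integral_label_sandwich (g : T -> R) (u v : L -> R) (K : R)
    (bad : set T) : measurable bad ->
  (forall w, g w <= u (lab w) + K * \1_bad w)%R ->
  (forall w, v (lab w) - K * \1_bad w <= g w)%R ->
  exists2 r : R, \int[P]_w (g w)%:E = r%:E &
  ((\sum_c v c * fine (P (lab @^-1` [set c]))) - K * fine (P bad) <= r <=
   (\sum_c u c * fine (P (lab @^-1` [set c]))) + K * fine (P bad))%R.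
Proof.
move=> mbad gu gv.
have ub : \int[P]_w (g w)%:E <= \int[P]_w (u (lab w) + K * \1_bad w)%:E.
  by apply: integral_mono_any => w; rewrite lee_fin.
have lb : \int[P]_w (v (lab w) + - K * \1_bad w)%:E <= \int[P]_w (g w)%:E.
  by apply: integral_mono_any => w; rewrite lee_fin mulNr.
rewrite !integral_label// mulNr in ub lb.
case: (\int[P]_w (g w)%:E) ub lb => [r| |]; rewrite ?leye_eq ?leeNy_eq//.
by rewrite !lee_fin => ub lb; exists r => //; rewrite lb ub.
Qed.

End sandwich.

Lemma cvgr_sum_fin (R : realType) (I : Type) (F : set_system I) (FF : Filter F)
    (L : finType) (f : L -> I -> R) (a : L -> R) :
  (forall c, f c x @[x --> F] --> a c) ->
  (\sum_c f c x) @[x --> F] --> \sum_c a c.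
Proof.
move=> fa; apply: cvg_big => //; exact: add_continuous.
Qed.

(** * Integrals of J1-continuous functionals *)

Section weak_convergence.
Variable R : realType.
Context d (Omega : measurableType d) (P : probability Omega R)
  (Z : nat -> Omega -> R -> R).
Context d' (Omega' : measurableType d') (Q : probability Omega' R)
  (S : Omega' -> R -> R).

(** The interface between probability and topology: one finite family of cells serves the sequence
    and the limit, the label laws converge, and off small events a path lies in the cell named by
    its label. *)
Definition cell_approximation (del : R) : Prop :=
  exists (h e : R) (A : nat) (L : finType) (kappa : L -> nat -> nat)
    (lab : nat -> Omega -> L) (labS : Omega' -> L)
    (bad : nat -> set Omega) (badS : set Omega'),
  [/\ [/\ 0 < h, h <= del, 0 < e, 4 * e <= del & del^-1 < A%:R * h],
      [/\ forall n c, measurable (lab n @^-1` [set c]),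
          forall c, measurable (labS @^-1` [set c]) &
          forall c, fine (P (lab n @^-1` [set c])) @[n --> \oo] -->
                    fine (Q (labS @^-1` [set c]))],
      [/\ forall n, measurable (bad n), measurable badS,
          \forall n \near \oo, (P (bad n) <= del%:E)%E &
          (Q badS <= del%:E)%E],
      \forall n \near \oo, forall w, ~ bad n w ->
        step_cell h A e (kappa (lab n w)) (Z n w) &
      forall w, ~ badS w -> step_cell h A e (kappa (labS w)) (S w)].

Lemma J1_cvg_of_close (x : R -> R) (ys : nat -> R -> R) (del : nat -> R) :
  (forall k, 0 < del k) -> del k @[k --> \oo] --> 0 ->
  (\forall k \near \oo, J1_close (del k) x (ys k)) -> J1_cvg ys x.
Proof.
move=> del0 delc yx.
(* Closeness fails for finitely many [k] only; there the identity is a valid time change. *)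
pose lam k := if pselect (J1_close (del k) x (ys k)) is left H
  then projT1 (cid H) else id.
have delle e : 0 < e -> \forall k \near \oo, del k <= e.
  move=> e0; move/cvgrPdist_le : delc => /(_ _ e0); apply: filterS => k.
  by rewrite sub0r normrN (ger0_norm (ltW (del0 k))).
exists lam; split; [|split].
- move=> k; rewrite /lam; case: pselect => [H|_]; first by case: cid => l /= [].
  split=> //; split; first by apply: continuous_subspaceT => ?; exact: cvg_id.
  by split=> // y y0; exists y.
- move=> e e0; near=> k => t t0.
  have ke : del k <= e by near: k; exact: delle.
  rewrite /lam; case: pselect => [H|_]; last by rewrite subrr normr0 ltW.
  by case: cid => l /= [_ + _] => /(_ _ t0)/le_trans; apply.
- move=> T e T0 e0; near=> k => t /andP[t0 tT].
  have ke : del k <= e by near: k; exact: delle.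
  have kT : del k <= T^-1 by near: k; apply: delle; rewrite invr_gt0.
  rewrite /lam; case: pselect => [H|nH]; last first.
    by exfalso; apply: nH; near: k.
  case: cid => l /= [_ _ lP]; apply: le_trans ke; apply: lP.
  rewrite t0 (le_trans tT)// -[leLHS]invrK lef_pV2 ?posrE ?invr_gt0//.
Unshelve. all: by end_near. Qed.

(** [D] is the oscillation of [f] over the cell of [S w]. In the error, each bad event contributes
    [2 * M] and the convergence of label laws 1. The null set [N] stays a parameter because
    regularity of [S] is known only once all values of [del] are combined. *)
Lemma cell_oscillation (f : (R -> R) -> R) (M : R) (del : R) :
  (forall x, `|f x| <= M) -> 0 < del -> cell_approximation del ->
  (\forall n \near \oo, forall w, cadlag (Z n w)) ->
  exists (D : Omega' -> R) (badS : set Omega'),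
  [/\ [/\ measurable_fun setT D, forall w, 0 <= D w <= 2 * M,
          measurable badS & (Q badS <= del%:E)%E],
      forall w, ~ badS w -> exists h A e c, [/\
        [/\ 0 < h, h <= del, 0 < e, 4 * e <= del & del^-1 < A%:R * h],
        step_cell h A e c (S w) & cadlag (S w) ->
        exists x y, [/\ step_cell h A e c x, step_cell h A e c y,
          cadlag x, cadlag y & D w <= f x - f y + del]] &
      forall N, measurable N -> Q N = 0%E -> (forall w, ~ N w -> cadlag (S w)) ->
        exists2 r : R, (\int[Q]_w (f (S w))%:E)%E = r%:E &
        \forall n \near \oo, exists2 r' : R,
          (\int[P]_w (f (Z n w))%:E)%E = r'%:E &
          `|r' - r| <= fine (\int[Q]_w (D w)%:E)%E + (4 * M + 1) * del].
Proof.
move=> fM del0 [h [e [A [L [kappa [lab [labS [bad [badS]]]]]]]]].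
move=> [par [mlab mlabS labc] [mbad mbadS Pbad Qbad] Zcell Scell] Zc.
have M0 : 0 <= M by apply: le_trans (fM (cst 0)).
(* Only cadlag paths enter, since the continuity of [f] is tested on them alone. *)
pose C c := [set f x | x in step_cell h A e (kappa c) `&` cadlag (R:=R)].
pose u c := sup (C c); pose v c := inf (C c).
have Cub c : has_ubound (C c).
  by exists M => _ [x _ <-]; have := fM x; rewrite ler_norml => /andP[].
have Clb c : has_lbound (C c).
  by exists (- M) => _ [x _ <-]; have := fM x; rewrite ler_norml => /andP[].
(* Supremum and infimum of the empty set are 0, which keeps the bounds below valid for empty
   cells. *)
have C0 c : C c = set0 -> (u c = 0) * (v c = 0).
  by move=> E; rewrite /u /v E sup0 inf0.
have uM c : - M <= u c <= M.
  have [/C0[uE _]|/set0P[_ [x xC _]]] := eqVneq (C c) set0.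
    by rewrite uE oppr_le0 M0.
  have := fM x; rewrite ler_norml => /andP[x1 x2]; apply/andP; split.
    by apply: (le_trans x1); apply: ub_le_sup => //; exists x.
  apply: ge_sup; first by exists (f x); exists x.
  by move=> _ [z _ <-]; have := fM z; rewrite ler_norml => /andP[].
have vM c : - M <= v c <= M.
  have [/C0[_ vE]|/set0P[_ [x xC _]]] := eqVneq (C c) set0.
    by rewrite vE oppr_le0 M0.
  have := fM x; rewrite ler_norml => /andP[x1 x2]; apply/andP; split.
    apply: lb_le_inf; first by exists (f x); exists x.
    by move=> _ [z _ <-]; have := fM z; rewrite ler_norml => /andP[].
  by apply: le_trans x2; apply: ge_inf => //; exists x.
have vu c : v c <= u c.
  have [/C0[uE vE]|/set0P[r rC]] := eqVneq (C c) set0; first by rewrite uE vE.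
  by apply: (@le_trans _ _ r); [exact: ge_inf|exact: ub_le_sup].
have fu c x : step_cell h A e (kappa c) x -> cadlag x -> v c <= f x <= u c.
  move=> xc xcad; apply/andP; split; [apply: ge_inf|apply: ub_le_sup] => //;
  by exists x.
have sand (T : Type) (w : T) c x (B : set T) :
    (~ B w -> step_cell h A e (kappa c) x /\ cadlag x) ->
    (f x <= u c + 2 * M * \1_B w) /\ (v c - 2 * M * \1_B w <= f x).
  move=> xB; rewrite indicE; have [Bw|nBw] := pselect (B w).
    rewrite mem_set// mulr1.
    by have := fM x; have := uM c; have := vM c; rewrite ler_norml; lra.
  have [xc xcad] := xB nBw; rewrite memNset// mulr0 subr0 addr0.
  by have /andP[] := fu _ _ xc xcad.
pose D w := u (labS w) - v (labS w).
exists D, badS; split.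
- split=> //; last by move=> w; have := uM (labS w); have := vM (labS w);
    have := vu (labS w); rewrite /D; lra.
  have -> : D = (fun w => \sum_c (u c - v c) * \1_(labS @^-1` [set c]) w).
    apply/funext => w; rewrite (bigD1 (labS w))//= indicE mem_set// mulr1.
    rewrite big1 ?addr0// => c cw.
    by rewrite indicE memNset ?mulr0// => /= E; rewrite E eqxx in cw.
  apply: measurable_sum => c; apply: measurable_funM; first exact: measurable_cst.
  exact: measurable_indic (mlabS c).
- move=> w nw; exists h, A, e, (kappa (labS w)); split => //; first exact: Scell.
  move=> Sc; have Cn : C (labS w) !=set0.
    by exists (f (S w)); exists (S w) => //; split => //; exact: Scell.
  have del20 : 0 < del / 2 by rewrite divr_gt0.
  have [|_ [x [xc xcad] <-] xu] := @sup_adherent _ (C (labS w)) _ del20 => //.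
  have [|_ [y [yc ycad] <-] yv] := @inf_adherent _ (C (labS w)) _ del20 => //.
  exists x, y; split => //; move: xu yv; rewrite /D -/(u _) -/(v _); lra.
move=> N mN QN Sc.
have mbN : measurable (badS `|` N) by exact: measurableU.
have SbN w : ~ (badS `|` N) w ->
    step_cell h A e (kappa (labS w)) (S w) /\ cadlag (S w).
  by move=> /not_orP[nb nN]; split; [exact: Scell|exact: Sc].
have [||r rE rb] := @integral_label_sandwich _ _ _ Q _ _ mlabS
    (f \o S) u v (2 * M) _ mbN.
- by move=> w; exact: (sand _ w (labS w) (S w) _ (SbN w)).1.
- by move=> w; exact: (sand _ w (labS w) (S w) _ (SbN w)).2.
exists r => //.
have DE : fine (\int[Q]_w (D w)%:E)%E =
   \sum_c u c * fine (Q (labS @^-1` [set c])) -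
   \sum_c v c * fine (Q (labS @^-1` [set c])).
  have := @integral_label _ _ _ Q _ _ mlabS (fun c => u c - v c) 0 _ measurable0.
  under eq_integral do rewrite mul0r addr0.
  move=> ->; rewrite mul0r addr0 /= -sumrB.
  by apply: eq_bigr => c _; rewrite mulrBl.
have QbN : fine (Q (badS `|` N)) <= del.
  rewrite measureU0//; rewrite -[del]/(fine del%:E); apply: fine_le => //.
  exact: fin_num_measure.
have cu w' : (\sum_c w' c * fine (P (lab n @^-1` [set c]))) @[n --> \oo] -->
    \sum_c (w' c * fine (Q (labS @^-1` [set c])) : R).
  apply: cvgr_sum_fin => c; apply: cvgM; [exact: cvg_cst|exact: labc].
have cun w' : \forall n \near \oo, `|\sum_c w' c * fine (Q (labS @^-1` [set c])) -
    \sum_c w' c * fine (P (lab n @^-1` [set c]))| <= del.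
  by move/cvgrPdist_le : (cu w') => /(_ _ del0).
near=> n.
have nbad w : ~ bad n w -> step_cell h A e (kappa (lab n w)) (Z n w) /\ cadlag (Z n w).
  by move=> nb; split; [move: w nb|move: w {nb}]; near: n.
have [||r' r'E r'b] := @integral_label_sandwich _ _ _ P _ _ (mlab n)
    (f \o Z n) u v (2 * M) _ (mbad n).
- by move=> w; exact: (sand _ w (lab n w) (Z n w) _ (nbad w)).1.
- by move=> w; exact: (sand _ w (lab n w) (Z n w) _ (nbad w)).2.
exists r' => //.
have Pb : fine (P (bad n)) <= del.
  have : (P (bad n) <= del%:E)%E by near: n.
  move=> Pb; rewrite -[del]/(fine del%:E); apply: fine_le => //.
  exact: fin_num_measure.
have un : `|\sum_c u c * fine (Q (labS @^-1` [set c])) -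
    \sum_c u c * fine (P (lab n @^-1` [set c]))| <= del by near: n; exact: cun.
have vn : `|\sum_c v c * fine (Q (labS @^-1` [set c])) -
    \sum_c v c * fine (P (lab n @^-1` [set c]))| <= del by near: n; exact: cun.
have M20 : 0 <= 2 * M by rewrite mulr_ge0.
have := ler_wpM2l M20 Pb; have := ler_wpM2l M20 QbN.
move: rb r'b un vn; rewrite DE !ler_norml; lra.
Unshelve. all: by end_near. Qed.

(** Nearly extremal paths of the cells containing [S w] are J1-close to [S w], hence converge to it
    as the levels are refined; sequential continuity at this one path makes the oscillation vanish.
    Cells of different levels need not be nested. *)
Lemma weak_cvg_of_cells : (forall del, 0 < del -> cell_approximation del) ->
  (\forall n \near \oo, forall w, cadlag (Z n w)) -> D_weak_cvg P Z Q S.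
Proof.
move=> cells Zc f [M fM] fc.
have M0 : 0 <= M by apply: le_trans (fM (cst 0)).
(* Powers of 1/2 make the probabilities of the bad events summable. *)
pose del k : R := 1 / (2 ^ k.+1)%:R.
have del0 k : 0 < del k by rewrite divr_gt0// ltr0n expn_gt0.
have delc : del k @[k --> \oo] --> 0.
  have -> : del = geometric (1 / 2) (1 / 2).
    apply/funext => k; rewrite /del /geometric /= -exprS natrX expr_div_n.
    by rewrite expr1n.
  by apply: cvg_geometric; rewrite ger0_norm//; lra.
have delle e : 0 < e -> \forall k \near \oo, del k <= e.
  move=> e0; move/cvgrPdist_le : delc => /(_ _ e0); apply: filterS => k.
  by rewrite sub0r normrN (ger0_norm (ltW (del0 k))).
have lev k := cell_oscillation fM (del0 k) (cells _ (del0 k)) Zc.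
have [D /choice[bad levP]] := choice lev.
have mbad k : measurable (bad k) by have [[]] := levP k.
pose N := lim_sup_set bad.
have mN : measurable N.
  by apply: bigcap_measurable => // k _; apply: bigcup_measurable.
have QN : Q N = 0%E.
  apply: lim_sup_set_cvg0 => //.
  apply: (@le_lt_trans _ _ 1%E); last by rewrite ltry.
  apply: le_trans (epsilon_trick0 xpredT (@ler01 R)).
  by apply: lee_nneseries => // k _; have [[]] := levP k.
have NP w : ~ N w -> \forall k \near \oo, ~ bad k w.
  move=> /existsNP[k] /not_implyP[_ kN]; exists k => // j /= kj bj.
  by apply: kN; exists j.
have Sc w : ~ N w -> cadlag (S w).
  move=> /NP Nw; apply: step_cell_cadlag => e e0.
  have := filterI (Nw) (delle _ e0); move=> [k _ /(_ k (leqnn k))[nk ke]].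
  have [_ /(_ _ nk)[h [A [e' [c [[h0 _ e'0 ee dA] Sw _]]]]] _] := levP k.
  exists h, A, e', c; split => //; first exact: le_trans ke.
  by apply: le_lt_trans dA; rewrite lef_pV2 ?posrE.
have Dc w : ~ N w -> D k w @[k --> \oo] --> 0.
  move=> /[dup] Nw /NP Nk; have Sw := Sc _ Nw.
  have pick k : exists xy : (R -> R) * (R -> R), [/\ cadlag xy.1, cadlag xy.2 &
      ~ bad k w -> [/\ J1_close (del k) (S w) xy.1, J1_close (del k) (S w) xy.2 &
      D k w <= f xy.1 - f xy.2 + del k]].
    (* On a bad level [S w] itself fills the pair, so that the whole sequence is cadlag. *)
    have [b|nb] := pselect (bad k w); first by exists (S w, S w).
    have [_ /(_ _ nb)[h [A [e' [c [[h0 hd e'0 ee dA] Sce xyE]]]]] _] := levP k.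
    have [x [y [xc yc xcad ycad Dxy]]] := xyE Sw.
    exists (x, y); split => //= _; split => //.
      exact: (step_cell_close h0 hd ee dA Sce xc).
    exact: (step_cell_close h0 hd ee dA Sce yc).
  have [xy xyP] := choice pick.
  have xc : f (xy k).1 @[k --> \oo] --> f (S w).
    apply: (fc (fun k => (xy k).1)) => //; first by move=> k; have [] := xyP k.
    apply: (J1_cvg_of_close del0 delc).
    by apply: filterS Nk => k nk; have [_ _ /(_ nk)[]] := xyP k.
  have yc : f (xy k).2 @[k --> \oo] --> f (S w).
    apply: (fc (fun k => (xy k).2)) => //; first by move=> k; have [] := xyP k.
    apply: (J1_cvg_of_close del0 delc).
    by apply: filterS Nk => k nk; have [_ _ /(_ nk)[]] := xyP k.
  have bc : f (xy k).1 - f (xy k).2 + del k @[k --> \oo] --> 0.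
    have -> : (0 : R) = f (S w) - f (S w) + 0 by rewrite subrr addr0.
    by apply: cvgD => //; exact: cvgB.
  apply: (@squeeze_cvgr _ _ _ _ (cst 0) _ _ _ _ _ bc); last exact: cvg_cst.
  apply: filterS Nk => k nk; have [[_ /(_ w)/andP[-> _]] _ _] := levP k.
  by have [_ _ /(_ nk)[_ _ ->]] := xyP k.
have intD : fine (\int[Q]_w (D k w)%:E)%E @[k --> \oo] --> 0.
  apply: (@fine_cvg _ _ _ _ (fun k => \int[Q]_w (D k w)%:E)%E 0).
  have [|||||_ _] := @dominated_convergence _ _ _ Q setT measurableT
    (fun k w => (D k w)%:E) (cst 0%E) (cst (2 * M)%:E).
  - by move=> k; apply/measurable_EFinP; have [[]] := levP k.
  - exact: measurable_cst.
  - exists N; split => // w /= nD; apply: contrapT => /Dc Dw; apply: nD => _.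
    by apply: cvg_EFin => //; exact: nearW.
  - exact: (@finite_measure_integrable_cst _ _ _ Q setT (2 * M)).
  - apply: aeW => w k _ /=; have [[_ /(_ w)/andP[D0 D2] _ _] _ _] := levP k.
    by rewrite lee_fin ger0_norm.
  - by rewrite integral0.
have [r SE _] : exists2 r : R, (\int[Q]_w (f (S w))%:E)%E = r%:E & True.
  by have [_ _ /(_ N mN QN Sc)[r rE _]] := levP 0%N; exists r.
rewrite SE; apply/fine_cvgP; split.
  have [_ _ /(_ N mN QN Sc)[r0 _]] := levP 0%N.
  by apply: filterS => n [r' -> _].
apply/cvgrPdist_le => e e0.
have boundc : fine (\int[Q]_w (D k w)%:E)%E + (4 * M + 1) * del k
    @[k --> \oo] --> 0.
  have -> : (0 : R) = 0 + (4 * M + 1) * 0 by rewrite mulr0 addr0.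
  by apply: cvgD => //; apply: cvgM => //; exact: cvg_cst.
(* The level [k] is fixed before [n] tends to infinity. *)
move/cvgrPdist_le : boundc => /(_ _ e0)[k _ /(_ k (leqnn k))] /=.
rewrite sub0r normrN => ke.
have [_ _ /(_ N mN QN Sc)[r'']] := levP k; rewrite SE => -[<-].
apply: filterS => n [r' -> rr] /=; rewrite distrC; apply: le_trans rr _.
exact: le_trans (ler_norm _) ke.
Qed.

End weak_convergence.

(** * Regularly varying tails *)

Section tail_asymptotics.
Variable R : realType.
Variables (G l : R -> R) (alpha : R) (b : nat -> R).
Hypothesis Gle : {homo G : x y /~ x <= y}.
Hypothesis G_ge0 : forall x, 0 <= G x.
Hypothesis alpha01 : 0 < alpha <= 1.
Hypothesis lsv : slowly_varying l.
Hypothesis Gl : (G x / (x `^ (- alpha) * l x)) @[x --> +oo] --> (1 : R).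
Hypothesis l1 : alpha = 1 -> l x @[x --> +oo] --> +oo.
Hypothesis b0 : forall n, (0 < n)%N -> 0 < b n.
Hypothesis nGb : (n%:R * G (b n)) @[n --> \oo] --> (1 : R).

(** A zero of the decreasing [G] would persist to the right and make the ratio in [Gl] vanish
    there. *)
Lemma tail_gt0 x : 0 < G x.
Proof.
rewrite lt_neqAle G_ge0 andbT eq_sym; apply/eqP => Gx0.
have : \forall y \near +oo, `|1 - G y / (y `^ (- alpha) * l y)| < 1.
  by move/cvgrPdist_lt : Gl; apply.
have : \forall y \near +oo, x <= y by apply: nbhs_pinfty_ge; exact: num_real.
move=> xy Gy; have [y [/= xy1 +]] := filter_ex (@filterI _ _ _ _ _ xy Gy).
have -> : G y = 0 by apply/eqP; rewrite eq_le G_ge0 andbT -Gx0 Gle.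
by rewrite mul0r subr0 normr1 ltxx.
Qed.

(** Wherever [b n <= C], monotonicity gives [n * G (b n) >= n * G C], which is too large for big
    [n]. *)
Lemma normalizers_cvg_pinfty : b n @[n --> \oo] --> +oo.
Proof.
apply/cvgryPge => C; near=> n.
rewrite leNgt; apply/negP => bC.
have n2 : 2 <= n%:R * G C.
  rewrite -ler_pdivrMr ?tail_gt0//.
  by near: n; exact: nbhs_infty_ger.
have : n%:R * G (b n) < 2.
  have : `|1 - n%:R * G (b n)| < 1.
    by near: n; move/cvgrPdist_lt : nGb; apply.
  by rewrite ltr_norml; lra.
apply/negP; rewrite -leNgt (le_trans n2)// ler_wpM2l// Gle// ltW.
Unshelve. all: by end_near. Qed.

Lemma tail_ratio y : 0 < y -> (G (y * x) / G x) @[x --> +oo] --> y `^ (- alpha).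
Proof.
move=> y0.
have [[a [lpos _]] lr] := lsv.
pose g x := G x / (x `^ (- alpha) * l x).
have yx : y * x @[x --> +oo] --> +oo.
  by apply/cvgryPge => C; near=> x; rewrite mulrC -ler_pdivrMr.
have gy : g (y * x) @[x --> +oo] --> (1 : R) by exact: (cvg_comp _ g yx Gl).
have H : y `^ (- alpha) * (l (y * x) / l x) * g (y * x) * (g x)^-1
    @[x --> +oo] --> y `^ (- alpha) * 1 * 1 * 1^-1.
  apply: cvgM; last by apply: cvgV => //; exact: oner_neq0.
  apply: cvgM => //; apply: cvgM; first exact: cvg_cst.
  exact: lr.
rewrite !mulr1 invr1 mulr1 in H.
apply: cvg_trans H; apply: near_eq_cvg; near=> x.
have x0 : 0 < x by near: x; apply: nbhs_pinfty_gt; exact: num_real.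
have lx0 : 0 < l x.
  by apply: lpos; near: x; apply: nbhs_pinfty_gt; exact: num_real.
have lyx0 : 0 < l (y * x).
  apply: lpos; rewrite mulrC -ltr_pdivrMr//.
  by near: x; apply: nbhs_pinfty_gt; exact: num_real.
have Gx := tail_gt0 x.
rewrite /g powRM ?ltW//.
have ya : 0 < y `^ (- alpha) by exact: powR_gt0.
have xa : 0 < x `^ (- alpha) by exact: powR_gt0.
by field; rewrite !lt0r_neq0.
Unshelve. all: by end_near. Qed.

Lemma tail_scaled y : 0 < y -> (n%:R * G (y * b n)) @[n --> \oo] --> y `^ (- alpha).
Proof.
move=> y0.
have H : n%:R * G (b n) * (G (y * b n) / G (b n)) @[n --> \oo] --> 1 * y `^ (- alpha).
  apply: cvgM => //.
  exact: (cvg_comp b (fun x => G (y * x) / G x) normalizers_cvg_pinfty (tail_ratio y0)).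
rewrite mul1r in H; apply: cvg_trans H; apply: near_eq_cvg; near=> n.
by field; rewrite lt0r_neq0// tail_gt0.
Unshelve. all: by end_near. Qed.

(** For [alpha = 1] the product is asymptotic to [l]. For [alpha < 1] each doubling of [x]
    multiplies it asymptotically by 2^(1 - alpha) > 1, and monotonicity of [G] controls it between
    doublings. *)
Lemma mul_tail_cvg_pinfty : x * G x @[x --> +oo] --> +oo.
Proof.
have [a0 a1] := andP alpha01.
have [aE|alt1] := eqVneq alpha 1.
  have H : G x / (x `^ (- alpha) * l x) * l x @[x --> +oo] --> +oo.
    apply/cvgryPge => C; near=> x.
    have lx : Num.max 0 (2 * C) <= l x.
      near: x; have /cvgryPge := l1 aE; apply; exact: num_real.
    have g1 : 1 / 2 <= G x / (x `^ (- alpha) * l x).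
      have : `|1 - G x / (x `^ (- alpha) * l x)| <= 1 / 2.
        by near: x; move/cvgrPdist_le : Gl; apply.
      by rewrite ler_norml; lra.
    move: lx; rewrite ge_max => /andP[l0 lC].
    have := ler_wpM2r l0 g1; lra.
  have [[a [lpos _]] _] := lsv.
  apply: cvg_trans H; apply: near_eq_cvg; near=> x.
  have x0 : 0 < x by near: x; apply: nbhs_pinfty_gt; exact: num_real.
  have lx0 : 0 < l x.
    by apply: lpos; near: x; apply: nbhs_pinfty_gt; exact: num_real.
  rewrite aE powR_inv1 ?ltW//.
  by field; rewrite !lt0r_neq0.
have {}alt1 : alpha < 1 by rewrite lt_neqAle alt1.
(* [r] is the limit of [phi (2 * x) / phi x]; [q], halfway between 1 and [r], is a growth factor
   valid from some [x0] on. *)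
pose phi x := x * G x; pose r : R := 2 * 2 `^ (- alpha).
have r1 : 1 < r.
  rewrite /r /powR pnatr_eq0 /= -{1}[2]lnK ?posrE// -expRD expR_gt1.
  have : 0 < ln (2 : R) by rewrite ln_gt0// ltr1n.
  nra.
pose q := (1 + r) / 2.
have q1 : 1 < q by rewrite /q; lra.
have [x0 [x00 dbl]] : exists x0, 0 < x0 /\ forall x, x0 <= x -> q * phi x <= phi (2 * x).
  have : \forall x \near +oo, 0 < x /\ `|2 `^ (- alpha) - G (2 * x) / G x| <= (r - q) / 2.
    near=> x; split; near: x; first by apply: nbhs_pinfty_gt; exact: num_real.
    have /cvgrPdist_le := @tail_ratio 2 ltac:(by []); apply.
    by rewrite /q; lra.
  move=> [M [_ MP]]; exists (Num.max 1 (M + 1)); split; first by rewrite lt_max ltr01.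
  move=> x; rewrite ge_max => /andP[x1 xM].
  have [|xp] := MP x; first by apply: lt_le_trans xM; rewrite ltrDl.
  rewrite ler_norml => /andP[_ H2]; rewrite /phi.
  have : q / 2 <= G (2 * x) / G x by rewrite /r in H2 *; lra.
  rewrite ler_pdivlMr ?tail_gt0// => H3.
  have := ler_wpM2l (ltW xp) H3; lra.
(* A lower bound of [phi] on [x0, 2 x0], because [G] decreases. *)
pose m := x0 * G (2 * x0).
have m0 : 0 < m by rewrite mulr_gt0// tail_gt0.
have phi0 x : 0 < x -> 0 < phi x by move=> ?; rewrite mulr_gt0// tail_gt0.
have base : forall x, x0 <= x -> m <= phi x.
  move=> x xx0.
  have [N xN] : exists N : nat, x < 2 ^+ N * x0.
    exists (Num.truncn (x / x0)).+1; rewrite -ltr_pdivrMr//.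
    apply: (lt_le_trans (truncnS_gt _)); rewrite -natrX ler_nat.
    exact/ltnW/ltn_expl.
  elim: N x xx0 xN => [x xx0|N IH x xx0 xN].
    by rewrite expr0 mul1r ltNge xx0.
  have [x2|x2] := leP x (2 * x0).
    rewrite /m /phi; apply: ler_pM => //; [exact: ltW|exact: Gle].
  have hx : x0 <= x / 2 by lra.
  have xE : x = 2 * (x / 2) by lra.
  rewrite xE; apply: le_trans (dbl _ hx).
  have : m <= phi (x / 2).
    by apply: IH => //; move: xN; rewrite exprS; lra.
  have := phi0 (x / 2) ltac:(lra); nra.
have step j : forall x, 2 ^+ j * x0 <= x -> q ^+ j * m <= phi x.
  elim: j => [x|j IH x xj]; first by rewrite expr0 !mul1r; exact: base.
  have jx : 2 ^+ j * x0 <= x / 2 by move: xj; rewrite exprS; lra.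
  have hx : x0 <= x / 2.
    by apply: le_trans jx; apply: ler_peMl; rewrite ?exprn_ege1 ?ler1n// ltW.
  have xE : x = 2 * (x / 2) by lra.
  rewrite xE; apply: le_trans (dbl _ hx); rewrite exprS -mulrA ler_pM2l; last by lra.
  exact: IH.
apply/cvgryPge => C.
have [j jC] : exists j, C <= q ^+ j * m.
  exists (Num.truncn (C / m / (q - 1))).+1.
  rewrite -ler_pdivrMr//.
  (* Bernoulli's inequality, showing that the powers of [q] are unbounded. *)
  have bern k : 1 + k%:R * (q - 1) <= q ^+ k.
    elim: k => [|k IH]; first by rewrite mul0r addr0 expr0.
    rewrite exprS; have := ler_wpM2l (ltW (lt_trans ltr01 q1)) IH.
    have : 0 <= k%:R * (q - 1) ^+ 2 by rewrite mulr_ge0// sqr_ge0.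
    rewrite -natr1; lra.
  apply: le_trans (bern _).
  have := truncnS_gt (C / m / (q - 1)); rewrite ltr_pdivrMr; last by lra.
  lra.
near=> x; apply: (le_trans jC); apply: step.
by near: x; apply: nbhs_pinfty_ge; exact: num_real.
Unshelve. all: by end_near. Qed.

(** The quotient of [n * G (b n)], which is bounded, by [b n * G (b n)], which tends to infinity. *)
Lemma normalizers_superlinear : n%:R / b n @[n --> \oo] --> (0 : R).
Proof.
have H := cvg_comp b (fun x => x * G x) normalizers_cvg_pinfty mul_tail_cvg_pinfty.
apply/cvgrPdist_le => e e0; near=> n.
have n0 : (0 < n)%N by near: n; exact: nbhs_infty_gt.
have bn0 := b0 n0.
rewrite sub0r normrN ger0_norm; last by rewrite divr_ge0// ltW.
have : `|1 - n%:R * G (b n)| <= 1.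
  by near: n; move/cvgrPdist_le : nGb; apply.
rewrite ler_norml => /andP[nG _].
have : 2 / e <= b n * G (b n).
  by near: n; move/cvgryPge : H; apply.
rewrite (ler_pdivrMr _ _ e0) => bG; rewrite (ler_pdivrMr _ _ bn0).
have Gb := tail_gt0 (b n).
rewrite -(ler_pM2r Gb); nra.
Unshelve. all: by end_near. Qed.

End tail_asymptotics.

(** * Point configurations and their labels *)

Lemma prob_setU_le (R : realType) d (T : measurableType d) (P : probability T R)
    (A B : set T) (a b : \bar R) : measurable A -> measurable B ->
  (P A <= a)%E -> (P B <= b)%E -> (P (A `|` B) <= a + b)%E.
Proof.
move=> mA mB Aa Bb; apply: (@le_trans _ _ (P A + P B)%E); last exact: leeD.
exact: measureU2.
Qed.

Lemma prob_bigsetU_le (R : realType) d (T : measurableType d) (P : probability T R)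
    (A : nat) (F : nat -> set T) (r : R) : (forall a, measurable (F a)) ->
  (forall a : 'I_A, (P (F a) <= r%:E)%E) ->
  (P (\big[setU/set0]_(a < A) F a) <= (A%:R * r)%:E)%E.
Proof.
move=> mF Fr; apply: (@le_trans _ _ (\sum_(a < A) P (F a))%E).
  exact: Boole_inequality.
apply: (@le_trans _ _ (\sum_(a < A) r%:E)%E); first exact: lee_sum.
by rewrite sumEFin sumr_const card_ord mulr_natl.
Qed.

Section config_events.
Variable R : realType.
Context d (Omega : measurableType d).
Variables (t : nat -> Omega -> R) (j : nat -> Omega -> \bar R).

Definition in_box (l r y : R) (k : nat) : set Omega :=
  [set w | l <= t k w < r /\ (y%:E < j k w)%E].

Definition ev_neg : set Omega := \bigcup_k [set w | t k w < 0].
Definition ev_pair (h e : R) (a : nat) : set Omega :=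
  \bigcup_k \bigcup_(k' in [set k' | (k < k')%N])
    (in_box (a%:R * h) (a.+1%:R * h) e k `&` in_box (a%:R * h) (a.+1%:R * h) e k').
Definition ev_edge (h e : R) (a : nat) : set Omega :=
  \bigcup_k [set w | t k w = a%:R * h /\ (e%:E < j k w)%E].
Definition ev_high (T H : R) : set Omega :=
  \bigcup_k [set w | t k w < T /\ (H%:E < j k w)%E].
Definition ev_clear (h : R) (A : nat) (D : pred 'I_A) (y : 'I_A -> R) : set Omega :=
  [set w | forall a, D a -> no_point_above h (t^~ w) (j^~ w) a (y a)].

Hypothesis mt : forall k, measurable_fun setT (t k).
Hypothesis mj : forall k, measurable_fun setT (j k).

Let m_gt k (y : R) : measurable [set w | (y%:E < j k w)%E].
Proof.
rewrite -[X in measurable X]setTI.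
exact: (emeasurable_fun_o_infty measurableT (mj k)).
Qed.

Let m_lt k (y : R) : measurable [set w | t k w < y].
Proof.
have := mt k; move=> /(_ measurableT _ (measurable_itv `]-oo, y[)).
by rewrite setTI; congr measurable; apply/seteqP; split => w /=; rewrite in_itv.
Qed.

Let m_co k (l r : R) : measurable [set w | l <= t k w < r].
Proof.
have := mt k; move=> /(_ measurableT _ (measurable_itv `[l, r[)).
by rewrite setTI; congr measurable; apply/seteqP; split => w /=; rewrite in_itv.
Qed.

Let m_eq k (l : R) : measurable [set w | t k w = l].
Proof.
have := mt k; move=> /(_ measurableT _ (measurable_set1 l)).
by rewrite setTI.
Qed.

Lemma measurable_in_box l r y k : measurable (in_box l r y k).
Proof. exact: (measurableI _ _ (m_co k l r) (m_gt k y)). Qed.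

Lemma measurable_ev_neg : measurable ev_neg.
Proof. by apply: bigcup_measurable => k _. Qed.

Lemma measurable_ev_pair h e a : measurable (ev_pair h e a).
Proof.
apply: bigcup_measurable => k _; apply: bigcup_measurable => k' _.
by apply: measurableI; exact: measurable_in_box.
Qed.

Lemma measurable_ev_edge h e a : measurable (ev_edge h e a).
Proof.
by apply: bigcup_measurable => k _; exact: (measurableI _ _ (m_eq k _) (m_gt k e)).
Qed.

Lemma measurable_ev_high T H : measurable (ev_high T H).
Proof.
by apply: bigcup_measurable => k _; exact: (measurableI _ _ (m_lt k T) (m_gt k H)).
Qed.

Lemma no_point_aboveE h a y : [set w | no_point_above h (t^~ w) (j^~ w) a y] =
  \bigcap_k ~` in_box (a%:R * h) (a.+1%:R * h) y k.
Proof.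
apply/seteqP; split=> w /= H k.
  by move=> _ [ka]; apply/negP; rewrite -leNgt; exact: H.
by move=> ka; rewrite leNgt; apply/negP => kj; exact: (H k).
Qed.

Lemma measurable_no_point_above h a y :
  measurable [set w | no_point_above h (t^~ w) (j^~ w) a y].
Proof.
rewrite no_point_aboveE; apply: bigcapT_measurable => k.
exact/measurableC/measurable_in_box.
Qed.

Lemma measurable_ev_clear h A (D : pred 'I_A) y : measurable (ev_clear h D y).
Proof.
apply: (@fin_bigcap_measurable _ _ _ [set a | D a]
  (fun a : 'I_A => [set w | no_point_above h (t^~ w) (j^~ w) a (y a)])).
  exact: finite_finset.
by move=> a _; exact: measurable_no_point_above.
Qed.

Section labels.
Variables (h e : R) (A B : nat).
Hypothesis e0 : 0 < e.

Definition config_label (w : Omega) : {ffun 'I_A -> 'I_B.+1} :=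
  [ffun a : 'I_A => inord (column_label h e B (t^~ w) (j^~ w) a)].

Lemma config_labelE w a :
  config_label w a = column_label h e B (t^~ w) (j^~ w) a :> nat.
Proof. by rewrite ffunE inordK// ltnS column_label_max. Qed.

(** A column with the top value [B] imposes no condition, since labels never exceed [B]; every other
    column asks for an empty box. Hence void probabilities determine the law of the label. *)
Lemma ev_clear_label (c : {ffun 'I_A -> 'I_B.+1}) :
  ev_clear h (fun a => (c a < B)%N) (fun a => (c a).+1%:R * e) =
  [set w | [forall a, config_label w a <= c a]%N].
Proof.
apply/seteqP; split => w /= H.
  apply/forallP => a; rewrite config_labelE.
  have [cB|cB] := ltnP (c a) B; last by rewrite (leq_trans (column_label_max _ _ _ _ _ _)).
  by rewrite column_label_le//; apply/asboolP; exact: H.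
move=> a ca; move/forallP : H => /(_ a); rewrite config_labelE column_label_le//.
by move/asboolP.
Qed.

Lemma measurable_config_label c : measurable (config_label @^-1` [set c]).
Proof.
have mle (a : 'I_A) (b : nat) : measurable [set w | (config_label w a <= b)%N].
  have [bB|bB] := ltnP b B.
    rewrite [X in measurable X](_ : _ = [set w |
      no_point_above h (t^~ w) (j^~ w) a (b.+1%:R * e)]).
      exact: measurable_no_point_above.
    apply/seteqP; split => w /=; rewrite config_labelE column_label_le//;
    by [move/asboolP|move=> ?; exact/asboolP].
  rewrite [X in measurable X](_ : _ = setT)//.
  apply/seteqP; split => w //= _; rewrite config_labelE.
  by rewrite (leq_trans (column_label_max _ _ _ _ _ _)).
have meq (a : 'I_A) : measurable [set w | config_label w a = c a].
  rewrite [X in measurable X](_ : _ = [set w | (config_label w a <= c a)%N] `&`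
      \bigcap_(b in [set b : nat | (b < c a)%N]) ~` [set w | (config_label w a <= b)%N]).
    by apply: measurableI => //; apply: bigcap_measurableType => b _; exact: measurableC.
  apply/seteqP; split => w /=.
    by move=> cE; split=> [|b /= bc]; [rewrite cE|rewrite /setC /= cE leqNgt bc].
  move=> [le H]; apply/val_inj/eqP; rewrite /= eqn_leq le /= leqNgt; apply/negP => lt.
  by have := H _ lt; apply => /=.
rewrite [X in measurable X](_ : _ = \bigcap_(a in setT)
    [set w | config_label w a = c a]).
  by apply: fin_bigcap_measurable => [|a _]; [exact: finite_finset|exact: meq].
apply/seteqP; split => w /=; first by move=> cE a _ /=; rewrite cE.
by move=> H; apply/ffunP => a; exact: H.
Qed.

Lemma ev_clear_sum (P : probability Omega R) (c : {ffun 'I_A -> 'I_B.+1}) :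
  fine (P (ev_clear h (fun a => (c a < B)%N) (fun a => (c a).+1%:R * e))) =
  \sum_(c' : {ffun 'I_A -> 'I_B.+1} | [forall a, c' a <= c a]%N)
    fine (P (config_label @^-1` [set c'])).
Proof.
have := @integral_label _ _ _ P _ _ measurable_config_label
  (fun c' : {ffun 'I_A -> 'I_B.+1} => ([forall a, c' a <= c a]%N)%:R) 0 _ measurable0.
under eq_integral do rewrite mul0r addr0.
rewrite mul0r addr0.
rewrite (_ : (fun w => _) = (fun w => (\1_(ev_clear h (fun a => (c a < B)%N)
    (fun a => (c a).+1%:R * e)) w)%:E)); last first.
  apply/funext => w; rewrite indicE ev_clear_label.
  by congr ((nat_of_bool _)%:R%:E); apply/idP/idP; rewrite inE.
rewrite integral_indic ?setIT//; last exact: measurable_ev_clear.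
move=> ->; rewrite /= [RHS]big_mkcond; apply: eq_bigr => c' _.
by case: ifPn => _; rewrite ?mul1r ?mul0r.
Qed.

End labels.

Definition bad_config h (A : nat) e (B : nat) : set Omega :=
  ev_neg `|` (\big[setU/set0]_(a < A) ev_pair h e a `|`
  (\big[setU/set0]_(a < A) ev_edge h e a `|` ev_high (A%:R * h) (B%:R * e))).

Lemma measurable_bad_config h A e B : measurable (bad_config h A e B).
Proof.
apply: measurableU; first exact: measurable_ev_neg.
apply: measurableU.
  by apply: bigsetU_measurable => a _; exact: measurable_ev_pair.
apply: measurableU; last exact: measurable_ev_high.
by apply: bigsetU_measurable => a _; exact: measurable_ev_edge.
Qed.

Lemma not_bad_config h A e B w : ~ bad_config h A e B w ->
  good_config h A e B (t^~ w) (j^~ w).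
Proof.
move=> /not_orP[nneg] /not_orP[npair] /not_orP[nedge nhigh]; split.
- by move=> k; rewrite leNgt; apply/negP => tk; apply: nneg; exists k.
- move=> a k k' aA ka k'a kj k'j.
  have [->//|kk'] := eqVneq k k'; exfalso; apply: npair.
  rewrite -bigcup_mkord; exists a => //.
  move: kk'; rewrite neq_ltn => /orP[kk'|kk'].
    by exists k => //; exists k'.
  by exists k' => //; exists k.
- move=> a k aA tk; rewrite leNgt; apply/negP => kj; apply: nedge.
  by rewrite -bigcup_mkord; exists a => //; exists k.
- by move=> k tk; rewrite leNgt; apply/negP => kj; apply: nhigh; exists k.
Qed.

Lemma bad_config_le (P : probability Omega R) h A e B (p q s : R) :
  P ev_neg = 0%E -> (forall a : 'I_A, (P (ev_pair h e a) <= p%:E)%E) ->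
  (forall a : 'I_A, (P (ev_edge h e a) <= q%:E)%E) ->
  (P (ev_high (A%:R * h) (B%:R * e)) <= s%:E)%E ->
  (P (bad_config h A e B) <= (A%:R * p + A%:R * q + s)%:E)%E.
Proof.
move=> P0 Pp Pq Ps.
have mp : measurable (\big[setU/set0]_(a < A) ev_pair h e a).
  by apply: bigsetU_measurable => a _; exact: measurable_ev_pair.
have me : measurable (\big[setU/set0]_(a < A) ev_edge h e a).
  by apply: bigsetU_measurable => a _; exact: measurable_ev_edge.
have mh := measurable_ev_high (A%:R * h) (B%:R * e).
rewrite /bad_config -addrA !EFinD.
rewrite -[leRHS]add0e; apply: prob_setU_le; rewrite ?P0//.
- exact: measurable_ev_neg.
- by apply: measurableU => //; exact: measurableU.
apply: prob_setU_le => //; first exact: measurableU.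
  by apply: prob_bigsetU_le => // a; exact: measurable_ev_pair.
by apply: prob_setU_le => //; apply: prob_bigsetU_le => // a; exact: measurable_ev_edge.
Qed.

End config_events.

(* The point masses are recovered from the lower-orthant masses by induction on
   the sum of the coordinates of the label. *)
Lemma orthant_cvg (R : realType) (A B : nat)
    (p : nat -> {ffun 'I_A -> 'I_B} -> R) (q : {ffun 'I_A -> 'I_B} -> R) :
  (forall c : {ffun 'I_A -> 'I_B},
     (\sum_(c' : {ffun 'I_A -> 'I_B} | [forall a, c' a <= c a]%N) p n c') @[n --> \oo] -->
      \sum_(c' : {ffun 'I_A -> 'I_B} | [forall a, c' a <= c a]%N) q c') ->
  forall c, p n c @[n --> \oo] --> q c.
Proof.
move=> pq c; have [m] := ubnP (\sum_a c a)%N.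
elim: m c => // m IH c cm.
have refl : [forall a, c a <= c a]%N by apply/forallP.
have sub : (\sum_(c' : {ffun 'I_A -> 'I_B} | [forall a, c' a <= c a]%N && (c' != c)) p n c')
    @[n --> \oo] -->
    \sum_(c' : {ffun 'I_A -> 'I_B} | [forall a, c' a <= c a]%N && (c' != c)) q c'.
  apply: cvg_big; first exact: add_continuous.
  move=> c' /andP[/forallP le ne]; apply: IH.
  move: cm; rewrite ltnS; apply: leq_trans.
  have [a ca] : exists a, c' a != c a.
    apply/existsP; rewrite -negb_forall; apply: contra ne => /forallP H.
    by apply/eqP/ffunP => a; exact/eqP.
  rewrite (bigD1 a)//= [ltnRHS](bigD1 a)//= -addSn leq_add//.
    by rewrite ltn_neqAle ca le.
  by apply: leq_sum => i _; exact: le.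
have dif (g : {ffun 'I_A -> 'I_B} -> R) : g c =
    \sum_(c' : {ffun 'I_A -> 'I_B} | [forall a, c' a <= c a]%N) g c' -
    \sum_(c' : {ffun 'I_A -> 'I_B} | [forall a, c' a <= c a]%N && (c' != c)) g c'.
  by rewrite (bigD1 c)//= addrK.
rewrite (dif q) (_ : (fun n => p n c) = (fun n =>
    \sum_(c' : {ffun 'I_A -> 'I_B} | [forall a, c' a <= c a]%N) p n c' -
    \sum_(c' : {ffun 'I_A -> 'I_B} | [forall a, c' a <= c a]%N && (c' != c)) p n c')).
  by apply: cvgB; [exact: pq|exact: sub].
by apply/funext => n; exact: dif.
Qed.

Lemma step_cell_ext (R : realType) (h : R) A e (c c' : nat -> nat) z :
  (forall a, (a < A)%N -> c a = c' a) -> step_cell h A e c z -> step_cell h A e c' z.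
Proof.
move=> cc [s sP]; exists s => a aA.
have hE b : (b <= A)%N -> cell_height e c b = cell_height e c' b.
  move=> bA; rewrite /cell_height; congr (_%:R * _); apply: eq_bigr => i _.
  by apply: cc; exact: leq_trans (ltn_ord i) bA.
by have [s1 s2 s3] := sP _ aA; split => //; rewrite -hE// ltnW.
Qed.

(** * From point configurations to cells of paths *)

Section points_to_cells.
Variable R : realType.
Context d (Omega : measurableType d) (P : probability Omega R)
  (Z : nat -> Omega -> R -> R)
  (tn : nat -> nat -> Omega -> R) (jn : nat -> nat -> Omega -> \bar R).
Context d' (Omega' : measurableType d') (Q : probability Omega' R)
  (S : Omega' -> R -> R)
  (t : nat -> Omega' -> R) (j : nat -> Omega' -> \bar R).
Variable alpha : R.
Hypothesis alpha0 : 0 < alpha.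
Hypothesis mtn : forall n k, measurable_fun setT (tn n k).
Hypothesis mjn : forall n k, measurable_fun setT (jn n k).
Hypothesis mt : forall k, measurable_fun setT (t k).
Hypothesis mj : forall k, measurable_fun setT (j k).

Hypothesis clear_cvg : forall (h : R) (A : nat) (D : pred 'I_A) (y : 'I_A -> R),
  0 < h -> (forall a, 0 < y a) ->
  fine (P (ev_clear (tn n) (jn n) h D y)) @[n --> \oo] -->
  fine (Q (ev_clear t j h D y)).
Hypothesis neg_n : forall n, P (ev_neg (tn n)) = 0%E.
Hypothesis neg_lim : Q (ev_neg t) = 0%E.
Hypothesis pair_n : forall (h e : R) (a : nat), 0 < h -> 0 < e ->
  \forall n \near \oo,
    (P (ev_pair (tn n) (jn n) h e a) <= (2 * (h * e `^ (- alpha)) ^+ 2)%:E)%E.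
Hypothesis pair_lim : forall (h e : R) (a : nat), 0 < h -> 0 < e ->
  (Q (ev_pair t j h e a) <= (2 * (h * e `^ (- alpha)) ^+ 2)%:E)%E.
Hypothesis edge_n : forall (h e : R) (a : nat) (q : R), 0 < h -> 0 < e -> 0 < q ->
  \forall n \near \oo, (P (ev_edge (tn n) (jn n) h e a) <= q%:E)%E.
Hypothesis edge_lim : forall (h e : R) (a : nat), 0 < h -> 0 < e ->
  Q (ev_edge t j h e a) = 0%E.
Hypothesis high_n : forall T H : R, 0 < T -> 0 < H ->
  \forall n \near \oo,
    (P (ev_high (tn n) (jn n) T H) <= (2 * (T * H `^ (- alpha)))%:E)%E.
Hypothesis high_lim : forall T H : R, 0 < T -> 0 < H ->
  (Q (ev_high t j T H) <= (2 * (T * H `^ (- alpha)))%:E)%E.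
Hypothesis tracks_n : forall T e q : R, 0 < T -> 0 < e -> 0 < q ->
  exists bad : nat -> set Omega, [/\ forall n, measurable (bad n),
    \forall n \near \oo, (P (bad n) <= q%:E)%E &
    \forall n \near \oo, forall w, ~ bad n w ->
      tracks T e ((tn n)^~ w) ((jn n)^~ w) (Z n w)].
Hypothesis tracks_lim : exists N, [/\ measurable N, Q N = 0%E &
  forall w T e H, ~ N w -> 0 < e -> 0 < H ->
    (forall k, t k w < T -> (j k w <= H%:E)%E) ->
    tracks T e (t^~ w) (j^~ w) (S w)].

(** Four events share [del] equally: two high points in a column, a high point on an edge, a mark
    above all levels, failure of tracking. The level [e] is fixed before the mesh, since the pair
    bound is quadratic in [h] and so of order [1 / A] after summation over columns. *)
Lemma cell_approximation_of_points del : 0 < del -> cell_approximation P Z Q S del.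
Proof.
move=> del0.
pose e := del / 4; pose T := del^-1 + 1.
have e0 : 0 < e by rewrite divr_gt0.
have T0 : 0 < T by rewrite ltr_wpDl// invr_ge0 ltW.
pose ea := e `^ (- alpha); have ea0 : 0 < ea by exact: powR_gt0.
(* The first entry gives [h <= del]; the second makes the sum of the pair bounds,
   [2 * (T * ea) ^+ 2 / A], at most [del / 4]. *)
pose A := (Num.truncn (Num.max (T / del) (8 * (T * ea) ^+ 2 / del))).+1.
have A0 : 0 < A%:R :> R by rewrite ltr0n.
have [AT Ae] : T / del <= A%:R /\ 8 * (T * ea) ^+ 2 / del <= A%:R.
  have := truncnS_gt (Num.max (T / del) (8 * (T * ea) ^+ 2 / del)).
  by rewrite gt_max => /andP[/ltW ? /ltW ?].
pose h := T / A%:R; have h0 : 0 < h by rewrite divr_gt0.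
have AhT : A%:R * h = T by rewrite mulrC divfK// lt0r_neq0.
(* Chosen so that [2 * T] times [x] to the power [- alpha] is [del / 4]. *)
pose x := (8 * T / del) `^ alpha^-1.
pose B := (Num.truncn (x / e)).+1.
have B0 : 0 < B%:R :> R by rewrite ltr0n.
have hB : 2 * (T * (B%:R * e) `^ (- alpha)) <= del / 4.
  have xBe : x <= B%:R * e by rewrite -ler_pdivrMr//; exact/ltW/truncnS_gt.
  have x0 : 0 <= x by exact: powR_ge0.
  have : x `^ alpha <= (B%:R * e) `^ alpha.
    apply: ge0_ler_powR; rewrite ?nnegrE//; first exact: ltW.
    by rewrite mulr_ge0// ltW.
  rewrite /x -powRrM mulVf ?lt0r_neq0// powRr1; last first.
    by rewrite divr_ge0 ?mulr_ge0// ltW.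
  rewrite ler_pdivrMr// powRN => H.
  have Ba0 : 0 < (B%:R * e) `^ alpha by rewrite powR_gt0// mulr_gt0.
  rewrite mulrA ler_pdivrMr//; lra.
have hp : A%:R * (2 * (h * ea) ^+ 2) <= del / 4.
  rewrite /h (_ : _ * _ = 2 * (T * ea) ^+ 2 / A%:R); last by field; exact: lt0r_neq0.
  rewrite ler_pdivrMr//; move: Ae; rewrite ler_pdivrMr//; lra.
pose q := del / 4 / A%:R.
have q0 : 0 < q by rewrite !divr_gt0.
have Aq : A%:R * q = del / 4 by rewrite mulrC divfK// lt0r_neq0.
have hT : 0 < A%:R * h by rewrite AhT.
have Be0 : 0 < B%:R * e by rewrite mulr_gt0.
have d40 : 0 < del / 4 by rewrite divr_gt0.
have [gw [mgw Pgw gwP]] := tracks_n hT e0 d40.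
have [N [mN QN NP]] := tracks_lim.
have near_ord (F : nat -> 'I_A -> Prop) : (forall a, \forall n \near \oo, F n a) ->
    \forall n \near \oo, forall a, F n a.
  by move=> FH; exact: filter_forall.
(* The value 0 past column [A] is arbitrary: a cell does not look there. *)
pose kappa (c : {ffun 'I_A -> 'I_B.+1}) (a : nat) : nat :=
  if insub a is Some i then c i else 0%N.
exists h, e, A, {ffun 'I_A -> 'I_B.+1}, kappa,
  (fun n => config_label (tn n) (jn n) h e A B), (config_label t j h e A B),
  (fun n => bad_config (tn n) (jn n) h A e B `|` gw n),
  (bad_config t j h A e B `|` N).
have kap d0 (O : measurableType d0) (t' : nat -> O -> R) j' w z :
    step_cell h A e (column_label h e B (t'^~ w) (j'^~ w)) z ->
    step_cell h A e (kappa (config_label t' j' h e A B w)) z.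
  apply: step_cell_ext => a aA; rewrite /kappa.
  by case: insubP => [i _ ia|]; [rewrite config_labelE ia|rewrite aA].
split.
- split => //; last 2 first.
  + by rewrite /e; lra.
  + by rewrite AhT ltrDl.
  by rewrite ler_pdivrMr// mulrC -ler_pdivrMr.
- split; [by move=> n c; exact: measurable_config_label|
          by move=> c; exact: measurable_config_label|].
  apply: orthant_cvg => c.
  under eq_fun do rewrite -ev_clear_sum//.
  rewrite -ev_clear_sum//; apply: clear_cvg => // a.
  by rewrite mulr_gt0.
- split.
  + by move=> n; apply: measurableU => //; exact: measurable_bad_config.
  + by apply: measurableU => //; exact: measurable_bad_config.
  + near=> n.
    have -> : del = (del / 4 + del / 4 + del / 4) + del / 4 by lra.
    rewrite EFinD; apply: prob_setU_le => //; last by near: n.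
      exact: measurable_bad_config.
    apply: le_trans.
      apply: (@bad_config_le _ _ _ _ _ (mtn n) (mjn n) P h A e B
        (2 * (h * ea) ^+ 2) q (2 * (A%:R * h * (B%:R * e) `^ (- alpha)))) => //.
      * by near: n; apply: near_ord => a; exact: pair_n.
      * by near: n; apply: near_ord => a; exact: edge_n.
      * by near: n; exact: high_n.
    by rewrite lee_fin Aq AhT; lra.
  + rewrite -[leRHS]adde0; apply: prob_setU_le; rewrite ?QN//.
      exact: measurable_bad_config.
    apply: le_trans.
      apply: (@bad_config_le _ _ _ _ _ mt mj Q h A e B
        (2 * (h * ea) ^+ 2) 0 (2 * (A%:R * h * (B%:R * e) `^ (- alpha)))) => //.
      * by move=> a; exact: pair_lim.
      * by move=> a; rewrite edge_lim.
      * exact: high_lim.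
    by rewrite lee_fin mulr0 addr0 AhT; lra.
- near=> n => w /not_orP[nb ng]; apply: kap.
  apply: good_config_step_cell => //; first exact: not_bad_config.
  by move: w ng {nb}; near: n.
- move=> w /not_orP[nb nN]; apply: kap; have good := not_bad_config nb.
  apply: good_config_step_cell => //; apply: (NP w _ e _ nN e0 Be0).
  by have [] := good.
Unshelve. all: by end_near. Qed.

End points_to_cells.

(** * The Poisson random measure *)

Section poisson_side.
Variable R : realType.
Local Open Scope ereal_scope.

Lemma mean_measure_box (mu : measure (\bar R) R) (T : set R) (Y : set (\bar R)) :
  measurable T -> mean_measure mu (T `*` Y) =
  mu Y * (@lebesgue_measure R) (T `&` [set x | (0 <= x)%R]).
Proof.
move=> mT; rewrite /mean_measure.
have m0 : measurable [set x : R | (0 <= x)%R].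
  rewrite (_ : [set _ | _] = [set` `[0%R, +oo[]); first exact: measurable_itv.
  by apply/seteqP; split => x /=; rewrite in_itv /= andbT.
transitivity (\int[@lebesgue_measure R]_(x in [set x : R | (0 <= x)%R])
    (mu Y * (\1_T x)%:E)).
  apply: eq_integral => x _; rewrite indicE.
  have [xT|xT] := boolP (x \in T); first by rewrite in_xsectionX// mule1.
  by rewrite notin_xsectionX// measure0 mule0.
rewrite ge0_integralZl//; last by apply/measurable_EFinP; exact: measurable_indic.
by rewrite integral_indic.
Qed.

Context d (Omega : measurableType d) (Q : probability Omega R).
Variables (t : nat -> Omega -> R) (j : nat -> Omega -> \bar R).

Lemma count_pts_eq0 w B :
  count_pts t j w B = 0 <-> forall k, ~ B (t k w, j k w).
Proof.
rewrite /count_pts; split=> [c0 k Bk|nB].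
  have : \sum_(0 <= i < k.+1) (if `[< B (t i w, j i w) >] then 1 else 0)%R%:E <= 0 :> \bar R.
    rewrite -[leRHS]c0; apply: nneseries_lim_ge => i _ _.
    by rewrite lee_fin; case: ifP.
  rewrite big_nat_recr//= asboolT// => le0.
  have : (1 : \bar R) <= 0.
    apply: le_trans le0; rewrite leeDr//; apply: sume_ge0 => i _.
    by rewrite lee_fin; case: ifP.
  by rewrite lee_fin ler10.
by apply: eseries0 => i _ _; rewrite asboolF.
Qed.

Lemma count_pts_pair w B k k' : (k < k')%N -> B (t k w, j k w) ->
  B (t k' w, j k' w) -> 1 < count_pts t j w B.
Proof.
move=> kk' Bk Bk'.
pose f i : \bar R := (if `[< B (t i w, j i w) >] then 1 else 0)%R%:E.
have f0 i : 0 <= f i by rewrite /f lee_fin; case: ifP.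
have fk : f k = 1 by rewrite /f asboolT.
have fk' : f k' = 1 by rewrite /f asboolT.
have s1 : 1 <= \sum_(0 <= i < k') f i.
  rewrite big_mkord (bigD1 (Ordinal kk'))//= fk leeDl//.
  exact: sume_ge0.
have : \sum_(0 <= i < k'.+1) f i <= count_pts t j w B.
  by apply: nneseries_lim_ge => i _ _.
apply: lt_le_trans; rewrite big_nat_recr//= fk'.
by apply: (@lt_le_trans _ _ (1 + 1)); [rewrite lte_fin ltrDl|exact: leeD].
Qed.

Variables (mu : measure (\bar R) R) (alpha : R).
Hypothesis muE : is_mu_ab 1 alpha mu.
Hypothesis prm : is_PRM Q t j (mean_measure mu).

Let mt : forall k, measurable_fun setT (t k). Proof. by case: prm. Qed.
Let mj : forall k, measurable_fun setT (j k). Proof. by case: prm => _ []. Qed.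

Let m_above (y : \bar R) : measurable [set z : \bar R | y < z].
Proof.
rewrite (_ : [set _ | _] = `]y, +oo]%classic); first exact: emeasurable_itv.
by apply/seteqP; split => z /=; rewrite in_itv /= leey andbT.
Qed.

Let m_co (l r : R) : measurable [set x : R | (l <= x < r)%R].
Proof.
rewrite (_ : [set _ | _] = [set` `[l, r[]); first exact: measurable_itv.
by apply/seteqP; split => x /=; rewrite in_itv.
Qed.

Let mu_above (y : R) : (0 < y)%R -> mu [set z | y%:E < z] = (y `^ (- alpha))%:E.
Proof. by move=> y0; have [_ ->//] := muE; rewrite mul1r. Qed.

Let box (l r y : R) : set (R * \bar R) :=
  [set x | (l <= x < r)%R] `*` [set z | y%:E < z].

Let m_box l r y : measurable (box l r y). Proof. exact: measurableX. Qed.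

Let box_mean l r y : (0 <= l)%R -> (l <= r)%R -> (0 < y)%R ->
  mean_measure mu (box l r y) = ((r - l) * y `^ (- alpha))%:E.
Proof.
move=> l0 lr y0; rewrite mean_measure_box// mu_above//.
rewrite (_ : _ `&` _ = [set` `[l, r[]); last first.
  apply/seteqP; split => x /=; rewrite in_itv /=; first by case.
  by move=> /[dup] lxr /andP[lx _]; split => //; exact: le_trans lx.
rewrite lebesgue_measure_itv /= lte_fin.
move: lr; rewrite le_eqVlt => /predU1P[->|->]; last by rewrite -EFinB mulrC EFinM.
by rewrite ltxx subrr mul0r mule0.
Qed.

Lemma prm_single (B : set (R * \bar R)) (c : nat) : measurable B ->
  mean_measure mu B < +oo ->
  Q [set w | count_pts t j w B = c%:R%:E] =
  (Defs.poisson_pmf (fine (mean_measure mu B)) c)%:E.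
Proof.
move=> mB fB; have [_ [_ H]] := prm.
have := H 1%N (fun=> B) (fun=> c) (fun=> mB) (fun=> fB).
rewrite big_ord1 => <-; last by move=> i i'; rewrite (ord1 i) (ord1 i') eqxx.
by congr (Q _); apply/seteqP; split => w /= wB // ; exact: (wB ord0).
Qed.

(** The count of a set of mean 0 is Poisson with parameter 0, hence almost surely 0. *)
Lemma prm_null (B : set (R * \bar R)) (E : nat -> set Omega) : measurable B ->
  (forall k, measurable (E k)) ->
  mean_measure mu B = 0 -> (forall k w, E k w -> B (t k w, j k w)) ->
  Q (\bigcup_k E k) = 0.
Proof.
move=> mB mE B0 EB.
have mU : measurable (\bigcup_k E k) by exact: bigcup_measurable.
have c1 : Q [set w | count_pts t j w B = 0%:R%:E] = 1.
  rewrite prm_single// B0 ?ltry//.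
  by rewrite /Defs.poisson_pmf /= oppr0 expR0 mul1r expr0 divr1.
have E1 : Q (~` \bigcup_k E k) = 1.
  apply/eqP; rewrite eq_le probability_le1 ?andTb//=; last exact: measurableC.
  rewrite -c1; apply: le_measure; rewrite ?inE//; [|exact: measurableC|].
    have -> : [set w | count_pts t j w B = 0%:R%:E] =
        \bigcap_k ~` [set w | B (t k w, j k w)].
      apply/seteqP; split => w /=; first by move=> /count_pts_eq0 H k _; exact: H.
      by move=> H; apply/count_pts_eq0 => k; exact: H.
    apply: bigcapT_measurable => k; apply: measurableC.
    have mtj : measurable_fun setT (fun w => (t k w, j k w)).
      exact: measurable_fun_pair.
    by have := mtj measurableT _ mB; rewrite setTI.
  by move=> w /= /count_pts_eq0 H [k _ Ek]; exact: (H k (EB _ _ Ek)).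
have := @probability_setC _ _ _ Q _ mU; rewrite E1 => H.
have : Q (\bigcup_k E k) \is a fin_num by exact: fin_num_measure.
move: H; case: (Q _) => // r; rewrite -EFinB => -[H] _.
by congr (_%:E); lra.
Qed.

Lemma prm_neg : Q (ev_neg t) = 0.
Proof.
apply: (@prm_null ([set x | (x < 0)%R] `*` setT)).
- apply: measurableX => //.
  rewrite (_ : [set _ | _] = [set` `]-oo, 0%R[]); first exact: measurable_itv.
  by apply/seteqP; split => x /=; rewrite in_itv.
- move=> k; have := mt k measurableT (measurable_itv `]-oo, 0%R[).
  rewrite setTI; congr measurable; apply/seteqP; split => w /=; by rewrite in_itv.
- rewrite mean_measure_box; last first.
    rewrite (_ : [set _ | _] = [set` `]-oo, 0%R[]); first exact: measurable_itv.
    by apply/seteqP; split => x /=; rewrite in_itv.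
  (* The mass of all marks may be infinite, but its product with the length 0 is 0. *)
  rewrite (_ : _ `&` _ = set0) ?measure0 ?mule0//.
  by apply/seteqP; split => x //= -[]; rewrite leNgt => ->.
- by [].
Qed.

Lemma prm_nonpos : Q (\bigcup_k [set w | j k w <= 0]) = 0.
Proof.
have mneg : measurable [set y : \bar R | y <= 0].
  rewrite (_ : [set _ | _] = ~` [set y : \bar R | 0 < y]); first exact: measurableC.
  by apply/seteqP; split => y /=; rewrite leNgt => /negP.
apply: (@prm_null (setT `*` [set y | y <= 0])).
- exact: measurableX.
- by move=> k; have := mj k measurableT mneg; rewrite setTI.
- by rewrite mean_measure_box//; have [-> _] := muE; rewrite mul0e.
- by [].
Qed.

Lemma prm_edge h e a : (0 < e)%R -> Q (ev_edge t j h e a) = 0.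
Proof.
move=> e0; apply: (@prm_null ([set a%:R * h]%R `*` [set y | e%:E < y])).
- exact: measurableX.
- move=> k; apply: (measurableI _ _ (_ : measurable [set w | t k w = (a%:R * h)%R])).
    by have := mt k measurableT (measurable_set1 (a%:R * h)%R); rewrite setTI.
  by have := mj k measurableT (m_above e%:E); rewrite setTI.
- rewrite mean_measure_box// mu_above//.
  suff -> : (@lebesgue_measure R) ([set (a%:R * h)%R] `&` [set x | (0 <= x)%R]) = 0.
    by rewrite mule0.
  have [H|H] := pselect (0 <= a%:R * h)%R.
    rewrite (_ : _ `&` _ = [set (a%:R * h)%R]) ?lebesgue_measure_set1//.
    by apply/seteqP; split => x /=; [case|move=> ->].
  rewrite (_ : _ `&` _ = set0) ?measure0//.
  by apply/seteqP; split => x //= [->].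
- by [].
Qed.

(** One minus a void probability, [1 - exp (- lam) <= lam]. The box starts at time 0, so the null
    event of negative times is added. *)
Lemma prm_high (T H : R) : (0 < T)%R -> (0 < H)%R ->
  Q (ev_high t j T H) <= (2 * (T * H `^ (- alpha)))%:E.
Proof.
move=> T0 H0.
have mU := measurable_ev_high mt mj T H.
pose lam := (T * H `^ (- alpha))%R.
have lam0 : (0 <= lam)%R by rewrite mulr_ge0 ?powR_ge0// ltW.
have c0 : Q [set w | count_pts t j w (box 0 T H) = 0%:R%:E] = (expR (- lam))%:E.
  rewrite prm_single//; rewrite box_mean ?ltry// ?ltW//= subr0.
  by rewrite /Defs.poisson_pmf expr0 mulr1 divr1.
have m0 : measurable [set w | count_pts t j w (box 0 T H) = 0%:R%:E].
  rewrite (_ : [set _ | _] = \bigcap_k ~` in_box t j 0 T H k).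
    by apply: bigcapT_measurable => k; exact/measurableC/measurable_in_box.
  apply/seteqP; split => w /=.
    by move=> /count_pts_eq0 Hk k _ kb; exact: (Hk k).
  by move=> Hk; apply/count_pts_eq0 => k kb; exact: (Hk k).
have mneg := measurable_ev_neg mt.
apply: (@le_trans _ _ (Q (~` [set w | count_pts t j w (box 0 T H) = 0%:R%:E] `|` ev_neg t))).
  apply: le_measure; rewrite ?inE//.
    by apply: measurableU => //; exact: measurableC.
  move=> w [k _ /= [tk jk]]; have [t0|t0] := leP 0%R (t k w); last by right; exists k.
  by left => /= /count_pts_eq0 /(_ k); apply; split => //=; rewrite t0.
apply: (@le_trans _ _ ((1 - expR (- lam))%:E + 0)).
  apply: prob_setU_le => //; [exact: measurableC| |by rewrite prm_neg].
  by rewrite probability_setC// c0 EFinB.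
rewrite adde0 lee_fin -/lam; have := expR_ge1Dx (- lam); lra.
Qed.

(** Two or more points have probability [1 - exp (- lam) * (1 + lam)], at most [lam ^ 2] because
    [exp (- lam) >= 1 - lam]. *)
Lemma prm_pair (h e : R) (a : nat) : (0 < h)%R -> (0 < e)%R ->
  Q (ev_pair t j h e a) <= (2 * (h * e `^ (- alpha)) ^+ 2)%:E.
Proof.
move=> h0 e0.
have mU := measurable_ev_pair mt mj h e a.
pose lam := (h * e `^ (- alpha))%R.
have lam0 : (0 <= lam)%R by rewrite mulr_ge0 ?powR_ge0// ltW.
pose B := box (a%:R * h) (a.+1%:R * h) e.
have mB : measurable B by exact: m_box.
have BE : mean_measure mu B = lam%:E.
  rewrite box_mean//.
  - by rewrite -mulrBl -natr1 addrAC subrr add0r mul1r.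
  - by rewrite mulr_ge0// ltW.
  - by rewrite ler_pM2r// ler_nat.
have B0 : mean_measure mu B < +oo by rewrite BE ltry.
have c0 : Q [set w | count_pts t j w B = 0%:R%:E] = (expR (- lam))%:E.
  by rewrite prm_single// BE /Defs.poisson_pmf /= expr0 mulr1 divr1.
have c1 : Q [set w | count_pts t j w B = 1%:R%:E] = (expR (- lam) * lam)%:E.
  by rewrite prm_single// BE /Defs.poisson_pmf /= expr1 divr1.
have mc c : measurable [set w | count_pts t j w B = c%:R%:E].
  have mcount : measurable_fun setT (fun w => count_pts t j w B).
    apply: ge0_emeasurable_sum => k.
      by move=> w _ _; rewrite lee_fin; case: ifP.
    move=> _; apply/measurable_EFinP.
    rewrite (_ : (fun _ => _) = \1_(in_box t j (a%:R * h) (a.+1%:R * h) e k)).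
      by apply: measurable_indic; exact: measurable_in_box.
    apply/funext => w; rewrite indicE; case: asboolP => H; first by rewrite mem_set.
    by rewrite memNset.
  have := mcount measurableT _ (emeasurable_set1 c%:R%:E); rewrite setTI; exact.
have c01 : Q ([set w | count_pts t j w B = 0%:R%:E] `|`
    [set w | count_pts t j w B = 1%:R%:E]) = (expR (- lam) * (1 + lam))%:E.
  transitivity (Q [set w | count_pts t j w B = 0%:R%:E] +
      Q [set w | count_pts t j w B = 1%:R%:E]); last first.
    by rewrite c0 c1 -EFinD mulrDr mulr1.
  apply: measureU; [exact: mc|exact: mc|].
  apply/seteqP; split => w //= [-> /eqP].
  by rewrite eqe eqr_nat.
apply: (@le_trans _ _ (Q (~` ([set w | count_pts t j w B = 0%:R%:E] `|`
    [set w | count_pts t j w B = 1%:R%:E])))).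
  apply: le_measure; rewrite ?inE//; first by apply/measurableC/measurableU; exact: mc.
  move=> w [k _ [k' /= kk' [bk bk']]].
  have := @count_pts_pair w B _ _ kk' bk bk' => c2.
  by case=> /= cE; move: c2; rewrite cE lte_fin ?ltxx// ltr10.
rewrite probability_setC; last by apply: measurableU; exact: mc.
rewrite c01 -EFinB lee_fin -/lam.
have := expR_ge1Dx (- lam); nra.
Qed.

Lemma prm_clear (h : R) (A : nat) (D : pred 'I_A) (y : 'I_A -> R) :
  (0 < h)%R -> (forall a, 0 < y a)%R ->
  fine (Q (ev_clear t j h D y)) =
  expR (- \sum_(a | D a) h * y a `^ (- alpha))%R.
Proof.
move=> h0 y0.
(* Columns outside [D] get the empty set, whose mean 0 contributes a factor 1. *)
pose B (a : 'I_A) := if D a then box (a%:R * h) (a.+1%:R * h) (y a) else set0.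
have BE a : mean_measure mu (B a) = (if D a then h * y a `^ (- alpha) else 0)%R%:E.
  rewrite /B; case: ifP => _.
    rewrite box_mean//.
    - by rewrite -mulrBl -natr1 addrAC subrr add0r mul1r.
    - by rewrite mulr_ge0// ltW.
    - by rewrite ler_pM2r// ler_nat.
  rewrite (_ : set0 = (set0 : set R) `*` (set0 : set (\bar R))).
    by rewrite mean_measure_box// measure0 mul0e.
  by apply/seteqP; split => -[? ?] //= [].
have [_ [_ H]] := prm.
have := H A B (fun=> 0%N).
have -> : [set w | forall i, count_pts t j w (B i) = 0%:R%:E] = ev_clear t j h D y.
  apply/seteqP; split => w /= wB a.
    move=> Da k ka; rewrite leNgt; apply/negP => kj.
    by have /count_pts_eq0/(_ k) := wB a; apply; rewrite /B Da; split.
  apply/count_pts_eq0 => k; rewrite /B; case: ifPn => [Da [/= ka kj]|_ []].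
  by have := wB a Da k ka; rewrite leNgt kj.
move=> -> /=.
- rewrite [in RHS]big_mkcond -sumrN expR_sum; apply: eq_bigr => a _.
  rewrite /Defs.poisson_pmf BE /= expr0 mulr1 divr1.
  by case: ifP.
- by move=> a; rewrite /B; case: ifP.
- by move=> a; rewrite BE ltry.
- move=> a a' aa'; apply/seteqP; split => -[x z] //=.
  wlog lt : a a' aa' / (a < a')%N => [wl|].
    have := aa'; rewrite neq_ltn => /orP[lt|lt]; first exact: wl.
    by move=> [? ?]; apply: (wl a' a) => //; rewrite eq_sym.
  rewrite /B; case: ifP => // _; case: ifP => _ [] //.
  move=> [/= /andP[_ x1] _] [/= /andP[x2 _] _].
  have : (a.+1%:R * h <= a'%:R * h)%R by rewrite ler_pM2r// ler_nat.
  by rewrite leNgt (le_lt_trans x2 x1).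
Qed.

(** The bound [H] keeps the supremum finite, where [fine] is faithful; off the null event all marks
    are positive, so the supremum is nonnegative. *)
Lemma prm_tracks : exists N, [/\ measurable N, Q N = 0 &
  forall w (T e H : R), ~ N w -> (0 < e)%R -> (0 < H)%R ->
    (forall k, (t k w < T)%R -> j k w <= H%:E) ->
    tracks T e (t^~ w) (j^~ w) (sup_process t j w)].
Proof.
exists (\bigcup_k [set w | j k w <= 0]); split; last 1 first.
- move=> w T e H Nw e0 H0 jH s /andP[s0 sT].
  have jpos k : 0 < j k w by rewrite ltNge; apply/negP => jk; apply: Nw; exists k.
  rewrite /sup_process /Defs.sup0; set A := [set j k w | k in _].
  case: asboolP => [A0|/eqP/set0P[_ [k0 /= k0s _]]].
    split => /=; [by rewrite oppr_le0 ltW| |by left; rewrite ltW].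
    by move=> k ks; exfalso; have : A (j k w) by [exists k]; rewrite A0.
  have supH : ereal_sup A <= H%:E.
    by apply: ge_ereal_sup => _ [k /= ks <-]; apply: jH; exact: le_lt_trans sT.
  have sup0' : 0 <= ereal_sup A.
    by apply: (le_trans (ltW (jpos k0))); apply: ereal_sup_ubound; exists k0.
  have supfin : ereal_sup A \is a fin_num.
    by rewrite ge0_fin_numE// (le_lt_trans supH)// ltry.
  have zE : (fine (ereal_sup A))%:E = ereal_sup A by rewrite fineK.
  have z0 : (0 <= fine (ereal_sup A))%R by exact: fine_ge0.
  split; first by lra.
    move=> k ks; rewrite EFinD zE; apply: (@le_trans _ _ (ereal_sup A)).
      by apply: ereal_sup_ubound; exists k.
    by rewrite leeDl// lee_fin ltW.
  right; have [_ [k /= ks <-] lt] := ub_ereal_sup_adherent e0 supfin.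
  by exists k => //; rewrite EFinB zE ltW.
- apply: bigcup_measurable => k _.
  have mneg : measurable [set y : \bar R | y <= 0].
    rewrite (_ : [set _ | _] = ~` [set y : \bar R | 0 < y]); first exact: measurableC.
    by apply/seteqP; split => y /=; rewrite leNgt => /negP.
  by have := mj k measurableT mneg; rewrite setTI.
- exact: prm_nonpos.
Qed.

End poisson_side.

(** * Independence and the mean of a Galton-Watson process *)

Section nat_random_variables.
Context d (T : measurableType d).

Lemma nat_rv_cst n : nat_rv (fun _ : T => n).
Proof.
move=> A; have [An|An] := pselect (A n).
  by rewrite (_ : _ @^-1` _ = setT)//; apply/seteqP; split.
by rewrite (_ : _ @^-1` _ = set0)//; apply/seteqP; split.
Qed.

Lemma nat_rv_bind (N : T -> nat) (F : nat -> T -> nat) :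
  nat_rv N -> (forall n, nat_rv (F n)) -> nat_rv (fun w => F (N w) w).
Proof.
move=> rN rF A.
rewrite (_ : _ @^-1` A = \bigcup_n (N @^-1` [set n] `&` F n @^-1` A)).
  apply: bigcup_measurable => n _; apply: measurableI; [exact: rN|exact: rF].
apply/seteqP; split => w /=; first by move=> Aw; exists (N w).
by move=> [n _ [/= -> ]].
Qed.

Lemma nat_rv_comp (g : nat -> nat) (X : T -> nat) : nat_rv X -> nat_rv (g \o X).
Proof. by move=> rX A; exact: (rX (g @^-1` A)). Qed.

Lemma nat_rv_add (X Y : T -> nat) : nat_rv X -> nat_rv Y ->
  nat_rv (fun w => X w + Y w)%N.
Proof.
move=> rX rY; apply: (nat_rv_bind (F := fun n w => n + Y w)%N) => // n.
exact: (@nat_rv_comp (addn n) Y).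
Qed.

Lemma nat_rv_sum n (X : nat -> T -> nat) : (forall l, nat_rv (X l)) ->
  nat_rv (fun w => \sum_(l < n) X l w)%N.
Proof.
move=> rX; elim: n => [|n IH].
  by under eq_fun do rewrite big_ord0; exact: nat_rv_cst.
by under eq_fun do rewrite big_ord_recr /=; exact: nat_rv_add.
Qed.

Lemma nat_rv_GW (xi : nat -> nat -> T -> nat) m :
  (forall m' l, (m' < m)%N -> nat_rv (xi m' l)) ->
  nat_rv (fun w => GW (fun m l => xi m l w) m).
Proof.
elim: m => [_|m IH rxi]; first exact: nat_rv_cst.
rewrite /=; apply: (nat_rv_bind (F := fun n w => \sum_(l < n) xi m l w)%N).
  by apply: IH => m' l mm; apply: rxi; exact: ltnW.
by move=> n; apply: nat_rv_sum => l; exact: rxi.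
Qed.

Lemma nat_rv_measurable_fun (R : realType) (X : T -> nat) : nat_rv X ->
  measurable_fun setT (fun w => (X w)%:R : R).
Proof.
by move=> rX _ A mA; rewrite setTI; exact: (rX [set n | A n%:R]).
Qed.

End nat_random_variables.

Section independence.
Local Open Scope ereal_scope.
Variable R : realType.
Context d (T : measurableType d) (P : probability T R).
Variables (I : eqType) (F : I -> T -> nat).
Hypothesis rF : forall i, nat_rv (F i).
Hypothesis iF : mutually_independent P F.

(** These generate the sigma-algebra of all coordinates other than [i0]. *)
Definition cylinders_off (i0 : I) : set (set T) := [set E | exists s A,
  [/\ uniq s, i0 \notin s & E = [set w | forall i, i \in s -> A i (F i w)]]].

Lemma measurable_cylinder (s : seq I) (A : I -> set nat) :
  measurable [set w | forall i, i \in s -> A i (F i w)].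
Proof.
elim: s => [|i s IH].
  by rewrite (_ : [set _ | _] = setT)//; apply/seteqP; split.
rewrite (_ : [set _ | _] = F i @^-1` A i `&`
    [set w | forall i, i \in s -> A i (F i w)]).
  by apply: measurableI => //; exact: rF.
apply/seteqP; split => w /=.
  by move=> H; split => [|j js]; apply: H; rewrite in_cons ?eqxx// js orbT.
by move=> [Hi Hs] j; rewrite in_cons => /predU1P[->//|/Hs].
Qed.

(* Both sides are finite measures in E that agree on cylinders, a pi-system. *)
Lemma independent_off i0 (A : set nat) (E : set T) : <<s cylinders_off i0 >> E ->
  P (E `&` F i0 @^-1` A) = P E * P (F i0 @^-1` A).
Proof.
move=> sE.
have mD : measurable (F i0 @^-1` A) by exact: rF.
have p0 : (0 <= fine (P (F i0 @^-1` A)))%R by exact: fine_ge0.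
pose m1 : measure T R := mrestr P mD.
pose m2 : measure T R := mscale (NngNum p0) P.
suff : m1 E = m2 E.
  move=> m12; transitivity (m1 E) => //; rewrite m12 /m2 /= /mscale /=.
  by rewrite fineK ?fin_num_measure// muleC.
apply: (@g_sigma_algebra_measure_unique _ _ _ (cylinders_off i0) _ (fun=> setT)) => //.
- by move=> _ [s [B [_ _ ->]]]; exact: measurable_cylinder.
- move=> _; exists [::], (fun=> setT); split => //.
  by apply/seteqP; split.
- by apply/seteqP; split => // w _; exists 0%N.
- move=> _ _ [s1 [A1 [u1 n1 ->]]] [s2 [A2 [u2 n2 ->]]].
  exists (undup (s1 ++ s2)),
    (fun i => [set n | (i \in s1 -> A1 i n) /\ (i \in s2 -> A2 i n)]); split.
  + exact: undup_uniq.
  + by rewrite mem_undup mem_cat negb_or n1.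
  + apply/seteqP; split => w /=.
      by move=> [H1 H2] i _; split => ?; [exact: H1|exact: H2].
    by move=> H; split => i si; have := H i; rewrite mem_undup mem_cat si ?orbT;
      move=> /(_ isT)[]; auto.
- move=> _ [s [B [us ns ->]]]; rewrite /m1 /m2 /= /mrestr /mscale /=.
  rewrite fineK ?fin_num_measure//.
  pose B' i := if i == i0 then A else B i.
  have us' : uniq (i0 :: s) by rewrite /= ns.
  have H1 := iF B' us'; have H2 := iF B us.
  transitivity (P [set w | forall i, i \in i0 :: s -> B' i (F i w)]).
    congr (P _); apply/seteqP; split => w /=.
      move=> [H3 H4] i; rewrite in_cons /B'; case: eqVneq => [->//|_ /=]; exact: H3.
    move=> H; split.
      move=> i si; have := H i; rewrite in_cons si orbT /B'.
      case: eqVneq => [ii|_]; last by apply.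
      by rewrite -ii si in ns.
    by have := H i0; rewrite in_cons eqxx /B' eqxx; apply.
  rewrite H1 H2 big_cons {1}/B' eqxx; congr (_ * _); apply: eq_big_seq => i si; rewrite /B'.
  by case: eqVneq => // ii; rewrite -ii si in ns.
- by move=> k; rewrite /m1 /= /mrestr setTI ltey_eq fin_num_measure.
Qed.

(** Phrased as [nat_rv] over the generated sigma-algebra, so that the closure lemmas for [nat_rv]
    show which variables depend on the other coordinates only. *)
Lemma nat_rv_off i0 i : i != i0 ->
  @nat_rv _ (g_sigma_algebraType (cylinders_off i0)) (F i).
Proof.
move=> ii A; apply: sub_sigma_algebra; exists [:: i], (fun=> A); split => //.
  by rewrite inE eq_sym.
apply/seteqP; split => w /=; first by move=> Aw j; rewrite inE => /eqP ->.
by apply; rewrite inE.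
Qed.

End independence.

Section nat_expectations.
Local Open Scope ereal_scope.
Variable R : realType.

(** Turns a sum with a random number of terms into a series over a fixed index set, which commutes
    with the integral. *)
Lemma sum_nat_series (n : nat) (f : nat -> nat) :
  ((\sum_(l < n) f l)%N%:R : R)%:E =
  \sum_(0 <= l <oo) (if (l < n)%N then (f l)%:R else 0)%R%:E.
Proof.
rewrite (nneseries_split 0 n); last first.
  by move=> k _; rewrite lee_fin; case: ifP.
rewrite add0n [X in _ = _ + X]eseries0 ?adde0; last first.
  by move=> i ni _; rewrite ltnNge ni.
rewrite big_mkord natr_sum -sumEFin.
by apply: eq_bigr => i _; rewrite ltn_ord.
Qed.

Context d (T : measurableType d) (P : probability T R).

Lemma nat_rv_integral (X : T -> nat) (C : set T) : nat_rv X -> measurable C ->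
  \int[P]_w ((X w)%:R * \1_C w)%:E =
  \sum_(0 <= v <oo) P (C `&` X @^-1` [set n | (v < n)%N]).
Proof.
move=> rX mC.
have mv v : measurable (C `&` X @^-1` [set n | (v < n)%N]).
  by apply: measurableI => //; exact: rX.
transitivity (\int[P]_w \sum_(0 <= v <oo)
    (\1_(C `&` X @^-1` [set n | (v < n)%N]) w)%:E).
  apply: eq_integral => w _.
  rewrite indicE; have [wC|wC] := boolP (w \in C); last first.
    rewrite mulr0 eseries0// => v _ _; rewrite indicE memNset//.
    by case=> Cw; rewrite mem_set in wC.
  have := sum_nat_series (X w) (fun=> 1%N); rewrite sum1_card card_ord mulr1 => ->.
  apply: eq_eseriesr => v _; rewrite indicE.
  case: ifPn => vX; first by rewrite mem_set//; split => //; exact: set_mem.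
  by rewrite memNset//; move=> [_ /=]; apply/negP.
rewrite integral_nneseries//; last first.
  by move=> v; apply/measurable_EFinP; exact: measurable_indic.
by apply: eq_eseriesr => v _; rewrite integral_indic// setIT.
Qed.

Lemma nat_rv_expectation (X : T -> nat) : nat_rv X ->
  \int[P]_w ((X w)%:R : R)%:E = \sum_(0 <= v <oo) P (X @^-1` [set n | (v < n)%N]).
Proof.
move=> rX; have := nat_rv_integral rX measurableT.
under eq_integral do rewrite indicT mulr1.
by move=> ->; apply: eq_eseriesr => v _; rewrite setTI.
Qed.

End nat_expectations.

Section GW_mean.
Local Open Scope ereal_scope.
Variable R : realType.
Context d (T : measurableType d) (P : probability T R).
Variables (I : eqType) (F : I -> T -> nat).
Hypothesis rF : forall i, nat_rv (F i).
Hypothesis iF : mutually_independent P F.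
Variables (ix : nat -> nat -> I) (mu : R).
Hypothesis ix_inj : forall m l m' l', ix m l = ix m' l' -> m = m' /\ l = l'.
Hypothesis meanF : forall m l, \int[P]_w ((F (ix m l) w)%:R : R)%:E = mu%:E.

Let X m w := GW (fun m l => F (ix m l) w) m.

Let rX m : nat_rv (X m). Proof. by apply: nat_rv_GW => *; exact: rF. Qed.

(** Wald's argument: the [l]-th individual exists on the event [l < X m], which depends on earlier
    generations only and is independent of its offspring number. *)
Lemma integral_GW m : \int[P]_w ((X m w)%:R : R)%:E = (mu ^+ m)%:E.
Proof.
elim: m => [|m IH].
  rewrite expr0; transitivity (\int[P]_w (cst 1 w)); first exact: eq_integral.
  by rewrite integral_cst//= (@probability_setT _ _ _ P) mul1e.
pose C l := X m @^-1` [set n | (l < n)%N].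
have mC l : measurable (C l) by exact: rX.
transitivity (\int[P]_w \sum_(0 <= l <oo) ((F (ix m l) w)%:R * \1_(C l) w)%:E).
  apply: eq_integral => w _.
  rewrite -[X m.+1 w]/(\sum_(l < X m w) F (ix m l) w)%N.
  rewrite (@sum_nat_series R (X m w) (fun l => F (ix m l) w)).
  apply: eq_eseriesr => l _; rewrite indicE; case: ifPn => lX.
    by rewrite mem_set ?mulr1.
  by rewrite memNset ?mulr0//; exact/negP.
rewrite integral_nneseries//; last first.
  move=> l; apply/measurable_EFinP; apply: measurable_funM.
    exact: nat_rv_measurable_fun.
  exact: measurable_indic.
have step l : \int[P]_w ((F (ix m l) w)%:R * \1_(C l) w)%:E = mu%:E * P (C l).
  rewrite nat_rv_integral// -(meanF m l) nat_rv_expectation//.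
  have PC : (fine (P (C l)))%:E = P (C l) by rewrite fineK// fin_num_measure.
  rewrite muleC -PC -nneseriesZl//.
  apply: eq_eseriesr => v _; rewrite PC; apply: (independent_off rF iF).
  pose G := cylinders_off F (ix m l).
  have : @nat_rv _ (g_sigma_algebraType G) (fun w => X m w).
    apply: (@nat_rv_GW _ (g_sigma_algebraType G) (fun m l => F (ix m l))).
    move=> m' l' mm; apply: nat_rv_off => //; apply/eqP => /ix_inj[mE _].
    by rewrite mE ltnn in mm.
  by move=> /(_ [set n | (l < n)%N]).
under eq_eseriesr do rewrite step.
rewrite nneseriesZl//.
by rewrite -nat_rv_expectation// IH exprS EFinM.
Qed.

End GW_mean.

(** * Bounds on the population *)

Section GW_paths.

Lemma GW_gt0 (xi : nat -> nat -> nat) m :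
  (forall m', (m' < m)%N -> (0 < xi m' 0)%N) -> (0 < GW xi m)%N.
Proof.
elim: m => // m IH xi0 /=.
have GWm : (0 < GW xi m)%N by apply: IH => m' mm; apply: xi0; exact: ltnW.
rewrite (bigD1 (Ordinal GWm))//=; apply: (leq_trans (xi0 m _)) => //.
exact: leq_addr.
Qed.

(** Blocks are open on the left because immigrants are numbered from 1. *)
Lemma block_sum_ge (x : nat -> nat) r n :
  (forall c, (c < n)%N -> exists2 i, (c * r < i <= c.+1 * r)%N & (0 < x i)%N) ->
  (n <= \sum_(1 <= i < (n * r).+1) x i)%N.
Proof.
elim: n => // n IH xP.
rewrite (@big_cat_nat _ _ _ (n * r).+1)//=; last by rewrite ltnS leq_mul2r leqnSn orbT.
rewrite -[leqLHS]addn1; apply: leq_add.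
  by apply: IH => c cn; apply: xP; exact: ltnW.
have [i /andP[i1 i2] xi0] := xP n (ltnSn n).
rewrite (bigD1_seq i)/= ?iota_uniq//; first exact: (leq_trans xi0 (leq_addr _ _)).
by rewrite mem_index_iota i1.
Qed.

Variables (Omega : Type) (xi : nat -> nat -> nat -> nat -> Omega -> nat).
Variables (J : nat -> Omega -> nat) (w : Omega).
Let X i k m := GW (fun m l => xi i k m l w) m.

(** Each full block of immigrants at time [k] has a living descendant; the incomplete block and the
    other immigration times are dropped. *)
Lemma GWI_ge_blocks (K r n k : nat) : (0 < r)%N -> (k <= n)%N -> (n - k <= K)%N ->
  (forall c, (c < J k w %/ r)%N -> exists2 i, (c * r < i <= c.+1 * r)%N &
     forall m, (m < K)%N -> (0 < xi i k m 0 w)%N) ->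
  (J k w %/ r <= GWI xi J n w)%N.
Proof.
move=> r0 kn nK surv.
apply: (@leq_trans (\sum_(1 <= i < (J k w).+1) X i k (n - k))%N).
  apply: leq_trans (_ : _ <= \sum_(1 <= i < ((J k w %/ r) * r).+1) X i k (n - k))%N _.
    apply: block_sum_ge => c cJ; have [i ic s] := surv c cJ; exists i => //.
    by apply: GW_gt0 => m mn; apply: s; exact: leq_trans nK.
  rewrite [leqRHS](@big_cat_nat _ _ _ (J k w %/ r * r).+1)//= ?leq_addr//.
  by rewrite ltnS leq_trunc_div.
by rewrite /GWI [leqRHS](bigD1_seq k) ?mem_index_iota ?iota_uniq//= leq_addr.
Qed.

End GW_paths.

Section population_bounds.
Variable R : realType.

(** Induction with [ln (1 - 1 / (N + 2)) <= - 1 / (N + 2)]; the case [N = 0] relies on the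
    convention that [ln 0] is 0. *)
Lemma harmonic_le (N : nat) : \sum_(1 <= i < N.+1) (i%:R : R)^-1 <= 1 + ln N%:R.
Proof.
case: N => [|N]; first by rewrite big_geq// ln0// addr0 ler01.
elim: N => [|N IH]; first by rewrite big_nat1 invr1 ln1 addr0.
rewrite big_nat_recr//=.
have N0 : (0 : R) < N.+1%:R by rewrite ltr0n.
have N20 : (0 : R) < N.+2%:R by rewrite ltr0n.
have : ln (1 + - (N.+2%:R)^-1 : R) <= - (N.+2%:R)^-1.
  by apply: le_ln1Dx; rewrite ltrN2 invf_lt1// ltr1n.
have -> : (1 - (N.+2%:R)^-1 : R) = N.+1%:R / N.+2%:R.
  by rewrite -[N.+1%:R in RHS](addrK 1) natr1 mulrBl divff ?mul1r// lt0r_neq0.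
rewrite lnM ?posrE ?invr_gt0// lnV ?posrE// => lnN.
by rewrite -lerBrDr (le_trans IH)// -addrA lerD2l -lerBlDl.
Qed.

Context d (Omega : measurableType d) (P : probability Omega R).
Variables (xi : nat -> nat -> nat -> nat -> Omega -> nat) (J : nat -> Omega -> nat).
Hypothesis rF : forall ix, nat_rv (GWI_family xi J ix).
Hypothesis iF : mutually_independent P (GWI_family xi J).
Hypothesis xi_id : forall i k m n i' k' m' n' (A : set nat),
  P (xi i k m n @^-1` A) = P (xi i' k' m' n' @^-1` A).
Variable mu : R.
Hypothesis mu0 : 0 < mu.
Hypothesis mean_xi : (\int[P]_w ((xi 1%N 0%N 0%N 0%N w)%:R : R)%:E)%E = mu%:E.

Let rxi i k m l : nat_rv (xi i k m l). Proof. exact: (rF (inl (i, k, m, l))). Qed.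

Lemma mean_offspring i k m l : (\int[P]_w ((xi i k m l w)%:R : R)%:E)%E = mu%:E.
Proof.
rewrite -mean_xi !nat_rv_expectation//; apply: eq_eseriesr => v _; exact: xi_id.
Qed.

Let X i k m w := GW (fun m l => xi i k m l w) m.

Let rX i k m : nat_rv (X i k m). Proof. by apply: nat_rv_GW => *; exact: rxi. Qed.

Lemma mean_GW i k m : (\int[P]_w ((X i k m w)%:R : R)%:E)%E = (mu ^+ m)%:E.
Proof.
apply: (@integral_GW R _ _ P _ _ rF iF (fun m l => inl (i, k, m, l))).
  by move=> ? ? ? ? [-> ->].
by move=> m' l; exact: mean_offspring.
Qed.

(* Dividing by i the descendants of the i-th immigrant turns a bound on this sum
   into a bound on the total progeny that is linear in the number of immigrants. *)
Definition weighted_progeny (K N : nat) (w : Omega) : R :=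
  \sum_(0 <= k < K) \sum_(1 <= i < N.+1) \sum_(0 <= m < K)
    (i%:R)^-1 * (X i k m w)%:R.

Lemma measurable_weighted_progeny K N : measurable_fun setT (weighted_progeny K N).
Proof.
apply: measurable_sum => k; apply: measurable_sum => i; apply: measurable_sum => m.
by apply: measurable_funM => //; exact: nat_rv_measurable_fun.
Qed.

Lemma mean_weighted_progeny K N :
  (\int[P]_w (weighted_progeny K N w)%:E <=
   (K%:R * ((1 + ln N%:R) * (K%:R * Num.max 1 mu ^+ K)))%:E)%E.
Proof.
have mterm i k m : measurable_fun setT (fun w => ((i%:R)^-1 * (X i k m w)%:R : R)).
  by apply: measurable_funM => //; exact: nat_rv_measurable_fun.
have term i k m : (\int[P]_w ((i%:R)^-1 * (X i k m w)%:R)%:E =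
    ((i%:R)^-1 * mu ^+ m)%:E)%E.
  under eq_integral do rewrite EFinM.
  rewrite ge0_integralZl_EFin ?invr_ge0//; first by rewrite mean_GW EFinM.
  by apply/measurable_EFinP; exact: nat_rv_measurable_fun.
have t0 i k m w : 0 <= (i%:R)^-1 * (X i k m w)%:R :> R.
  by rewrite mulr_ge0// invr_ge0.
have -> : (\int[P]_w (weighted_progeny K N w)%:E)%E =
  (\sum_(0 <= k < K) \sum_(1 <= i < N.+1) \sum_(0 <= m < K) (i%:R)^-1 * mu ^+ m)%:E.
  rewrite /weighted_progeny; under eq_integral do rewrite -sumEFin.
  rewrite ge0_integral_sum; [|exact: measurableT| |]; last 2 first.
  - move=> k; apply/measurable_EFinP; apply: measurable_sum => i.
    exact: measurable_sum.
  - by move=> k w _; rewrite lee_fin sumr_ge0// => i _; exact: sumr_ge0.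
  rewrite -sumEFin; apply: eq_bigr => k _.
  under eq_integral do rewrite -sumEFin.
  rewrite ge0_integral_sum; [|exact: measurableT| |]; last 2 first.
  - by move=> i; apply/measurable_EFinP; exact: measurable_sum.
  - by move=> i w _; rewrite lee_fin sumr_ge0.
  rewrite -sumEFin; apply: eq_bigr => i _.
  under eq_integral do rewrite -sumEFin.
  rewrite ge0_integral_sum; [|exact: measurableT| |]; last 2 first.
  - by move=> m; apply/measurable_EFinP.
  - by move=> m w _; rewrite lee_fin.
  by rewrite -sumEFin; apply: eq_bigr => m _.
rewrite lee_fin.
have geo : \sum_(0 <= m < K) mu ^+ m <= K%:R * Num.max 1 mu ^+ K.
  apply: (@le_trans _ _ (\sum_(0 <= m < K) Num.max 1 mu ^+ K)); last first.
    by rewrite big_const_nat subn0 iter_addr_0 mulr_natl.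
  rewrite [leLHS]big_nat [leRHS]big_nat; apply: ler_sum => m /andP[_ mK].
  apply: (@le_trans _ _ (Num.max 1 mu ^+ m)).
    by apply: lerXn2r; rewrite ?nnegrE ?le_max ?lexx ?orbT ?ltW ?ler01.
  by apply: ler_weXn2l; [rewrite le_max lexx|exact: ltnW].
rewrite [leLHS]big_const_nat subn0 iter_addr_0 -[leLHS]mulr_natl ler_wpM2l//.
under eq_bigr do rewrite -mulr_sumr.
rewrite -mulr_suml; apply: ler_pM => //.
- by apply: sumr_ge0 => i _; rewrite invr_ge0.
- by apply: sumr_ge0 => m _; rewrite exprn_ge0// ltW.
- exact: harmonic_le.
Qed.

Lemma weighted_progeny_markov K N (c : R) : 0 < c ->
  (P [set w | (c <= weighted_progeny K N w)%R] <=
   (K%:R * ((1 + ln N%:R) * (K%:R * Num.max 1 mu ^+ K)) / c)%:E)%E.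
Proof.
move=> c0; set E := [set w | _].
have mE : measurable E.
  have := measurable_weighted_progeny K N measurableT (measurable_itv `[c, +oo[).
  rewrite setTI; congr measurable; apply/seteqP; split => w /=;
  by rewrite in_itv /= andbT.
have int : (\int[P]_w (c%:E * (\1_E w)%:E) = c%:E * P E)%E.
  rewrite ge0_integralZl_EFin ?(ltW c0)// ?integral_indic ?setIT//.
  by apply/measurable_EFinP; exact: measurable_indic.
have : (c%:E * P E <= \int[P]_w (weighted_progeny K N w)%:E)%E.
  rewrite -int; apply: integral_mono_any => w; rewrite -EFinM lee_fin indicE.
  have [wE|wE] := boolP (w \in E); first by rewrite mulr1; exact: set_mem wE.
  rewrite mulr0 sumr_ge0// => k _; apply: sumr_ge0 => i _; apply: sumr_ge0 => m _.
  by rewrite mulr_ge0// invr_ge0.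
move=> /le_trans/(_ (mean_weighted_progeny K N)).
have PE : (fine (P E))%:E = P E by rewrite fineK// fin_num_measure.
rewrite -PE -EFinM !lee_fin => H.
by rewrite ler_pdivlMr// mulrC.
Qed.

(** An immigrant that is present has index [i] at most the maximum of the [J k], so this maximum
    times [1 / i] is at least 1. The bound is pathwise and separates the offspring from the
    [J k]. *)
Lemma GWI_le_weighted K N n w : (n < K)%N -> (forall k, (k <= n)%N -> (J k w <= N)%N) ->
  (GWI xi J n w)%:R <= (\max_(k < n.+1) J k w)%:R * weighted_progeny K N w :> R.
Proof.
move=> nK JN; rewrite /GWI /weighted_progeny natr_sum.
have t0 i k m : 0 <= (i%:R)^-1 * (X i k m w)%:R :> R.
  by rewrite mulr_ge0// invr_ge0.
rewrite [X in _ * X](@big_cat_nat _ _ _ n.+1)//= mulrDr.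
rewrite ler_wpDr//.
  rewrite mulr_ge0// sumr_ge0// => k _; apply: sumr_ge0 => i _; exact: sumr_ge0.
rewrite mulr_sumr [leLHS]big_nat [leRHS]big_nat; apply: ler_sum => k /andP[_ kn].
rewrite ltnS in kn.
have Jk : (J k w <= \max_(k < n.+1) J k w)%N.
  exact: (@leq_bigmax _ (fun k : 'I_n.+1 => J k w) (Ordinal (kn : (k < n.+1)%N))).
rewrite natr_sum [X in _ * X](@big_cat_nat _ _ _ (J k w).+1)//=; last by rewrite ltnS JN.
rewrite mulrDr ler_wpDr//.
  by rewrite mulr_ge0// sumr_ge0// => i _; exact: sumr_ge0.
rewrite mulr_sumr [leLHS]big_nat [leRHS]big_nat; apply: ler_sum => i /andP[i0 iJ].
rewrite ltnS in iJ.
have nkK : (n - k < K)%N by exact: leq_ltn_trans (leq_subr _ _) nK.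
rewrite (bigD1_seq (n - k)%N)/= ?iota_uniq ?mem_index_iota// mulrDr.
rewrite ler_wpDr//; first by rewrite mulr_ge0// sumr_ge0.
rewrite mulrA ler_peMl// ler_pdivlMr ?ltr0n// mul1r ler_nat.
exact: leq_trans Jk.
Qed.

Let p : R := fine (P (xi 0 0 0 0 @^-1` [set n | (0 < n)%N])).

Lemma offspring_prob i k m l :
  P (xi i k m l @^-1` [set n | (0 < n)%N]) = p%:E.
Proof.
rewrite (xi_id _ _ _ _ 0 0 0 0) /p fineK// fin_num_measure//; exact: rxi.
Qed.

Lemma offspring_prob_gt0 : 0 < p.
Proof.
have p0 : 0 <= p by exact: fine_ge0.
rewrite lt_neqAle p0 andbT eq_sym; apply/eqP => pE.
have : (\int[P]_w ((xi 0%N 0%N 0%N 0%N w)%:R : R)%:E = 0)%E.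
  rewrite nat_rv_expectation//; apply: eseries0 => v _ _.
  apply/eqP; rewrite eq_le measure_ge0 andbT.
  apply: (@le_trans _ _ (P (xi 0 0 0 0 @^-1` [set n | (0 < n)%N]))).
    apply: le_measure; rewrite ?inE; [exact: rxi|exact: rxi|].
    by move=> w /=; exact: leq_ltn_trans.
  by rewrite offspring_prob pE.
by rewrite mean_offspring => -[muE]; have := mu0; rewrite muE ltxx.
Qed.

Lemma offspring_prob_le1 : p <= 1.
Proof.
rewrite -lee_fin -(offspring_prob 0 0 0 0); apply: probability_le1; exact: rxi.
Qed.

(** Sufficient for being alive up to generation [K]. Following only the first individual of each
    generation makes it an intersection of [K] independent events. *)
Definition survives K k i : set Omega :=
  [set w | forall m, (m < K)%N -> (0 < xi i k m 0 w)%N].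

Lemma measurable_survives K k i : measurable (survives K k i).
Proof.
rewrite (_ : survives _ _ _ = \bigcap_(m in [set m | (m < K)%N])
  (xi i k m 0 @^-1` [set n | (0 < n)%N])).
  by apply: bigcap_measurableType => m _; exact: rxi.
by apply/seteqP; split.
Qed.

Let pattern K k (fs ss : seq nat) : set Omega :=
  [set w | (forall i, i \in fs -> ~ survives K k i w) /\
           (forall i, i \in ss -> survives K k i w)].

Let measurable_pattern K k fs ss : measurable (pattern K k fs ss).
Proof.
rewrite (_ : pattern _ _ _ _ = \bigcap_(i in [set i | i \in fs]) ~` survives K k i `&`
  \bigcap_(i in [set i | i \in ss]) survives K k i); last by apply/seteqP; split.
apply: measurableI; apply: bigcap_measurableType => i _; last exact: measurable_survives.
exact/measurableC/measurable_survives.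
Qed.

(** Independence treats a list of survivals directly. A failing index is removed by taking a
    difference of probabilities, which moves it to the surviving list; this is why a pattern carries
    both lists. *)
Lemma pattern_prob K k fs ss : uniq (fs ++ ss) ->
  P (pattern K k fs ss) = ((1 - p ^+ K) ^+ size fs * (p ^+ K) ^+ size ss)%:E.
Proof.
elim: fs ss => [|i fs IH] ss us.
  pose s := [seq (inl (i, k, m, 0%N) : (nat * nat * nat * nat) + nat) |
    i <- ss, m <- iota 0 K].
  have us' : uniq s.
    by apply: allpairs_uniq => //; [exact: iota_uniq|move=> [? ?] [? ?] _ _ /= [-> ->]].
  have := iF (fun=> [set n | (0 < n)%N]) us'.
  rewrite (_ : [set w | _] = pattern K k [::] ss).
    move=> ->; rewrite /s big_allpairs_dep expr0 mul1r.
    have -> : (p ^+ K) ^+ size ss = \prod_(i <- ss) \prod_(m <- iota 0 K) p.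
      by rewrite big_const_seq count_predT iter_mulr_1 big_const_seq count_predT
        size_iota iter_mulr_1.
    rewrite -prodEFin; apply: eq_bigr => i _; rewrite -prodEFin.
    by apply: eq_bigr => m _; exact: offspring_prob.
  apply/seteqP; split => w /=.
    move=> H; split => // i si m mK; have := H (inl (i, k, m, 0%N)); apply.
    by apply/allpairsPdep; exists i, m; rewrite si mem_iota.
  move=> [_ H] x /allpairsPdep[i [m [si]]]; rewrite mem_iota /= add0n => mK ->.
  exact: H.
have := us; rewrite /= mem_cat negb_or => /andP[/andP[ifs iss] us1].
have us2 : uniq (fs ++ i :: ss) by rewrite -[i :: ss]cat1s uniq_catCA.
have -> : pattern K k (i :: fs) ss = pattern K k fs ss `\` survives K k i.
  apply/seteqP; split => w /=.
    move=> [H1 H2]; split; last by apply: H1; rewrite inE eqxx.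
    by split => // i' i'fs; apply: H1; rewrite inE i'fs orbT.
  by move=> [[H1 H2] H3]; split => // i'; rewrite inE => /predU1P[->//|]; exact: H1.
transitivity (P (pattern K k fs ss) - P (pattern K k fs ss `&` survives K k i))%E.
  apply: measureD; [exact: measurable_pattern|exact: measurable_survives|].
  by rewrite ltey_eq fin_num_measure.
have -> : pattern K k fs ss `&` survives K k i = pattern K k fs (i :: ss).
  apply/seteqP; split => w /=.
    by move=> [[H1 H2] H3]; split => // i'; rewrite inE => /predU1P[->//|]; exact: H2.
  move=> [H1 H2]; split; last by apply: H2; rewrite inE eqxx.
  by split => // i' i'fs; apply: H2; rewrite inE i'fs orbT.
rewrite !IH// -EFinB; congr (_%:E); rewrite /= !exprS; ring.
Qed.

Definition block_dies K r k c : set Omega :=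
  [set w | forall i, (c * r < i <= c.+1 * r)%N -> ~ survives K k i w].

Lemma block_diesE K r k c : block_dies K r k c = pattern K k (iota (c * r).+1 r) [::].
Proof.
have iE i : (i \in iota (c * r).+1 r) = (c * r < i <= c.+1 * r)%N.
  by rewrite mem_iota addSn ltnS mulSn [(r + _)%N]addnC.
by apply/seteqP; split => w /=; [move=> H; split => // i; rewrite iE; exact: H|
  move=> [H _] i; rewrite -iE; exact: H].
Qed.

Lemma measurable_block_dies K r k c : measurable (block_dies K r k c).
Proof. by rewrite block_diesE; exact: measurable_pattern. Qed.

Lemma block_dies_prob K r k c :
  (P (block_dies K r k c) <= (expR (- (p ^+ K * r%:R)))%:E)%E.
Proof.
rewrite block_diesE pattern_prob; last by rewrite cats0 iota_uniq.
rewrite size_iota expr0 mulr1 lee_fin -mulNr expRM_natr.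
apply: lerXn2r; rewrite ?nnegrE ?expR_ge0//.
  by rewrite subr_ge0 exprn_ile1// ?offspring_prob_le1// ltW// offspring_prob_gt0.
exact: expR_ge1Dx.
Qed.

End population_bounds.

(** * The process follows the running maximum *)

(** A quadratic bound is enough to beat the competing terms below, which are linear in [b n]. *)
Lemma expR_ge_quadratic (R : realType) (x : R) : 0 <= x -> x ^+ 2 / 4 <= expR x.
Proof.
move=> x0; have -> : expR x = expR (x / 2) ^+ 2.
  by rewrite -expRM_natr; congr expR; field.
have := expR_ge1Dx (x / 2); nra.
Qed.

Lemma natr_le_expR (R : realType) (n : nat) : n%:R <= expR n%:R :> R.
Proof. by have := expR_ge1Dx (n%:R : R); lra. Qed.

Lemma ln_natr_ge0 (R : realType) (n : nat) : 0 <= ln (n%:R : R).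
Proof. by have [->|n0] := posnP n; [rewrite ln0|rewrite ln_ge0// ler1n]. Qed.

Section prelimit_tracks.
Variable R : realType.
Context d (Omega : measurableType d) (P : probability Omega R).
Variables (xi : nat -> nat -> nat -> nat -> Omega -> nat) (J : nat -> Omega -> nat).

(** The deterministic half. Below, dividing [J k] by [r] costs a factor [2 * r], absorbed by
    [ln (2 * r) <= e * b]; above, the weighted progeny costs a factor [exp (del * b)]. The bound [N]
    leaves finitely many blocks to control. *)
Lemma tracks_of_population_bounds (T e H del b : R) (n r K N : nat) (w : Omega) :
  (0 < n)%N -> 0 < b -> 0 < e -> del <= e -> (0 < r)%N -> ln (2 * r%:R) <= e * b ->
  n%:R * T < K%:R -> (forall x : nat, ln (x%:R : R) <= H * b -> (x <= N)%N) ->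
  (forall k, (k < K)%N -> ln ((J k w)%:R : R) <= H * b) ->
  weighted_progeny R xi K N w < expR (del * b) ->
  (forall k c, (k < K)%N -> (c < N)%N -> ~ block_dies xi K r k c w) ->
  tracks T e (fun k => k%:R / n%:R) (fun k => (ln (J k w)%:R / b)%:E)
    (fun t => logp (GWI xi J (Num.truncn (n%:R * t)) w)%:R / b).
Proof.
move=> n0 b0 e0 dele r0 re TK NP JH Vlt alive s /andP[s0 sT].
have n0R : (0 : R) < n%:R by rewrite ltr0n.
have ns0 : 0 <= n%:R * s by rewrite mulr_ge0// ltW.
set m := Num.truncn (n%:R * s); set Y := GWI xi J m w.
have mK : (m < K)%N.
  rewrite /m truncn_lt_nat//; apply: lt_trans TK; by rewrite ltr_pM2l.
have JN k : (k <= m)%N -> (J k w <= N)%N.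
  by move=> km; apply: NP; apply: JH; exact: leq_ltn_trans mK.
have logp0 : 0 <= logp (Y%:R : R) by rewrite /logp le_max lexx orbT.
split.
- by apply: (@le_trans _ _ 0); [rewrite oppr_le0 ltW|rewrite divr_ge0// ltW].
- move=> k; rewrite ler_pdivrMr// => ks.
  have km : (k <= m)%N by rewrite /m truncn_ge_nat// mulrC.
  rewrite lee_fin ler_pdivrMr// mulrDl divfK ?lt0r_neq0//.
  have : (J k w %/ r <= Y)%N.
    apply: (@GWI_ge_blocks _ _ _ _ K) => //.
      by rewrite (leq_trans (leq_subr _ _))// ltnW.
    move=> c cJ; apply: contrapT => nc.
    apply: (alive k c) => //; first exact: leq_ltn_trans mK.
      apply: (leq_trans cJ); apply: (leq_trans (leq_div _ _)); exact: JN.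
    by move=> i ic si; apply: nc; exists i.
  have r0R : (0 : R) < r%:R by rewrite ltr0n.
  (* Without a full block nothing is known about descendants, but the logarithm of [J k] is then
     below the tolerance. *)
  have [Jr|Jr] := ltnP (J k w) r.
    move=> _; apply: (@le_trans _ _ (ln (2 * r%:R))); last by rewrite ler_wpDl.
    have [->|J0] := posnP (J k w).
      by rewrite ln0//; apply: ln_ge0; rewrite -natrM ler1n muln_gt0.
    rewrite ler_ln ?posrE ?ltr0n ?mulr_gt0//.
    by rewrite -natrM ler_nat (leq_trans (ltnW Jr))// leq_pmull.
  move=> JY; have J0 : (0 < J k w)%N by exact: leq_trans Jr.
  have Y0 : (0 < Y)%N by apply: leq_trans JY; rewrite divn_gt0.
  (* Quotient times [r] and remainder are each at most [r * Y], the latter because [Y] is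
     positive. *)
  have JrY : (J k w <= 2 * r * Y)%N.
    have := divn_eq (J k w) r; have := ltn_pmod (J k w) r0.
    move: (J k w %% r)%N (J k w %/ r)%N JY => x y JY xr JE.
    have : (y * r <= Y * r)%N by rewrite leq_mul2r JY orbT.
    have rY : (r <= Y * r)%N by rewrite leq_pmull.
    rewrite JE => yr; apply: (leq_trans (leq_add yr (ltnW xr))).
    by rewrite -mulnA [(r * Y)%N]mulnC mul2n -addnn leq_add2l.
  have : ln ((J k w)%:R : R) <= ln (2 * r%:R * Y%:R).
    by rewrite ler_ln ?posrE ?mulr_gt0 ?ltr0n// -!natrM ler_nat.
  rewrite lnM ?posrE ?mulr_gt0 ?ltr0n// => /le_trans; apply.
  rewrite addrC lerD//.
  by rewrite /logp le_max lexx.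
- have [Y0|Y0] := posnP Y.
    by left; rewrite Y0 /logp ln0// maxxx mul0r ltW.
  right; have c0 : (0 < #|'I_m.+1|)%N by rewrite card_ord.
  have [k kE] := @bigop.eq_bigmax _ (fun k : 'I_m.+1 => J k w) c0.
  exists (k : nat).
    have km : (k <= m)%N by rewrite -ltnS.
    by rewrite ler_pdivrMr// mulrC -truncn_ge_nat.
  have := @GWI_le_weighted R _ _ xi J K N m w mK JN; rewrite kE -/Y => YV.
  have J0 : (0 < J k w)%N.
    rewrite lt0n; apply/eqP => JE; move: YV; rewrite JE mul0r.
    by rewrite leNgt ltr0n Y0.
  rewrite lee_fin lerBlDr -lerBlDr ler_pdivlMr// mulrBl divfK ?lt0r_neq0//.
  rewrite lerBlDr.
  have -> : logp (Y%:R : R) = ln Y%:R.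
    by rewrite /logp max_l// ln_ge0// ler1n.
  apply: (@le_trans _ _ (ln ((J k w)%:R * expR (del * b)))).
    rewrite ler_ln ?posrE ?mulr_gt0 ?ltr0n ?expR_gt0//.
    by apply: (le_trans YV); rewrite ler_wpM2l// ltW.
  by rewrite lnM ?posrE ?ltr0n ?expR_gt0// expRK lerD2l ler_pM2r.
Qed.

Hypothesis rF : forall ix, nat_rv (GWI_family xi J ix).
Hypothesis iF : mutually_independent P (GWI_family xi J).
Hypothesis xi_id : forall i k m n i' k' m' n' (A : set nat),
  P (xi i k m n @^-1` A) = P (xi i' k' m' n' @^-1` A).
Hypothesis J_id : forall k k' (A : set nat), P (J k @^-1` A) = P (J k' @^-1` A).
Variables (mu alpha : R) (b : nat -> R).
Hypothesis mu0 : 0 < mu.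
Hypothesis mean_xi : (\int[P]_w ((xi 1%N 0%N 0%N 0%N w)%:R : R)%:E)%E = mu%:E.
Hypothesis alpha0 : 0 < alpha.

Definition log_tail (x : R) : R := fine (P [set w | x < ln (J 0%N w)%:R]).

Hypothesis b_gt0 : forall n, (0 < n)%N -> 0 < b n.
Hypothesis b_oo : b n @[n --> \oo] --> +oo.
Hypothesis b_lin : n%:R / b n @[n --> \oo] --> (0 : R).
Hypothesis tail_b : forall y : R, 0 < y ->
  n%:R * log_tail (y * b n) @[n --> \oo] --> y `^ (- alpha).

Let rJ k : nat_rv (J k). Proof. exact: (rF (inr k)). Qed.

Lemma measurable_log_gt k x : measurable [set w | x < ln ((J k w)%:R : R)].
Proof. exact: (rJ k [set n | x < ln n%:R]). Qed.

Lemma log_tailE k x : P [set w | x < ln ((J k w)%:R : R)] = (log_tail x)%:E.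
Proof.
rewrite (J_id k 0%N [set n | x < ln n%:R]) /log_tail fineK//.
apply: fin_num_measure; exact: measurable_log_gt.
Qed.

Lemma near_b_ge C : \forall n \near \oo, C <= b n.
Proof. by move/cvgryPge : b_oo; apply. Qed.

(** The number of generations is negligible against [b n], so anything geometric in it is
    [exp (o(b n))]. *)
Lemma near_horizon_le (T eta : R) : 0 < T -> 0 < eta ->
  \forall n \near \oo, (Num.truncn (n%:R * T)).+1%:R <= eta * b n.
Proof.
move=> T0 eta0; near=> n.
have n0 : (0 < n)%N by near: n; exact: nbhs_infty_gt.
have bn := b_gt0 n0.
have nT0 : 0 <= n%:R * T by rewrite mulr_ge0// ltW.
have tr : (Num.truncn (n%:R * T))%:R <= n%:R * T by rewrite truncn_le.
have nb : n%:R <= eta / 2 / T * b n.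
  rewrite -ler_pdivrMr//.
  have : `|0 - n%:R / b n| <= eta / 2 / T.
    by near: n; move/cvgrPdist_le : b_lin; apply; rewrite !divr_gt0.
  by rewrite sub0r normrN ger0_norm// divr_ge0// ltW.
have b1 : 1 <= eta / 2 * b n.
  rewrite -ler_pdivrMl ?divr_gt0// mulr1; near: n; exact: near_b_ge.
have : n%:R * T <= eta / 2 * b n.
  by move: nb; rewrite mulrAC -ler_pdivlMr ?invr_gt0// invrK.
by move=> nTb; rewrite -[leLHS]natr1; lra.
Unshelve. all: by end_near. Qed.

(** Three bad events get [q / 3] each: too many immigrants at some time, a large weighted progeny, a
    block without surviving line. *)
Lemma prelimit_tracks (T e q : R) : 0 < T -> 0 < e -> 0 < q ->
  exists bad : nat -> set Omega, [/\ forall n, measurable (bad n),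
    \forall n \near \oo, (P (bad n) <= q%:E)%E &
    \forall n \near \oo, forall w, ~ bad n w ->
      tracks T e (fun k => k%:R / n%:R) (fun k => (ln (J k w)%:R / b n)%:E)
        (fun t => logp (GWI xi J (Num.truncn (n%:R * t)) w)%:R / b n)].
Proof.
move=> T0 e0 q0.
(* Solves [4 * T * H^(- alpha) = q / 3], where the left side bounds the first bad event. *)
pose H := (12 * T / q) `^ alpha^-1.
have H0 : 0 < H by rewrite powR_gt0// divr_gt0// mulr_gt0.
have HE : H `^ (- alpha) = q / (12 * T).
  rewrite powRN /H -powRrM mulVf ?lt0r_neq0// powRr1 ?invf_div//.
  by rewrite divr_ge0// ltW// mulr_gt0.
(* [ln (2 * r n)] is at most [del * b n] plus a constant and must stay below [e * b n]. *)
pose del := e / 2; have del0 : 0 < del by rewrite divr_gt0.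
pose p := fine (P (xi 0 0 0 0 @^-1` [set n | (0 < n)%N])).
have p0 : 0 < p := offspring_prob_gt0 rF xi_id mu0 mean_xi.
(* The summand 1 gives a positive divisor even when [p = 1]. *)
have lp : 0 < 1 - ln p.
  have : ln p <= 0 by apply: ln_le0; exact: (offspring_prob_le1 rF xi_id).
  by lra.
pose M := Num.max 1 mu.
have M1 : 1 <= M by rewrite le_max lexx.
have lM0 : 0 <= ln M by exact: ln_ge0.
pose K n := (Num.truncn (n%:R * T)).+1.
pose N n := Num.truncn (expR (H * b n)).
pose r n := (Num.truncn (expR (del * b n))).+1.
pose high n := \big[setU/set0]_(k < K n) [set w | H * b n < ln ((J k w)%:R : R)].
pose big n := [set w | expR (del * b n) <= weighted_progeny R xi (K n) (N n) w].
pose dies n := \big[setU/set0]_(k < K n) \big[setU/set0]_(c < N n)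
  block_dies xi (K n) (r n) k c.
have mhigh n : measurable (high n).
  by apply: bigsetU_measurable => k _; exact: measurable_log_gt.
have mbig n : measurable (big n).
  have := measurable_weighted_progeny (R := R) rF (K n) (N n) measurableT
    (measurable_itv `[expR (del * b n), +oo[).
  rewrite setTI; congr measurable; apply/seteqP; split => w /=;
  by rewrite in_itv /= andbT.
have mdies n : measurable (dies n).
  apply: bigsetU_measurable => k _; apply: bigsetU_measurable => c _.
  exact: measurable_block_dies.
exists (fun n => high n `|` (big n `|` dies n)); split.
- by move=> n; apply: measurableU => //; exact: measurableU.
- near=> n.
  have n0 : (0 < n)%N by near: n; exact: nbhs_infty_gt.
  have bn := b_gt0 n0.
  have Nle : (N n)%:R <= expR (H * b n) by rewrite truncn_le expR_ge0.
  have -> : q%:E = ((q / 3)%:E + ((q / 3)%:E + (q / 3)%:E))%E.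
    by rewrite -!EFinD; congr (_%:E); lra.
  apply: prob_setU_le => //; first exact: measurableU.
    apply: (@le_trans _ _ ((K n)%:R * log_tail (H * b n))%:E).
      apply: (@prob_bigsetU_le _ _ _ P (K n)
        (fun k => [set w | H * b n < ln ((J k w)%:R : R)])) => k.
        exact: measurable_log_gt.
      by rewrite log_tailE.
    rewrite lee_fin.
    have nG : n%:R * log_tail (H * b n) <= 2 * H `^ (- alpha).
      have : `|H `^ (- alpha) - n%:R * log_tail (H * b n)| <= H `^ (- alpha).
        by near: n; move/cvgrPdist_le : (tail_b H0); apply; exact: powR_gt0.
      by rewrite ler_norml; lra.
    have G0 : 0 <= log_tail (H * b n) by exact: fine_ge0.
    have Kn : (K n)%:R <= 2 * T * n%:R.
      have tr : (Num.truncn (n%:R * T))%:R <= n%:R * T.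
        by rewrite truncn_le mulr_ge0// ltW.
      have : 1 <= n%:R * T.
        by rewrite -ler_pdivrMr// div1r; near: n; exact: nbhs_infty_ger.
      by move=> nT1; rewrite /K -[leLHS]natr1; lra.
    apply: (@le_trans _ _ (2 * T * (n%:R * log_tail (H * b n)))).
      by rewrite mulrA ler_wpM2r.
    apply: (@le_trans _ _ (2 * T * (2 * H `^ (- alpha)))).
      by rewrite ler_wpM2l// mulr_ge0// ltW.
    by rewrite HE le_eqVlt; apply/orP; left; apply/eqP; field; exact: lt0r_neq0.
  have quad : del ^+ 2 * b n ^+ 2 / 16 <= expR (del * b n / 2).
    have -> : del ^+ 2 * b n ^+ 2 / 16 = (del * b n / 2) ^+ 2 / 4 by field.
    by apply: expR_ge_quadratic; rewrite divr_ge0// mulr_ge0// ltW.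
  have lnN : ln ((N n)%:R : R) <= H * b n.
    have [->|N0] := posnP (N n); first by rewrite ln0// mulr_ge0// ltW.
    by rewrite -[leRHS]expRK ler_ln ?posrE ?ltr0n ?expR_gt0.
  have d20 : 0 < del ^+ 2 by exact: exprn_gt0.
  have b1 : 1 <= b n by near: n; exact: near_b_ge.
  apply: prob_setU_le => //.
    apply: le_trans (weighted_progeny_markov rF iF xi_id mu0 mean_xi _ _ (expR_gt0 _)) _.
    rewrite lee_fin -/M ler_pdivrMr ?expR_gt0//.
    (* The factor [exp (del * b n)] is split in two: one half absorbs [K * K * M^K], the other
       [1 + ln N <= 1 + H * b n]. *)
    have Ksm : (2 + ln M) * (K n)%:R <= del / 2 * b n.
      rewrite -ler_pdivlMl; last by lra.
      rewrite mulrA; near: n; apply: near_horizon_le => //.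
      by rewrite mulr_gt0 ?divr_gt0 ?invr_gt0//; lra.
    have KM : (K n)%:R * ((K n)%:R * M ^+ K n) <= expR (del * b n / 2).
      apply: (@le_trans _ _ (expR (K n)%:R * (expR (K n)%:R * expR (ln M * (K n)%:R)))).
        apply: ler_pM => //; first by rewrite mulr_ge0// exprn_ge0//; lra.
          exact: natr_le_expR.
        apply: ler_pM => //; first by rewrite exprn_ge0//; lra.
          exact: natr_le_expR.
        by rewrite expRM_natr lnK// posrE; lra.
      by rewrite -!expRD ler_expR; lra.
    have b2 : 1 + H * b n <= q / 3 * (del ^+ 2 * b n ^+ 2 / 16).
      have bC : 48 * (1 + H) / (q * del ^+ 2) <= b n by near: n; exact: near_b_ge.
      rewrite ler_pdivrMr ?mulr_gt0// in bC.
      have := ler_wpM2r (ltW bn) bC; nra.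
    have -> : expR (del * b n) = expR (del * b n / 2) * expR (del * b n / 2).
      by rewrite -expRD; congr expR; lra.
    rewrite mulrCA [leRHS]mulrA; apply: ler_pM => //.
    - by rewrite addr_ge0// ln_natr_ge0.
    - by rewrite !mulr_ge0// exprn_ge0//; lra.
    - apply: (@le_trans _ _ (1 + H * b n)); first by lra.
      by apply: (le_trans b2); rewrite ler_wpM2l//; lra.
  have Kb : (K n)%:R <= b n.
    by rewrite -[b n]mul1r; near: n; exact: near_horizon_le.
  apply: (@le_trans _ _ ((K n)%:R * ((N n)%:R * expR (- (p ^+ K n * (r n)%:R))))%:E).
    apply: (@prob_bigsetU_le _ _ _ P (K n) (fun k => \big[setU/set0]_(c < N n)
        block_dies xi (K n) (r n) k c)) => k.
      by apply: bigsetU_measurable => c _; exact: measurable_block_dies.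
    apply: (@prob_bigsetU_le _ _ _ P (N n) (block_dies xi (K n) (r n) k)) => c.
      exact: measurable_block_dies.
    exact: (block_dies_prob rF iF xi_id mu0 mean_xi).
  rewrite lee_fin.
  have Kp : (K n)%:R * (1 - ln p) <= del / 2 * b n.
    rewrite -ler_pdivlMr// mulrAC; near: n; apply: near_horizon_le => //.
    by rewrite !divr_gt0.
  (* The expected number of surviving lines in a block is exponentially large in [b n]. *)
  have pr : expR (del * b n / 2) <= p ^+ K n * (r n)%:R.
    have pE : p ^+ K n = expR (ln p * (K n)%:R) by rewrite expRM_natr lnK.
    apply: (@le_trans _ _ (expR (ln p * (K n)%:R) * expR (del * b n))).
      rewrite -expRD ler_expR; have : 0 <= (K n)%:R :> R by []; lra.
    by rewrite -pE ler_wpM2l ?exprn_ge0 ?(ltW p0)//; exact/ltW/truncnS_gt.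
  (* There are at most [exp ((1 + H) * b n)] blocks, and each dies with a probability whose exponent
     is quadratic in [b n]. *)
  have quad_wins : (1 + H) * b n - del ^+ 2 * b n ^+ 2 / 16 <= - b n.
    have bC : 16 * (2 + H) / del ^+ 2 <= b n by near: n; exact: near_b_ge.
    rewrite ler_pdivrMr// in bC.
    have := ler_wpM2r (ltW bn) bC; nra.
  apply: (@le_trans _ _ (expR (b n) * (expR (H * b n) * expR (- (del ^+ 2 * b n ^+ 2 / 16))))).
    apply: ler_pM; [by []|by rewrite mulr_ge0// expR_ge0| |].
    - apply: (le_trans Kb); have := expR_ge1Dx (b n); lra.
    - apply: ler_pM; [by []|exact: expR_ge0|exact: Nle|].
      by rewrite ler_expR lerN2 (le_trans quad).
  rewrite -!expRD; apply: (@le_trans _ _ (expR (- b n))).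
    by rewrite ler_expR; lra.
  rewrite expRN -[leRHS]invrK lef_pV2 ?posrE ?expR_gt0 ?invr_gt0 ?divr_gt0//.
  have bq : (q / 3)^-1 <= b n by near: n; exact: near_b_ge.
  by apply: (le_trans bq); have := expR_ge1Dx (b n); lra.
- near=> n => w /not_orP[nhigh /not_orP[nbig ndies]].
  have n0 : (0 < n)%N by near: n; exact: nbhs_infty_gt.
  have bn := b_gt0 n0.
  apply: (@tracks_of_population_bounds T e H del (b n) n (r n) (K n) (N n)) => //.
  + by rewrite /del; lra.
  + have rle : (r n)%:R <= 2 * expR (del * b n).
      have := truncn_le (expR (del * b n)); rewrite expR_ge0 => tr.
      rewrite /r -[leLHS]natr1 (_ : 2 * _ = expR (del * b n) + expR (del * b n)).
        apply: lerD; first exact: tr.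
        by have := expR_ge1Dx (del * b n); have := mulr_ge0 (ltW del0) (ltW bn); lra.
      by lra.
    apply: (@le_trans _ _ (ln (4 * expR (del * b n)))).
      rewrite ler_ln ?posrE ?mulr_gt0 ?expR_gt0//; lra.
    rewrite lnM ?posrE ?expR_gt0// expRK.
    have b4 : ln 4 / del <= b n by near: n; exact: near_b_ge.
    rewrite ler_pdivrMr// in b4; rewrite /del in b4 *; lra.
  + exact: truncnS_gt.
  + move=> x xH; rewrite /N truncn_ge_nat ?expR_ge0//.
    have [->|x0] := posnP x; first exact: expR_ge0.
    by rewrite -ler_ln ?posrE ?ltr0n ?expR_gt0// expRK.
  + move=> k kK; rewrite leNgt; apply/negP => kH; apply: nhigh.
    rewrite /high -(bigcup_mkord (K n) (fun k => [set w | H * b n < ln ((J k w)%:R : R)])).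
    by exists k.
  + by rewrite ltNge; apply/negP.
  + move=> k c kK cN dk; apply: ndies.
    rewrite /dies -(bigcup_mkord (K n) (fun k => \big[setU/set0]_(c < N n)
      block_dies xi (K n) (r n) k c)); exists k => //.
    by rewrite -(bigcup_mkord (N n) (block_dies xi (K n) (r n) k)); exists c.
Unshelve. all: by end_near. Qed.

End prelimit_tracks.

(** * The points (k / n, log J_k / b_n) *)

Section product_exponential.
Variable R : realType.

Lemma prod_1B_le_expR (K : nat) (q : nat -> R) : (forall k, 0 <= q k <= 1) ->
  \prod_(k < K) (1 - q k) <= expR (- \sum_(k < K) q k).
Proof.
move=> q01; rewrite -sumrN expR_sum; apply: ler_prod => k _.
have /andP[q0 q1] := q01 k; rewrite subr_ge0 q1 /=.
exact: expR_ge1Dx.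
Qed.

(** Factorwise, [1 / (1 - q) = 1 + q / (1 - q) <= exp (q / (1 - del))]. *)
Lemma expR_le_prod_1B (K : nat) (q : nat -> R) (del : R) : del < 1 ->
  (forall k, 0 <= q k <= del) ->
  expR (- ((\sum_(k < K) q k) / (1 - del))) <= \prod_(k < K) (1 - q k).
Proof.
move=> del1 q01; rewrite mulr_suml -sumrN expR_sum; apply: ler_prod => k _.
rewrite expR_ge0 /=; have /andP[q0 q1] := q01 k.
have d0 : 0 < 1 - del by lra.
have dq : 0 < 1 - q k by lra.
rewrite expRN -[leRHS]invrK lef_pV2 ?posrE ?expR_gt0 ?invr_gt0//.
apply: le_trans (expR_ge1Dx _).
rewrite -div1r ler_pdivrMr//.
have : q k <= q k / (1 - del) * (1 - q k).
  rewrite mulrAC ler_pdivlMr// ler_wpM2l//; lra.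
by rewrite mulrDl mul1r; lra.
Qed.

(** The sum is the ceiling of [y]. *)
Lemma count_below (K : nat) (y : R) : 0 <= y <= K%:R ->
  y <= \sum_(k < K) (k%:R < y)%R%:R < y + 1.
Proof.
elim: K => [|K IH] /andP[y0 yK].
  have -> : y = 0 by apply/eqP; rewrite eq_le yK.
  by rewrite big_ord0 lexx add0r ltr01.
rewrite big_ord_recr /=; have [yK'|Ky] := leP y K%:R.
  by rewrite addr0; apply: IH; rewrite y0.
rewrite (eq_bigr (fun=> 1)) => [|k _]; last first.
  by rewrite (lt_trans _ Ky)// ltr_nat.
rewrite sumr_const card_ord natr1 yK /= -natr1 ltrD2r//.
Qed.

Lemma count_between (K : nat) (x y : R) : 0 <= x -> x <= y -> y <= K%:R ->
  `|\sum_(k < K) (x <= k%:R < y)%R%:R - (y - x)| <= 1.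
Proof.
move=> x0 xy yK.
have -> : \sum_(k < K) (x <= k%:R < y)%R%:R =
    \sum_(k < K) (k%:R < y)%R%:R - \sum_(k < K) (k%:R < x)%R%:R :> R.
  rewrite -sumrB; apply: eq_bigr => k _.
  have [xk|kx] := leP x k%:R; first by rewrite subr0.
  by rewrite (lt_le_trans kx xy) subrr.
have := @count_below K y; have := @count_below K x.
rewrite x0 (le_trans xy yK) (le_trans x0 xy) yK => /(_ isT) + /(_ isT).
rewrite ler_norml; lra.
Qed.

End product_exponential.

Section prelimit_points.
Variable R : realType.
Context d (Omega : measurableType d) (P : probability Omega R).
Variables (xi : nat -> nat -> nat -> nat -> Omega -> nat) (J : nat -> Omega -> nat).
Hypothesis rF : forall ix, nat_rv (GWI_family xi J ix).
Hypothesis iF : mutually_independent P (GWI_family xi J).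
Hypothesis J_id : forall k k' (A : set nat), P (J k @^-1` A) = P (J k' @^-1` A).
Variables (alpha : R) (b : nat -> R).
Hypothesis b_gt0 : forall n, (0 < n)%N -> 0 < b n.
Hypothesis tail_b : forall y : R, 0 < y ->
  n%:R * log_tail P J (y * b n) @[n --> \oo] --> y `^ (- alpha).

Local Notation G := (log_tail P J).

Definition point_time (n k : nat) (w : Omega) : R := k%:R / n%:R.
Definition point_mark (n k : nat) (w : Omega) : \bar R := (ln (J k w)%:R / b n)%:E.

Let rJ k : nat_rv (J k). Proof. exact: (rF (inr k)). Qed.

Lemma measurable_point_time n k : measurable_fun setT (point_time n k).
Proof. exact: measurable_cst. Qed.

Lemma measurable_point_mark n k : measurable_fun setT (point_mark n k).
Proof.
move=> _ A mA; rewrite setTI.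
exact: (rJ k [set x : nat | A (ln (x%:R : R) / b n)%:E]).
Qed.

Let mt := measurable_point_time.
Let mj := measurable_point_mark.

Lemma point_mark_gt n k w y : (0 < n)%N ->
  (y%:E < point_mark n k w)%E = (y * b n < ln (J k w)%:R).
Proof. by move=> n0; rewrite lte_fin ltr_pdivlMr// b_gt0. Qed.

Let G0 x : 0 <= G x. Proof. exact: fine_ge0. Qed.

Let G1 x : G x <= 1.
Proof.
rewrite -lee_fin -(log_tailE rF J_id 0); apply: probability_le1.
exact: (measurable_log_gt rF 0).
Qed.

Lemma near_tail_le (y c : R) : 0 < y -> 1 < c ->
  \forall n \near \oo, n%:R * G (y * b n) <= c * y `^ (- alpha).
Proof.
move=> y0 c1; have ya : 0 < y `^ (- alpha) by exact: powR_gt0.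
have := tail_b y0; move/cvgrPdist_le => /(_ ((c - 1) * y `^ (- alpha))).
move=> /(_ (mulr_gt0 _ ya))/wrap[|]; first by rewrite subr_gt0.
by apply: filterS => n; rewrite ler_norml; lra.
Qed.

Lemma tail_cvg0 (y : R) : 0 < y -> G (y * b n) @[n --> \oo] --> (0 : R).
Proof.
move=> y0; have ya : 0 < y `^ (- alpha) by exact: powR_gt0.
apply/cvgrPdist_le => e e0; near=> n.
have n0 : (0 < n)%N by near: n; exact: nbhs_infty_gt.
have n0R : (0 : R) < n%:R by rewrite ltr0n.
rewrite sub0r normrN ger0_norm//.
have : n%:R * G (y * b n) <= 2 * y `^ (- alpha).
  by near: n; apply: near_tail_le; rewrite // ltr1n.
have ne : 2 * y `^ (- alpha) / e <= n%:R by near: n; exact: nbhs_infty_ger.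
rewrite ler_pdivrMr// in ne; move=> /le_trans/(_ ne).
by rewrite ler_pM2l.
Unshelve. all: by end_near. Qed.

Lemma prelimit_neg n : P (ev_neg (point_time n)) = 0%E.
Proof.
rewrite (_ : ev_neg _ = set0) ?measure0//; apply/seteqP; split => // w [k _ /=].
by rewrite /point_time ltNge divr_ge0.
Qed.

Lemma prelimit_high (T H : R) : 0 < T -> 0 < H -> \forall n \near \oo,
  (P (ev_high (point_time n) (point_mark n) T H) <= (2 * (T * H `^ (- alpha)))%:E)%E.
Proof.
move=> T0 H0; near=> n.
have n0 : (0 < n)%N by near: n; exact: nbhs_infty_gt.
have n0R : (0 : R) < n%:R by rewrite ltr0n.
pose K := (Num.truncn (n%:R * T)).+1.
apply: (@le_trans _ _ (P (\big[setU/set0]_(k < K)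
    [set w | H * b n < ln ((J k w)%:R : R)]))).
  apply: le_measure; rewrite ?inE.
  - by apply: measurable_ev_high => k; [exact: mt|exact: mj].
  - by apply: bigsetU_measurable => k _; exact: (measurable_log_gt rF).
  move=> w [k _ /= []]; rewrite point_mark_gt// /point_time ltr_pdivrMr// => kT kH.
  rewrite -(bigcup_mkord K (fun k => [set w | H * b n < ln ((J k w)%:R : R)])).
  exists k => //=; rewrite ltnS truncn_ge_nat ?mulr_ge0 ?(ltW T0)//.
  by rewrite mulrC ltW.
apply: (@le_trans _ _ (K%:R * G (H * b n))%:E).
  apply: (@prob_bigsetU_le _ _ _ P K
    (fun k => [set w | H * b n < ln ((J k w)%:R : R)])) => k.
    exact: (measurable_log_gt rF).
  by rewrite (log_tailE rF J_id).
rewrite lee_fin.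
have KT : K%:R <= 5 / 4 * T * n%:R.
  have tr : (Num.truncn (n%:R * T))%:R <= n%:R * T.
    by rewrite truncn_le mulr_ge0// ltW.
  have : 4 / T <= n%:R by near: n; exact: nbhs_infty_ger.
  rewrite ler_pdivrMr// => nT; rewrite /K -[leLHS]natr1; lra.
have nG : n%:R * G (H * b n) <= 5 / 4 * H `^ (- alpha).
  by near: n; apply: near_tail_le => //; lra.
have Ha : 0 < H `^ (- alpha) by exact: powR_gt0.
apply: (@le_trans _ _ (5 / 4 * T * (n%:R * G (H * b n)))).
  by rewrite mulrA ler_wpM2r.
apply: (@le_trans _ _ (5 / 4 * T * (5 / 4 * H `^ (- alpha)))).
  by rewrite ler_wpM2l// mulr_ge0// ltW.
have := mulr_gt0 T0 Ha; lra.
Unshelve. all: by end_near. Qed.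

(** At most one index has its time exactly on the edge, so a single tail probability, which tends to
    0, is the bound. *)
Lemma prelimit_edge (h e : R) (a : nat) (q : R) : 0 < h -> 0 < e -> 0 < q ->
  \forall n \near \oo, (P (ev_edge (point_time n) (point_mark n) h e a) <= q%:E)%E.
Proof.
move=> h0 e0 q0; near=> n.
have n0 : (0 < n)%N by near: n; exact: nbhs_infty_gt.
have n0R : (0 : R) < n%:R by rewrite ltr0n.
have Gq : G (e * b n) <= q.
  have : `|0 - G (e * b n)| <= q.
    by near: n; move/cvgrPdist_le : (tail_cvg0 e0); apply.
  by rewrite sub0r normrN ger0_norm.
have [[k0 kE]|nk] := pselect (exists k : nat, k%:R / n%:R = a%:R * h).
  apply: (@le_trans _ _ (P [set w | e * b n < ln ((J k0 w)%:R : R)])); last first.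
    by rewrite (log_tailE rF J_id).
  apply: le_measure; rewrite ?inE.
  - by apply: measurable_ev_edge => k; [exact: mt|exact: mj].
  - exact: (measurable_log_gt rF).
  move=> w [k _ /= []]; rewrite point_mark_gt// /point_time => kE' kj.
  suff <- : k = k0 by [].
  have n1 : (n%:R^-1 : R) != 0 by rewrite invr_eq0 lt0r_neq0.
  by apply/eqP; rewrite -(eqr_nat R) -(inj_eq (mulIf n1)) kE' kE.
rewrite (_ : ev_edge _ _ _ _ _ = set0) ?measure0 ?lee_fin ?ltW//.
by apply/seteqP; split => // w [k _ /= [kE _]]; apply: nk; exists k.
Unshelve. all: by end_near. Qed.

Lemma two_large_marks k k' x : k != k' ->
  P ([set w | x < ln ((J k w)%:R : R)] `&` [set w | x < ln ((J k' w)%:R : R)]) =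
  (G x ^+ 2)%:E.
Proof.
move=> kk'.
have us : uniq [:: (inr k : (nat * nat * nat * nat) + nat); inr k'].
  by rewrite /= inE andbT; apply: contra kk' => /eqP[->].
have := iF (fun=> [set y : nat | x < ln (y%:R : R)]) us.
rewrite !big_cons big_nil mule1 /=.
rewrite (log_tailE rF J_id k) (log_tailE rF J_id k') -EFinM => H.
rewrite expr2 -H; congr (P _); apply/seteqP; split => w /=.
  by move=> [H1 H2] i; rewrite !inE => /orP[/eqP->|/eqP->].
by move=> H1; split; [apply: (H1 (inr k))|apply: (H1 (inr k'))]; rewrite !inE eqxx ?orbT.
Qed.

(** A union bound over ordered pairs of the at most [L] indices in the column. *)
Lemma prelimit_pair (h e : R) (a : nat) : 0 < h -> 0 < e ->
  \forall n \near \oo, (P (ev_pair (point_time n) (point_mark n) h e a) <=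
    (2 * (h * e `^ (- alpha)) ^+ 2)%:E)%E.
Proof.
move=> h0 e0; near=> n.
have n0 : (0 < n)%N by near: n; exact: nbhs_infty_gt.
have n0R : (0 : R) < n%:R by rewrite ltr0n.
pose x := n%:R * (a%:R * h).
have x0 : 0 <= x by rewrite !mulr_ge0// ltW.
(* One extra index for the truncation of [n * h], one because the column need not start at an
   index. *)
pose k0 := Num.truncn x; pose L := (Num.truncn (n%:R * h)).+2.
pose E k := [set w | e * b n < ln ((J k w)%:R : R)].
have mE k : measurable (E k) by exact: (measurable_log_gt rF).
pose E2 (i i' : nat) := if i == i' then set0 else E (k0 + i)%N `&` E (k0 + i')%N.
pose F i := \big[setU/set0]_(i' < L) E2 i i'.
have mE2 i i' : measurable (E2 i i').
  by rewrite /E2; case: ifP => // _; exact: measurableI.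
have nh0 : 0 <= n%:R * h by rewrite mulr_ge0// ltW.
have col k : a%:R * h <= k%:R / n%:R < a.+1%:R * h ->
    exists2 i, (i < L)%N & k = (k0 + i)%N.
  rewrite ler_pdivlMr// ltr_pdivrMr// => /andP[k1 k2].
  have k0x : k0%:R <= x by rewrite truncn_le.
  have xk0 : x < k0.+1%:R by exact: truncnS_gt.
  have k0k : (k0 <= k)%N by rewrite -(ler_nat R) (le_trans k0x)// /x mulrC.
  exists (k - k0)%N; last by rewrite subnKC.
  rewrite ltnS -ltnS -(ltr_nat R) natrB//.
  have := truncnS_gt (n%:R * h).
  move: k2 xk0; rewrite /L -!natr1 /x mulrDl mul1r; lra.
apply: (@le_trans _ _ (P (\big[setU/set0]_(i < L) F i))).
  apply: le_measure; rewrite ?inE.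
  - by apply: measurable_ev_pair => k; [exact: mt|exact: mj].
  - by apply: bigsetU_measurable => i _; apply: bigsetU_measurable.
  move=> w [k _ [k' /= kk' [[/col[i iL kE] kj] [/col[i' iL' kE'] kj']]]].
  rewrite -(bigcup_mkord L F); exists i => //.
  rewrite /F -(bigcup_mkord L (E2 i)); exists i' => //; rewrite /E2.
  case: eqP => [ii|_]; first by rewrite kE kE' ii ltnn in kk'.
  by move: kj kj'; rewrite !point_mark_gt// kE kE'.
apply: (@le_trans _ _ (L%:R * (L%:R * G (e * b n) ^+ 2))%:E).
  apply: (@prob_bigsetU_le _ _ _ P L F) => i.
    by apply: bigsetU_measurable.
  apply: (@prob_bigsetU_le _ _ _ P L (E2 i)) => i' //.
  rewrite /E2; case: eqP => [_|/eqP ii]; first by rewrite measure0 lee_fin sqr_ge0.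
  by rewrite /E two_large_marks// eqn_add2l.
rewrite lee_fin mulrA -expr2 -exprMn.
have Ha : 0 < e `^ (- alpha) by exact: powR_gt0.
(* [7 / 5] is [7 / 6] times [6 / 5], and its square is below the factor 2 of the claim. *)
have LG : L%:R * G (e * b n) <= 7 / 5 * (h * e `^ (- alpha)).
  have LT : L%:R <= 7 / 6 * h * n%:R.
    have tr : (Num.truncn (n%:R * h))%:R <= n%:R * h by rewrite truncn_le.
    have : 12 / h <= n%:R by near: n; exact: nbhs_infty_ger.
    rewrite ler_pdivrMr// => nT.
    have -> : L%:R = (Num.truncn (n%:R * h))%:R + 2 :> R by rewrite -natrD addn2.
    by lra.
  have nG : n%:R * G (e * b n) <= 6 / 5 * e `^ (- alpha).
    by near: n; apply: near_tail_le => //; lra.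
  apply: (@le_trans _ _ (7 / 6 * h * (n%:R * G (e * b n)))).
    by rewrite mulrA ler_wpM2r.
  apply: (@le_trans _ _ (7 / 6 * h * (6 / 5 * e `^ (- alpha)))).
    by rewrite ler_wpM2l// mulr_ge0// ltW.
  by lra.
have := mulr_gt0 h0 Ha; have : 0 <= L%:R * G (e * b n) by rewrite mulr_ge0.
move: LG; move: (L%:R * G _) (h * _) => u v uv u0 v0.
have : u ^+ 2 <= (7 / 5 * v) ^+ 2 by rewrite lerXn2r// nnegrE//; lra.
rewrite exprMn; have := sqr_ge0 v; lra.
Unshelve. all: by end_near. Qed.

(** Independence turns the void probability into a product of [1 - q n k], which lies between two
    exponentials of the sum of the [q n k]. A column holds [n * h] indices up to an error of 1, and
    this determines the limit of the sum. *)
Lemma prelimit_clear (h : R) (A : nat) (D : pred 'I_A) (y : 'I_A -> R) :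
  0 < h -> (forall a, 0 < y a) ->
  fine (P (ev_clear (point_time n) (point_mark n) h D y)) @[n --> \oo] -->
  expR (- \sum_(a | D a) h * y a `^ (- alpha)).
Proof.
move=> h0 y0.
pose K n := (Num.truncn (n%:R * (A%:R * h))).+1.
pose incol n (a : 'I_A) (k : nat) := ((a%:R * h : R) <= k%:R / n%:R < a.+1%:R * h).
(* Columns are disjoint, so at most one summand is nonzero. *)
pose q n k := \sum_(a | D a) (incol n a k)%:R * G (y a * b n).
pose del n := \sum_(a | D a) G (y a * b n).
have incol_inj n a a' k : incol n a k -> incol n a' k -> a = a'.
  move=> /andP[k1 k2] /andP[k1' k2'].
  have := le_lt_trans k1 k2'; have := le_lt_trans k1' k2.
  rewrite !ltr_pM2r// !ltr_nat !ltnS => aa a'a.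
  by apply/val_inj/eqP; rewrite eqn_leq aa a'a.
have qdel n k : 0 <= q n k <= del n.
  apply/andP; split; first by apply: sumr_ge0 => a _; rewrite mulr_ge0.
  by apply: ler_sum => a _; rewrite ler_piMl// lern1 leq_b1.
have q1 n k : q n k <= 1.
  rewrite /q; have [[a /andP[Da ka]]|nk] := pselect (exists a, D a && incol n a k).
    rewrite (bigD1 a)//= ka mul1r big1 ?addr0// => a' /andP[_ aa'].
    case: (boolP (incol n a' k)) => [ka'|_]; last by rewrite mul0r.
    by rewrite (incol_inj _ _ _ _ ka ka') eqxx in aa'.
  rewrite big1// => a Da; case: (boolP (incol n a k)) => [ka|_]; last by rewrite mul0r.
  by exfalso; apply: nk; exists a; rewrite Da.
have clearE n : (0 < n)%N ->
    fine (P (ev_clear (point_time n) (point_mark n) h D y)) = \prod_(k < K n) (1 - q n k).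
  move=> n0; have n0R : (0 : R) < n%:R by rewrite ltr0n.
  pose B k := [set x : nat | forall a, D a -> incol n a k -> ln (x%:R : R) <= y a * b n].
  pose s := [seq (inr k : (nat * nat * nat * nat) + nat) | k <- iota 0 (K n)].
  have us : uniq s by rewrite map_inj_uniq ?iota_uniq// => ? ? [].
  have := iF (fun i => if i is inr k then B k else setT) us.
  rewrite (_ : [set w | _] = ev_clear (point_time n) (point_mark n) h D y).
    move=> ->; rewrite /s big_map -[iota 0 (K n)]/(index_iota 0 (K n)) big_mkord.
    rewrite (eq_bigr (fun k : 'I_(K n) => (1 - q n k)%:E)) ?prodEFin// => k _.
    have mB : measurable (J k @^-1` B k) by exact: rJ.
    have [[a /andP[Da ka]]|nk] := pselect (exists a, D a && incol n a k).
      have -> : J k @^-1` B k = ~` [set w | y a * b n < ln ((J k w)%:R : R)].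
        apply/seteqP; split => w /=.
          by move=> Bw; apply/negP; rewrite -leNgt; exact: Bw.
        move=> /negP; rewrite -leNgt => le a' Da' ka'.
        by rewrite -(incol_inj _ _ _ _ ka ka').
      rewrite probability_setC; last exact: (measurable_log_gt rF).
      rewrite (log_tailE rF J_id) EFinB; congr (_ - _%:E)%E.
      rewrite /q (bigD1 a)//= ka mul1r big1 ?addr0// => a' /andP[_ aa'].
      case: (boolP (incol n a' k)) => [ka'|_]; last by rewrite mul0r.
      by rewrite (incol_inj _ _ _ _ ka ka') eqxx in aa'.
    have -> : J k @^-1` B k = setT.
      apply/seteqP; split => // w _ a Da ka; exfalso; apply: nk.
      by exists a; rewrite Da.
    rewrite probability_setT /q big1 ?subr0// => a Da.
    case: (boolP (incol n a k)) => [ka|_]; last by rewrite mul0r.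
    by exfalso; apply: nk; exists a; rewrite Da.
  apply/seteqP; split => w /=.
    move=> H a Da k ka; rewrite leNgt point_mark_gt// -leNgt.
    have kK : (k < K n)%N.
      rewrite ltnS truncn_ge_nat; last by rewrite !mulr_ge0// ltW.
      have /andP[_] := ka; rewrite /point_time ltr_pdivrMr// => kA.
      apply: (le_trans (ltW kA)); rewrite mulrC ler_pM2l// ler_pM2r// ler_nat.
      exact: ltn_ord.
    by apply: (H (inr k)) => //; rewrite map_f// mem_iota.
  move=> H _ /mapP[k _ ->] a Da ka.
  by have := H a Da k ka; rewrite leNgt point_mark_gt// -leNgt.
have delc : del n @[n --> \oo] --> (0 : R).
  rewrite (_ : (0 : R) = \sum_(a | D a) 0); last by rewrite big1.
  apply: cvg_big; first exact: add_continuous.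
  by move=> a _; exact: tail_cvg0.
pose cnt n a : R := \sum_(k < K n) (incol n a k)%:R.
have sumE n : \sum_(k < K n) q n k = \sum_(a | D a) cnt n a * G (y a * b n).
  by rewrite /q exchange_big /=; apply: eq_bigr => a _; rewrite mulr_suml.
have cntb n a : (0 < n)%N -> `|cnt n a - n%:R * h| <= 1.
  move=> n0; have n0R : (0 : R) < n%:R by rewrite ltr0n.
  have := @count_between R (K n) (n%:R * (a%:R * h)) (n%:R * (a.+1%:R * h)).
  have -> : n%:R * (a.+1%:R * h) - n%:R * (a%:R * h) = n%:R * h.
    by rewrite -[a.+1%:R]natr1; ring.
  move=> /(_ _ _ _)/wrap[].
  - by rewrite !mulr_ge0// ltW.
  - by rewrite ler_pM2l// ler_pM2r// ler_nat.
  - apply: le_trans (ltW (truncnS_gt _)).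
    by rewrite ler_pM2l// ler_pM2r// ler_nat ltn_ord.
  move=> H; rewrite (le_trans _ H)// le_eqVlt; apply/orP; left; apply/eqP.
  congr (`|_ - _|); apply: eq_bigr => k _.
  by rewrite /incol ler_pdivlMr// ltr_pdivrMr// ![n%:R * _]mulrC.
have sumc : \sum_(k < K n) q n k @[n --> \oo] --> \sum_(a | D a) h * y a `^ (- alpha).
  under eq_fun do rewrite sumE.
  apply: cvg_big; first exact: add_continuous.
  move=> a _.
  have c1 : h * (n%:R * G (y a * b n)) - G (y a * b n) @[n --> \oo] --> h * y a `^ (- alpha).
    rewrite -[X in _ --> X]subr0; apply: cvgB; last exact: tail_cvg0.
    by apply: cvgM; [exact: cvg_cst|exact: tail_b].
  have c2 : h * (n%:R * G (y a * b n)) + G (y a * b n) @[n --> \oo] --> h * y a `^ (- alpha).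
    rewrite -[X in _ --> X]addr0; apply: cvgD; last exact: tail_cvg0.
    by apply: cvgM; [exact: cvg_cst|exact: tail_b].
  apply: (squeeze_cvgr _ c1 c2); near=> n.
  have n0 : (0 < n)%N by near: n; exact: nbhs_infty_gt.
  have := cntb n a n0; rewrite ler_norml => /andP[l1 l2].
  have := ler_wpM2r (G0 (y a * b n)) l1; have := ler_wpM2r (G0 (y a * b n)) l2.
  by lra.
have low : expR (- ((\sum_(k < K n) q n k) / (1 - del n))) @[n --> \oo] -->
    expR (- \sum_(a | D a) h * y a `^ (- alpha)).
  apply: continuous_cvg; first exact: continuous_expR.
  apply: cvgN; rewrite -[X in _ --> X]divr1; apply: cvgM => //.
  apply: cvgV; first exact: oner_neq0.
  by rewrite -[X in _ --> X]subr0; apply: cvgB => //; exact: cvg_cst.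
have up : expR (- \sum_(k < K n) q n k) @[n --> \oo] -->
    expR (- \sum_(a | D a) h * y a `^ (- alpha)).
  by apply: continuous_cvg; [exact: continuous_expR|exact: cvgN].
apply: (squeeze_cvgr _ low up); near=> n.
have n0 : (0 < n)%N by near: n; exact: nbhs_infty_gt.
rewrite clearE//; apply/andP; split.
  apply: expR_le_prod_1B => //.
  have : `|0 - del n| < 1 by near: n; move/cvgrPdist_lt : delc; apply.
  by rewrite sub0r normrN => /(le_lt_trans (ler_norm _)).
by apply: prod_1B_le_expR => k; rewrite q1 andbT; have /andP[] := qdel n k.
Unshelve. all: by end_near. Qed.

End prelimit_points.

(** * Conclusion *)

Lemma cadlag_scaled_sequence (R : realType) (g : nat -> R) (n : nat) : (0 < n)%N ->
  cadlag (fun t => g (Num.truncn (n%:R * t))).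
Proof.
move=> n0; have n0R : (0 : R) < n%:R by rewrite ltr0n.
apply: cadlag_of_local_osc => e u e0 u0.
  have nu0 : 0 <= n%:R * u by rewrite mulr_ge0// ltW.
  have /andP[m1 m2] := truncn_itv nu0.
  set m := Num.truncn (n%:R * u) in m1 m2 *.
  exists (m.+1%:R / n%:R); first by rewrite ltr_pdivlMr// mulrC.
  move=> v /andP[uv]; rewrite ltr_pdivlMr// mulrC => vm.
  rewrite (truncn_def (n := m)) ?subrr ?normr0 ?(ltW e0)// vm andbT.
  by apply: (le_trans m1); rewrite ler_pM2l.
have nu0 : 0 < n%:R * u by rewrite mulr_gt0.
(* The largest integer strictly below [n * u]; it differs from the truncation when [n * u] is an
   integer. *)
have [m /andP[m1 m2]] : exists m : nat, m%:R < n%:R * u <= m.+1%:R.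
  have /andP[t1 t2] := truncn_itv (ltW nu0).
  set k := Num.truncn (n%:R * u) in t1 t2.
  move: t1; rewrite le_eqVlt => /predU1P[kE|kl]; last by exists k; rewrite kl ltW.
  move: kE; case: k {t2} => [kE|k kE]; first by rewrite -kE ltxx in nu0.
  by exists k; rewrite -kE lexx ltr_nat ltnSn.
exists (m%:R / n%:R); first by rewrite ltr_pdivrMr// mulrC.
have trE v : m%:R / n%:R < v < u -> Num.truncn (n%:R * v) = m.
  rewrite ltr_pdivrMr// => /andP[mv vu]; apply: truncn_def.
  by rewrite mulrC ltW//= mulrC (lt_le_trans _ m2)// ltr_pM2l.
by move=> v v' /trE -> /trE ->; rewrite subrr normr0 ltW.
Qed.

Theorem theorem2 (R : realType)
  (* the probability space carrying the process *)
  (d : measure_display) (Omega : measurableType d) (P : probability Omega R)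
  (* offspring numbers xi i k m l and immigrant numbers J k *)
  (xi : nat -> nat -> nat -> nat -> Omega -> nat) (J : nat -> Omega -> nat)
  (mu : R) (alpha : R) (l : R -> R) (b : nat -> R)
  (* a probability space carrying the limiting Poisson random measure *)
  (d' : measure_display) (Omega' : measurableType d') (Q : probability Omega' R)
  (mu1a : measure (\bar R) R)
  (tp : nat -> Omega' -> R) (jp : nat -> Omega' -> \bar R) :
  (* all xi's and J's are random variables, mutually independent *)
  (forall ix, nat_rv (GWI_family xi J ix)) ->
  mutually_independent P (GWI_family xi J) ->
  (* the xi's are identically distributed, the J's are identically distributed *)
  (forall i k m n i' k' m' n' (A : set nat),
      P (xi i k m n @^-1` A) = P (xi i' k' m' n' @^-1` A)) ->
  (forall k k' (A : set nat), P (J k @^-1` A) = P (J k' @^-1` A)) ->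
  (* offspring mean mu in (0,oo) *)
  0 < mu ->
  (\int[P]_w ((xi 1%N 0%N 0%N 0%N w)%:R : R)%:E)%E = mu%:E ->
  (* P{J = 0} < 1 *)
  (P (J 0%N @^-1` [set 0%N]) < 1)%E ->
  (* P{log J > x} ~ x^-alpha l(x) *)
  0 < alpha <= 1 ->
  slowly_varying l ->
  (fine (P [set w | x < ln (J 0 w)%:R]) / (x `^ (- alpha) * l x))
     @[x --> +oo] --> (1 : R) ->
  (alpha = 1 -> l x @[x --> +oo] --> +oo) ->
  (* normalizing sequence *)
  (forall n, (0 < n)%N -> 0 < b n) ->
  (n%:R * fine (P [set w | b n < ln (J 0 w)%:R])) @[n --> \oo] --> (1 : R) ->
  (* the limit: N^{(1,alpha)} = sum_k eps_{(tp k, jp k)} is a PRM with mean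
     measure Leb x mu_{1,alpha} on [0,oo) x (0,oo] *)
  is_mu_ab 1 alpha mu1a ->
  is_PRM Q tp jp (mean_measure mu1a) ->
  D_weak_cvg P
    (fun n w t => logp (GWI xi J (Num.truncn (n%:R * t)) w)%:R / b n)
    Q (sup_process tp jp).
Proof.
move=> rF iF xi_id J_id mu0 mean_xi _ alpha01 lsv tail_l l1 b_gt0 tail_b prm_mu prm.
have [alpha0 _] := andP alpha01.
have rJ : nat_rv (J 0%N) := rF (inr 0%N).
pose G : R -> R := log_tail P J.
have mG x : measurable [set w | x < ln ((J 0%N w)%:R : R)].
  exact: (measurable_log_gt rF 0%N).
have G_ge0 x : 0 <= G x by exact: fine_ge0.
have G_le : {homo G : x y /~ x <= y}.
  move=> x y yx; apply: fine_le; [exact: fin_num_measure|exact: fin_num_measure|].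
  by apply: le_measure; rewrite ?inE// => w /=; exact: le_lt_trans.
have b_oo := normalizers_cvg_pinfty G_le G_ge0 tail_l tail_b.
have b_lin := normalizers_superlinear G_le G_ge0 alpha01 lsv tail_l l1 b_gt0 tail_b.
have tail_y := tail_scaled G_le G_ge0 lsv tail_l tail_b.
have [mt [mj _]] := prm.
apply: weak_cvg_of_cells; last first.
  near=> n => w.
  apply: (@cadlag_scaled_sequence R (fun m => logp (GWI xi J m w)%:R / b n)).
  by near: n; exact: nbhs_infty_gt.
apply: (@cell_approximation_of_points R _ _ P _ (@point_time R _ Omega)
  (point_mark J b) _ _ Q _ tp jp alpha) => //.
- by move=> n k; exact: measurable_point_time.
- by move=> n k; exact: (measurable_point_mark rF).
- move=> h A D y h0 y0; rewrite (prm_clear prm_mu prm)//.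
  exact: (prelimit_clear rF iF J_id b_gt0 tail_y).
- by move=> n; exact: prelimit_neg.
- exact: (prm_neg prm).
- by move=> h e a; exact: (prelimit_pair rF iF J_id b_gt0 tail_y).
- by move=> h e a; exact: (prm_pair prm_mu prm).
- by move=> h e a q; exact: (prelimit_edge rF J_id b_gt0 tail_y).
- by move=> h e a _; exact: (prm_edge prm_mu prm).
- by move=> T H; exact: (prelimit_high rF J_id b_gt0 tail_y).
- by move=> T H; exact: (prm_high prm_mu prm).
- move=> T e q; exact: (prelimit_tracks rF iF xi_id J_id mu0 mean_xi alpha0
    b_gt0 b_oo b_lin tail_y).
- exact: (prm_tracks prm_mu prm).
Unshelve. all: by end_near. Qed.
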